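(* Let $Y$ be a Lévy process in $\mathbb{R}^d$ with generating triplet $(A,N,b)$ and with $h(0^+)=\infty$. Each of the following (mutually equivalent) conditions (C1)–(C4) is equivalent to (C7). (C1) The density $p(t,x)$ of $Y_t$ exists and there are $T_1\in(0,\infty]$, $c_1>0$ such that $\sup_{x\in\mathbb{R}^d}p(t,x)\le c_1[h^{-1}(1/t)]^{-d}$ for all $0<t<T_1$. (C2) There are $T_2\in(0,\infty]$, $c_2>0$ such that $\int_{\mathbb{R}^d}e^{-t\,\mathrm{Re}[\Psi(z)]}dz\le c_2[h^{-1}(1/t)]^{-d}$ for all $0<t<T_2$. (C3) There are $T_3\in(0,\infty]$, $c_3\in(0,1]$, $\alpha_3\in(0,2]$ such that $c_3\Psi^*(|x|)\le \mathrm{Re}[\Psi(x)]$ for all $|x|>1/T_3$, and $\Psi^*(\lambda r)\ge c_3\lambda^{\alpha_3}\Psi^*(r)$ for all $\lambda\ge1$, $r>1/T_3$. (C4) There are $T_4\in(0,\infty]$, $c_4\in[1,\infty)$ such that $\Psi^*(|x|)\le c_4\big(\langle x,Ax\rangle+\int_{|\langle x,z\rangle|<1}|\langle x,z\rangle|^2N(dz)\big)$ for all $|x|>1/T_4$. (C7) The density $p(t,x)$ of $Y_t$ exists and there are $T_7\in(0,\infty]$, $c_7\in[1,\infty)$ such that for all $0<t<T_7$, $$c_7^{-1}[h^{-1}(1/t)]^{-d}\le\sup_{x\in\mathbb{R}^d}p(t,x)\le c_7[h^{-1}(1/t)]^{-d}.$$ Moreover, (C3) with constants $T_3,c_3,\alpha_3$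 implies (C7) with a constant $c_7$ depending only on $d,\alpha_3,c_3$ and with $T_7=1/h(T_3/c_7)$. If $T_3<\infty$ in (C3), then (C7) holds for every $T_7>0$ with a constant $c_7$ depending only on $d,\alpha_3,c_3,T_3,T_7,h$.
   Context: $Y=(Y_t)_{t\ge0}$ is a Lévy process in $\mathbb{R}^d$, $d\in\mathbb{N}$, with generating triplet $(A,N,b)$: $A$ is a symmetric non-negative definite $d\times d$ matrix, $b\in\mathbb{R}^d$, and $N$ is a Lévy measure (Borel measure with $N(\{0\})=0$, $\int(1\wedge|z|^2)N(dz)<\infty$). The characteristic exponent $\Psi$ is given by $\mathbb{E}e^{i\langle x,Y_t\rangle}=e^{-t\Psi(x)}$, $$\Psi(x)=\langle x,Ax\rangle-i\langle x,b\rangle-\int_{\mathbb{R}^d}\big(e^{i\langle x,z\rangle}-1-i\langle x,z\rangle\mathbf{1}_{|z|<1}\big)N(dz).$$ For $r>0$, $h(r)=r^{-2}\|A\|+\int_{\mathbb{R}^d}\big(1\wedge\frac{|x|^2}{r^2}\big)N(dx)$ and $\Psi^*(r)=\sup_{|z|\le r}\mathrm{Re}[\Psi(z)]$. Standing assumption: $h(0^+)=\infty$; then $h$ is a continuous strictly decreasing bijection of $(0,\infty)$ onto $(0,\infty)$ with inverse $h^{-1}$. Conventions: $1/\infty=0$, $h(\infty)=0$, $1/0=\infty$. $p(t,\cdot)$ is the density of the law of $Y_t$ with respect to Lebesgue measure (if $e^{-t\Psi}$ is integrable, it is the continuous one given by Fourier inversion). *)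

(* Defs.v *)
From HB Require Import structures.
From mathcomp Require Import all_boot all_order all_algebra.
From mathcomp Require Import all_classical all_reals all_analysis.
From mathcomp Require Import measurable_realfun.
From mathcomp Require Import complex.

Set Implicit Arguments.
Unset Strict Implicit.
Unset Printing Implicit Defensive.

Import Order.TTheory GRing.Theory Num.Theory.
Import numFieldNormedType.Exports.
Local Open Scope classical_set_scope.
Local Open Scope ring_scope.

Definition borel_mx_display : measure_display.
Proof. exact: default_measure_display. Qed.

Section borel_mx.
Context {R : realType} {m n : nat}.

Let borel : set (set 'M[R]_(m, n)) := <<s open >>.

Let borel0 : borel set0.
Proof. exact: sigma_algebra0. Qed.

Let borelC A : borel A -> borel (~` A).
Proof. exact: sigma_algebraC. Qed.

Let borel_bigcup (F : (set 'M[R]_(m, n))^nat) :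
  (forall i, borel (F i)) -> borel (\bigcup_i (F i)).
Proof. exact: sigma_algebra_bigcup. Qed.

HB.instance Definition _ := @isMeasurable.Build borel_mx_display
  'M[R]_(m, n) borel borel0 borelC borel_bigcup.

Lemma measurable_mxE : @measurable _ 'M[R]_(m, n) = <<s open >>.
Proof. by []. Qed.

Let qball (p : 'M[rat]_(m, n) * nat) : set 'M[R]_(m, n) :=
  [set M | forall i j, ball (ratr (p.1 i j) : R) p.2.+1%:R^-1 (M i j)].

Let open_qball (U : set 'M[R]_(m, n)) : open U ->
  U = \bigcup_(p in [set p | qball p `<=` U]) qball p.
Proof.
move=> oU; rewrite eqEsubset; split=> [x Ux|x [p /= pU px]]; last exact: pU.
have /nbhs_ballP[e /= e0 xeU] : nbhs x U by exact: open_nbhs_nbhs.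
have e20 : 0 < e / 2 by rewrite divr_gt0.
have [k _ /(_ k (leqnn k)) ke] := near_infty_natSinv_lt (PosNum e20).
have k0 : (0 : R) < k.+1%:R^-1 by rewrite invr_gt0.
have qP i j : exists q : rat, ball (ratr q : R) k.+1%:R^-1 (x i j).
  have /rat_in_itvoo[q] : x i j - k.+1%:R^-1 < x i j + k.+1%:R^-1.
    by rewrite ltrD2l gtrN.
  by rewrite in_itv/= => qx; exists q; rewrite /ball/= ltr_distl.
pose q := \matrix_(i, j) projT1 (cid (qP i j)).
have qx : qball (q, k) x by move=> i j; rewrite mxE; case: cid.
exists (q, k) => //= y qy; apply: xeU; split => // i j.
apply: (@le_ball _ _ _ (k.+1%:R^-1 + k.+1%:R^-1)).
  by rewrite (splitr e) lerD// ltW.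
by apply: ball_triangle (qy i j); exact/ball_sym/qx.
Qed.

Lemma measurable_fun_mxP d (T : measurableType d) (D : set T)
    (f : T -> 'M[R]_(m, n)) :
  measurable_fun D f <-> forall i j, measurable_fun D (fun t => f t i j).
Proof.
split=> [mf i j|mf].
  apply: (@measurableT_comp _ _ _ _ _ _ (fun M : 'M[R]_(m, n) => M i j)) mf.
  apply: (@measurability _ _ _ _ _ _ (@RGenOpens.G R)).
    exact: RGenOpens.measurableE.
  move=> _ [_ [a [b ->]] <-].
  rewrite setTI; apply: sub_sigma_algebra.
  by apply: open_comp (interval_open _ _) => // M _; exact: coord_continuous.
move=> mD; move: (mD); rewrite -/(measurable_fun D f).
apply: (@measurability _ _ _ _ _ _ _ measurable_mxE).
move=> _ [U oU <-]; rewrite (open_qball oU).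
rewrite preimage_bigcup setI_bigcupr bigcup_mkcond.
apply: countable_bigcupT_measurable => [|p]; first exact: countableP.
case: ifPn => // _.
rewrite (_ : _ `&` _ = D `&` \bigcap_(ij in [set: 'I_m * 'I_n])
    (D `&` (fun t => f t ij.1 ij.2) @^-1`
             ball (ratr (p.1 ij.1 ij.2) : R) p.2.+1%:R^-1)); last first.
  rewrite eqEsubset; split=> t /= [Dt ft]; split => //.
    by move=> -[i j] _; split => //; exact: ft.
  by move=> i j; have [] := ft (i, j).
apply: measurableI => //; apply: fin_bigcap_measurable => // -[i j] _.
by apply: mf => //; exact: measurable_ball.
Qed.

End borel_mx.

Section lebesgue_rV.
Context {R : realType}.

Definition consrV n (p : measurableTypeR R * 'rV[R]_n) : 'rV[R]_(1 + n) :=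
  row_mx (\row_(_ < 1) (p.1 : R)) p.2.

Let unconsrV n (v : 'rV[R]_(1 + n)) : measurableTypeR R * 'rV[R]_n :=
  (v ord0 ord0, \row_j v ord0 (lift ord0 j)).

Let consrVK n : cancel (@consrV n) (@unconsrV n).
Proof.
move=> [x v]; rewrite /consrV /unconsrV /=; congr pair.
  by rewrite mxE; case: splitP => // j; rewrite mxE.
apply/rowP => j; rewrite !mxE; case: splitP => k /= /eqP.
  by rewrite ord1.
by rewrite eqSS => /eqP/val_inj ->.
Qed.

Let consrV0 n p : @consrV n p ord0 ord0 = p.1.
Proof. by have /(congr1 fst) := consrVK p. Qed.

Let consrVS n p j : @consrV n p ord0 (lift ord0 j) = p.2 ord0 j.
Proof.
by have /(congr1 snd)/rowP/(_ j) := consrVK p; rewrite mxE.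
Qed.

Let measurable_consrV n : measurable_fun setT (@consrV n).
Proof.
apply/measurable_fun_mxP => i j; rewrite /consrV.
case: (split_ordP j) => k ->.
  under eq_fun do rewrite row_mxEl mxE.
  exact: measurable_fst.
under eq_fun do rewrite row_mxEr.
have /measurable_fun_mxP msnd :=
  @measurable_snd _ _ (measurableTypeR R) 'rV[R]_n.
exact: msnd.
Qed.

Let measurable_unconsrV n : measurable_fun setT (@unconsrV n).
Proof.
have /measurable_fun_mxP mid : measurable_fun [set: 'rV[R]_(1 + n)] id by [].
apply/measurable_fun_pair; first exact: mid.
by apply/measurable_fun_mxP => i j; under eq_fun do rewrite mxE; exact: mid.
Qed.

HB.instance Definition _ n :=
  isMeasurableFun.Build _ _ _ _ (@consrV n) (@measurable_consrV n).

Section step.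
Local Open Scope ereal_scope.
Variables (n : nat) (mu : {sigma_finite_measure set 'rV[R]_n -> \bar R}).

Definition consrV_measure : set 'rV[R]_(1 + n) -> \bar R :=
  pushforward (@lebesgue_measure R \x mu) (@consrV n).

Let consrV_measure0 : consrV_measure set0 = 0.
Proof. exact: measure0. Qed.

Let consrV_measure_ge0 A : 0 <= consrV_measure A.
Proof. exact: measure_ge0. Qed.

Let consrV_measure_sigma_additive : semi_sigma_additive consrV_measure.
Proof. exact: measure_semi_sigma_additive. Qed.

HB.instance Definition _ := isMeasure.Build _ _ _ consrV_measure
  consrV_measure0 consrV_measure_ge0 consrV_measure_sigma_additive.

Let consrV_measure_sigma_finite : sigma_finite setT consrV_measure.
Proof.
have /sigma_finiteP[F [TF ndF Foo]] := sigma_finiteT (@lebesgue_measure R).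
have /sigma_finiteP[G [TG ndG Goo]] := sigma_finiteT mu.
exists (fun k => @unconsrV n @^-1` (F k `*` G k)).
  rewrite -preimage_bigcup (_ : \bigcup_k _ = setT) ?preimage_setT//.
  rewrite -subTset => -[x v] _.
  have [i _ Fx] : (\bigcup_k F k) x by rewrite -TF.
  have [j _ Gv] : (\bigcup_k G k) v by rewrite -TG.
  exists (maxn i j) => //; split.
  - by move: (x : measurableTypeR R) Fx; exact/subsetPset/ndF/leq_maxl.
  - by move: v Gv; exact/subsetPset/ndG/leq_maxr.
move=> k; have [mF Fk] := Foo k; have [mG Gk] := Goo k; split.
  rewrite -[X in measurable X]setTI.
  by apply: measurable_unconsrV => //; exact: measurableX.
rewrite /consrV_measure /pushforward -comp_preimage.
rewrite (_ : @unconsrV n \o @consrV n = id) ?preimage_id; last first.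
  by apply/funext => p /=; exact: consrVK.
by rewrite product_measure1E// lte_mul_pinfty// ge0_fin_numE.
Qed.

HB.instance Definition _ := Measure_isSigmaFinite.Build _ _ _
  consrV_measure consrV_measure_sigma_finite.

End step.

Fixpoint lebesgue_rV n : {sigma_finite_measure set 'rV[R]_n -> \bar R} :=
  match n with
  | 0 => dirac (0 : 'rV[R]_0)
  | n'.+1 => consrV_measure (lebesgue_rV n')
  end.

Local Open Scope ereal_scope.

Let box n (a b : 'rV[R]_n) : set 'rV[R]_n :=
  [set v | forall j, (a ord0 j <= v ord0 j <= b ord0 j)%R].

Let measurable_box n (a b : 'rV[R]_n) : measurable (box a b).
Proof.
rewrite (_ : box a b = \bigcap_(j in [set: 'I_n])
    ((fun v : 'rV[R]_n => v ord0 j) @^-1` `[a ord0 j, b ord0 j])).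
  apply: fin_bigcap_measurable => // j _; rewrite -[X in measurable X]setTI.
  have /measurable_fun_mxP mid : measurable_fun [set: 'rV[R]_n] id by [].
  exact: mid.
rewrite eqEsubset; split=> v /= abv j; first by move=> _ /=; rewrite in_itv/= abv.
by have := abv j I; rewrite /= in_itv.
Qed.

Lemma lebesgue_rV_box n (a b : 'rV[R]_n) : (forall j, a ord0 j <= b ord0 j)%R ->
  lebesgue_rV n [set v | forall j, (a ord0 j <= v ord0 j <= b ord0 j)%R] =
  (\prod_(j < n) (b ord0 j - a ord0 j))%:E.
Proof.
rewrite -/(box a b); elim: n a b => [|n ih] a b ab.
  by rewrite big_ord0 /= diracE mem_set//= => -[].
pose tl (v : 'rV[R]_n.+1) : 'rV[R]_n := \row_j v ord0 (lift ord0 j).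
rewrite /= /consrV_measure /pushforward.
rewrite (_ : _ @^-1` _ = `[a ord0 ord0, b ord0 ord0] `*` box (tl a) (tl b)).
  rewrite product_measure1E//=; last exact: measurable_box.
  rewrite lebesgue_measure_itv/= ih => [|j]; last by rewrite !mxE.
  rewrite big_ord_recl EFinM; congr (_ * _)%E.
    case: ifPn => //; rewrite lte_fin -leNgt => ba.
    by rewrite (@le_anti _ _ (a ord0 ord0) (b ord0 ord0)) ?subrr ?ab//=.
  by congr EFin; apply: eq_bigr => j _; rewrite !mxE.
rewrite eqEsubset; split=> -[x v] /=.
  move=> xv; split=> [|j] /=.
    by rewrite in_itv/=; have := xv ord0; rewrite (consrV0 (x, v)).
  by have := xv (lift ord0 j); rewrite (consrVS (x, v)) !mxE.
rewrite in_itv/= => -[xab vab] j; have [k ->|->] := unliftP ord0 j.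
  by rewrite (consrVS (x, v)); have := vab k; rewrite !mxE.
by rewrite (consrV0 (x, v)).
Qed.

End lebesgue_rV.

Section complex_valued.
Local Open Scope complex_scope.
Context {R : realType}.

(* exp (a + i b) = exp a (cos b + i sin b) *)
Definition cexp (z : R[i]) : R[i] :=
  ((expR (complex.Re z) * cos (complex.Im z)) +i*
   (expR (complex.Re z) * sin (complex.Im z))).

Context d (T : measurableType d) (mu : {measure set T -> \bar R}).

Definition cintegrable (f : T -> R[i]) : Prop :=
  mu.-integrable setT (fun x => (complex.Re (f x))%:E) /\
  mu.-integrable setT (fun x => (complex.Im (f x))%:E).

Definition cintegral (f : T -> R[i]) : R[i] :=
  (\int[mu]_x complex.Re (f x)) +i* (\int[mu]_x complex.Im (f x)).

End complex_valued.

Section euclidean.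
Context {R : realType} {d : nat}.
Implicit Types (x y : 'rV[R]_d) (A : 'M[R]_d).

Definition dotv x y : R := \sum_(j < d) x ord0 j * y ord0 j.

(* the library norm `|x| on 'rV[R]_d is the max norm *)
Definition enorm x : R := Num.sqrt (dotv x x).

(* A x, with vectors stored as rows *)
Definition mulmv A x : 'rV[R]_d := x *m A^T.

Definition opnorm A : R :=
  sup [set enorm (mulmv A x) | x in [set x | enorm x <= 1]].

End euclidean.

Section levy_process.
Context {R : realType} {d : nat} disp (Omega : measurableType disp).
Variable P : probability Omega R.

Definition mutually_independent n (X : 'I_n -> Omega -> 'rV[R]_d) : Prop :=
  forall B : 'I_n -> set 'rV[R]_d, (forall k, measurable (B k)) ->
  P (\bigcap_(k in [set: 'I_n]) (X k @^-1` B k)) =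
  (\prod_(k < n) P (X k @^-1` B k))%E.

(* Only the values Y t with 0 <= t are meaningful. *)
Record levy_process (Y : R -> Omega -> 'rV[R]_d) : Prop := {
  levy_measurable : forall t, 0 <= t -> measurable_fun setT (Y t);
  levy_start : {ae P, forall w, Y 0 w = 0};
  levy_independent_increments : forall n (t : nat -> R),
    0 <= t 0%N -> nondecreasing_seq t ->
    mutually_independent (fun (k : 'I_n) w => Y (t k.+1) w - Y (t k) w);
  levy_stationary_increments : forall s t, 0 <= s -> 0 <= t ->
    forall B : set 'rV[R]_d, measurable B ->
    P ((fun w => Y (s + t) w - Y s w) @^-1` B) = P (Y t @^-1` B);
  levy_stochastically_continuous : forall t e, 0 <= t -> 0 < e ->
    P [set w | e < enorm (Y s w - Y t w)]
      @[s --> within [set s | 0 <= s] (nbhs t)] --> 0%E;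
  levy_cadlag : {ae P, forall w,
    (forall t, 0 <= t -> Y s w @[s --> t^'+] --> Y t w) /\
    (forall t, 0 < t -> cvg (Y s w @[s --> t^'-]))}
}.

Definition is_density (X : Omega -> 'rV[R]_d) (f : 'rV[R]_d -> R) : Prop :=
  [/\ measurable_fun setT f, (forall x, 0 <= f x) &
      forall B, measurable B ->
        P (X @^-1` B) = (\int[lebesgue_rV d]_(x in B) (f x)%:E)%E].

End levy_process.

Section triplet.
Local Open Scope complex_scope.
Context {R : realType} {d : nat}.
Variables (A : 'M[R]_d) (N : {measure set 'rV[R]_d -> \bar R}) (b : 'rV[R]_d).

Definition levy_measure : Prop :=
  N [set 0] = 0%E /\
  (\int[N]_z (Num.min 1 (enorm z ^+ 2))%:E < +oo)%E.

Definition generating_triplet : Prop :=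
  [/\ A^T = A, (forall x, 0 <= dotv x (mulmv A x)) & levy_measure].

Definition psi (x : 'rV[R]_d) : R[i] :=
  (dotv x (mulmv A x))%:C - 'i * (dotv x b)%:C
  - cintegral N (fun z => cexp ('i * (dotv x z)%:C) - 1
      - 'i * (dotv x z)%:C * (\1_[set z | enorm z < 1] z)%:C).

Definition re_psi (x : 'rV[R]_d) : R := complex.Re (psi x).

Definition psi_star (r : R) : R :=
  sup [set re_psi z | z in [set z | enorm z <= r]].

Definition levy_h (r : R) : R :=
  r ^- 2 * opnorm A + \int[N]_x Num.min 1 (enorm x ^+ 2 / r ^+ 2).

(* h on [0, +oo], with h(+oo) = 0; never used at -oo *)
Definition levy_hE (r : \bar R) : \bar R :=
  if r is r'%:E then (levy_h r')%:E else 0%E.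

Definition levy_hinv : R -> R := pinv [set r : R | 0 < r] levy_h.

(* Below T ranges over ]0, +oo], and the inverse on \bar R satisfies
   +oo^-1 = 0 and 0^-1 = +oo. *)

Definition C2 : Prop := exists (T : \bar R) (c : R),
  [/\ (0 < T)%E, 0 < c & forall t : R, 0 < t -> (t%:E < T)%E ->
    (\int[lebesgue_rV d]_z (expR (- t * re_psi z))%:E <=
       (c * levy_hinv t^-1 ^- d)%:E)%E].

Definition C3_with (T : \bar R) (c alpha : R) : Prop :=
  (forall x : 'rV[R]_d, (T^-1 < (enorm x)%:E)%E ->
     c * psi_star (enorm x) <= re_psi x) /\
  (forall lambda r : R, 1 <= lambda -> (T^-1 < r%:E)%E ->
     c * lambda `^ alpha * psi_star r <= psi_star (lambda * r)).

Definition C3 : Prop := exists (T : \bar R) (c alpha : R),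
  [/\ (0 < T)%E, 0 < c <= 1, 0 < alpha <= 2 & C3_with T c alpha].

Definition C4 : Prop := exists (T : \bar R) (c : R),
  [/\ (0 < T)%E, 1 <= c & forall x : 'rV[R]_d, (T^-1 < (enorm x)%:E)%E ->
    psi_star (enorm x) <=
    c * (dotv x (mulmv A x) +
         \int[N]_(z in [set z | `|dotv x z| < 1]) (`|dotv x z| ^+ 2))].

Section process.
Context disp (Omega : measurableType disp) (P : probability Omega R).
Variable Y : R -> Omega -> 'rV[R]_d.

Definition characteristic_exponent : Prop := forall (t : R) (x : 'rV[R]_d),
  0 <= t ->
  cintegral P (fun w => cexp ('i * (dotv x (Y t w))%:C)) =
  cexp (- t%:C * psi x).

Definition levy_setting : Prop :=
  [/\ levy_process P Y, generating_triplet, characteristic_exponent &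
      levy_h r @[r --> 0^'+] --> +oo].

(* p t is a density of Y t; when exp (- t psi) is integrable, it is the version
   given pointwise by Fourier inversion. *)
Definition transition_density (p : R -> 'rV[R]_d -> R) : Prop :=
  forall t : R, 0 < t ->
  is_density P (Y t) (p t) /\
  (cintegrable (lebesgue_rV d) (fun z => cexp (- t%:C * psi z)) ->
   forall x, (p t x)%:C = ((2 * pi) ^- d)%:C *
     cintegral (lebesgue_rV d) (fun z =>
       cexp (- 'i * (dotv x z)%:C) * cexp (- t%:C * psi z))).

Definition sup_density (f : 'rV[R]_d -> R) : \bar R :=
  ereal_sup [set (f x)%:E | x in [set: 'rV[R]_d]].

Definition C1 : Prop := exists p, transition_density p /\
  exists (T : \bar R) (c : R),
  [/\ (0 < T)%E, 0 < c & forall t : R, 0 < t -> (t%:E < T)%E ->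
    (sup_density (p t) <= (c * levy_hinv t^-1 ^- d)%:E)%E].

Definition C7_with (T : \bar R) (c : R) : Prop :=
  exists p, transition_density p /\
  forall t : R, 0 < t -> (t%:E < T)%E ->
    ((c^-1 * levy_hinv t^-1 ^- d)%:E <= sup_density (p t))%E /\
    (sup_density (p t) <= (c * levy_hinv t^-1 ^- d)%:E)%E.

Definition C7 : Prop := exists (T : \bar R) (c : R),
  [/\ (0 < T)%E, 1 <= c & C7_with T c].

End process.
End triplet.

(* Main.v *)
(* Let I(t) be the integral of exp (- t Re psi), and r_t = h^-1(1/t).

   Smoothing by the Cauchy kernels, whose Fourier transforms are the Laplace
   kernels exp (- e |z|), gives both directions of Fourier inversion: if Y_t has
   a density bounded by M, then I(2t) <= (2 pi)^d M; if I(t) is finite, then Y_t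
   has a continuous density bounded by (2 pi)^-d I(t).  On the other hand
   Re psi <= 2 h(1/s) on the ball of radius s, so that I(t) is at least
   c r_t^-d for every t.  These bounds give C2 => C7 => C1 and, comparing I(2t)
   at the scales r_t and h^-1(2/t), a doubling property of h^-1, hence C1 => C2.

   The function psi^* is comparable to h(1/.): one inequality is elementary,
   the other follows by averaging 1 - cos (s <x, z>) against exp (- |s|).  Under
   C2 the doubling property yields the power growth of psi^*, and Re psi (x)
   cannot be much smaller than psi^*(|x|): otherwise, as Re psi (k x) <= k^2
   Re psi (x), exp (- t Re psi) would be of order 1 on many disjoint cubes with
   centres k x.  Conversely C3 bounds exp (- t Re psi) by a stretched
   exponential at scale 1/r_t, thus by a product of Cauchy kernels, with a
   constant depending only on d, c3 and alpha3.

   For C3 <=> C4, let K(x) = <x, Ax> + int min (1, <x, z>^2) N(dz) and let G(x)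
   be the right-hand side of C4.  Then K(2x) - K(x) >= (3/4) G(2x) and
   K(l x) <= l^2 G(x) + K(x): G is comparable to K exactly when K grows like
   a power in each direction. *)
Require Import Defs.
From HB Require Import structures.
From mathcomp Require Import all_boot all_order all_algebra.
From mathcomp Require Import all_classical all_reals all_analysis.
From mathcomp Require Import measurable_realfun complex ring lra.

Set Implicit Arguments.
Unset Strict Implicit.
Unset Printing Implicit Defensive.

Import Order.TTheory GRing.Theory Num.Theory.
Import numFieldNormedType.Exports.
Local Open Scope classical_set_scope.
Local Open Scope ring_scope.

(** * Laplace and Cauchy kernels *)

(** The Laplace-Cauchy pair is chosen because it is explicit and factorises over coordinates: its
    transforms come from elementary primitives, its integral over a box is a product of differences
    of arctangents, and the same Cauchy product serves again as the integrable majorant of exp (- t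
    Re psi). A bounded density controls the squared modulus of the characteristic function, that is
    exp (- 2 t Re psi). It therefore says something at time 2t only, and the doubling of h^-1 is
    what leads back to t. The lower bound on sup p asks for nothing beyond the existence of a
    density, and its constant depends on d alone. The order of the quantifiers shapes the rest: one
    c7 must serve all processes, so the constants between C3 and C7 are closed definitions
    ([C3_cst], [density_lower_cst], [C7_cst]) and not existential witnesses. For h no derivative is
    taken: it is concave as a function of r^-2, which gives continuity, and together with h(0+) =
    +oo strict monotonicity. *)

Section laplace_kernel.
Context {R : realType}.
Local Notation leb := (@lebesgue_measure R).
Implicit Types e u s x : R.

Let laplace_primitive e u s : R :=
  expR (- (e * s)) * (u * sin (u * s) - e * cos (u * s)) / (e ^+ 2 + u ^+ 2).

Let is_derive_laplace_primitive e u s : 0 < e ->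
  is_derive s 1 (laplace_primitive e u) (expR (- (e * s)) * cos (u * s)).
Proof.
move=> e0; have D0 : e ^+ 2 + u ^+ 2 != 0.
  by rewrite gt_eqF// ltr_wpDr ?sqr_ge0// exprn_gt0.
by rewrite /laplace_primitive; apply: is_derive_eq; rewrite /GRing.scale/=; field.
Qed.

Let cvg_expRM e : 0 < e -> expR (- (e * s)) @[s --> +oo] --> (0 : R).
Proof.
move=> e0; apply: (@cvg_comp _ _ _ (fun s => e * s) (fun y => expR (- y)) _
  (pinfty_nbhs R)); last exact: cvgr_expR.
exact: gt0_cvgMry.
Qed.

Let cvg_laplace_primitive e u : 0 < e ->
  laplace_primitive e u s @[s --> +oo] --> 0.
Proof.
move=> e0.
have D0 : 0 < e ^+ 2 + u ^+ 2 by rewrite ltr_wpDr ?sqr_ge0// exprn_gt0.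
pose C := (`|u| + `|e|) / (e ^+ 2 + u ^+ 2).
apply: norm_cvg0; apply: (@squeeze_cvgr _ _ _ _ (fun=> 0)
    (fun s => expR (- (e * s)) * C)); last 2 first.
- exact: cvg_cst.
- by rewrite -[X in _ --> X](mul0r C); apply: cvgMr_tmp; exact: cvg_expRM.
apply: nearW => s; rewrite normr_ge0/= /laplace_primitive -mulrA normrM.
rewrite ger0_norm ?expR_ge0// ler_wpM2l ?expR_ge0// normrM /C.
rewrite normfV (gtr0_norm D0) ler_wpM2r ?invr_ge0 ?(ltW D0)//.
rewrite (le_trans (ler_normB _ _))// lerD// normrM ler_piMr//.
  exact: sin_max.
exact: cos_max.
Qed.

Let leb_laplace e u : 0 < e ->
  (\int[leb]_(s in `[0%R, +oo[) (expR (- (e * s)) * (1 - cos (u * s)))%:E =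
   (e^-1 - e / (e ^+ 2 + u ^+ 2))%:E)%E.
Proof.
move=> e0.
pose F s := - e^-1 * expR (- (e * s)) - laplace_primitive e u s.
have D0 : e ^+ 2 + u ^+ 2 != 0.
  by rewrite gt_eqF// ltr_wpDr ?sqr_ge0// exprn_gt0.
have dF s : is_derive s 1 F (expR (- (e * s)) * (1 - cos (u * s))).
  rewrite /F; have := is_derive_laplace_primitive u s e0 => ?.
  by apply: is_derive_eq; rewrite /GRing.scale/=; field; rewrite gt_eqF.
have cF : continuous F.
  by move=> s; apply/differentiable_continuous/derivable1_diffP/ex_derive.
rewrite (@ge0_continuous_FTC2y _ _ F _ 0).
- rewrite -EFinB; congr EFin.
  rewrite /F /laplace_primitive !mulr0 oppr0 expR0 sin0 cos0.
  by field; rewrite D0 gt_eqF.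
- by move=> s _; rewrite mulr_ge0 ?expR_ge0// subr_ge0 cos_le1.
- apply: continuous_subspaceT => s.
  apply/differentiable_continuous/derivable1_diffP.
  exact: ex_derive.
- rewrite /F -[X in _ --> X]subr0; apply: cvgB; last exact: cvg_laplace_primitive.
  by rewrite -(mulr0 (- e^-1)); apply: cvgMl_tmp; exact: cvg_expRM.
- by move=> s _; exact: ex_derive.
- by apply: cvg_at_right_filter; exact: cF.
- by move=> s _; rewrite derive1E; exact: derive_val.
Qed.

Let leb_exp e : 0 < e ->
  (\int[leb]_(s in `[0%R, +oo[) (expR (- (e * s)))%:E = (e^-1)%:E)%E.
Proof.
move=> e0.
pose F s := - e^-1 * expR (- (e * s)).
have dF s : is_derive s 1 F (expR (- (e * s))).
  by rewrite /F; apply: is_derive_eq; rewrite /GRing.scale/=; field; rewrite gt_eqF.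
have cF : continuous F.
  by move=> s; apply/differentiable_continuous/derivable1_diffP/ex_derive.
rewrite (@ge0_continuous_FTC2y _ _ F _ 0).
- by rewrite -EFinB; congr EFin; rewrite /F !mulr0 oppr0 expR0; ring.
- by move=> s _; exact: expR_ge0.
- apply: continuous_subspaceT => s.
  apply/differentiable_continuous/derivable1_diffP.
  exact: ex_derive.
- by rewrite -(mulr0 (- e^-1)); apply: cvgMl_tmp; exact: cvg_expRM.
- by move=> s _; exact: ex_derive.
- by apply: cvg_at_right_filter; exact: cF.
- by move=> s _; rewrite derive1E; exact: derive_val.
Qed.

Let continuous_laplace e : continuous (fun s : R => expR (- (e * `|s|))).
Proof.
move=> s; apply: (@continuous_comp _ _ _ (fun s => - (e * `|s|)) expR).
  by apply: cvgN; apply: cvgMl_tmp; exact: norm_continuous.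
exact: continuous_expR.
Qed.

Lemma continuous_cosM u : continuous (fun s : R => cos (u * s)).
Proof.
by move=> s; apply/differentiable_continuous/derivable1_diffP; exact: ex_derive.
Qed.

Lemma continuous_sinM u : continuous (fun s : R => sin (u * s)).
Proof.
by move=> s; apply/differentiable_continuous/derivable1_diffP; exact: ex_derive.
Qed.

Lemma integral_laplace e : 0 < e ->
  (\int[leb]_s (expR (- (e * `|s|)))%:E = (2 / e)%:E)%E.
Proof.
move=> e0; rewrite ge0_symfun_integralT//=.
- rewrite [X in (_ * X)%E](_ : _ = (e^-1)%:E) ?EFinM//.
  rewrite -leb_exp// set_itvE; apply: eq_integral => s; rewrite inE/= => s0.
  by rewrite ger0_norm.
- by move=> s /=; rewrite normrN.
Qed.

Lemma integral_laplace_1Bcos e u : 0 < e ->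
  (\int[leb]_s (expR (- (e * `|s|)) * (1 - cos (u * s)))%:E =
   (2 / e - 2 * e / (e ^+ 2 + u ^+ 2))%:E)%E.
Proof.
move=> e0; rewrite ge0_symfun_integralT//=.
- rewrite [X in (_ * X)%E](_ : _ = (e^-1 - e / (e ^+ 2 + u ^+ 2))%:E).
    by rewrite -EFinM mulrBr mulrA.
  rewrite -leb_laplace// set_itvE; apply: eq_integral => s; rewrite inE/= => s0.
  by rewrite ger0_norm.
- move=> s; apply: cvgM; first exact: continuous_laplace.
  by apply: cvgB; [exact: cvg_cst|exact: continuous_cosM].
- by move=> s /=; rewrite normrN mulrN cosN.
Qed.

Lemma measurable_laplace e : measurable_fun setT (fun s => expR (- (e * `|s|))).
Proof. apply: continuous_measurable_fun; exact: continuous_laplace. Qed.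

Lemma integrable_laplace e : 0 < e ->
  leb.-integrable setT (fun s => (expR (- (e * `|s|)))%:E).
Proof.
move=> e0; apply/integrableP; split.
  apply/measurable_EFinP; exact: measurable_laplace.
under eq_integral do rewrite abse_EFin ger0_norm ?expR_ge0//.
by rewrite integral_laplace// ltry.
Qed.

Lemma integrable_laplaceM e (f : R -> R) : 0 < e ->
  measurable_fun setT f -> (forall s, `|f s| <= 1) ->
  leb.-integrable setT (fun s => (expR (- (e * `|s|)) * f s)%:E).
Proof.
move=> e0 mf f1; apply: le_integrable (integrable_laplace e0) => //.
  by apply/measurable_EFinP; apply: measurable_funM => //; exact: measurable_laplace.
move=> s _ /=; rewrite lee_fin normrM ger0_norm ?expR_ge0//.
by rewrite ler_piMr// expR_ge0.
Qed.

(** The Cauchy density of scale [e] times 2 pi: with this normalisation it is exactly the Fourier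
    transform of exp (- e |s|). *)
Definition cauchy_kernel e x : R := 2 * e / (e ^+ 2 + x ^+ 2).

Lemma Rintegral_laplace_cos e u : 0 < e ->
  \int[leb]_s (expR (- (e * `|s|)) * cos (u * s)) = cauchy_kernel e u.
Proof.
move=> e0.
have h1 : \int[leb]_s expR (- (e * `|s|)) = 2 / e.
  by rewrite /Rintegral integral_laplace.
have h2 : \int[leb]_s (expR (- (e * `|s|)) * (1 - cos (u * s))) =
    2 / e - cauchy_kernel e u.
  by rewrite /Rintegral integral_laplace_1Bcos.
have ic : leb.-integrable setT (fun s => (expR (- (e * `|s|)) * cos (u * s))%:E).
  apply: integrable_laplaceM => //; last by move=> s; exact: cos_max.
  apply: continuous_measurable_fun; exact: continuous_cosM.
apply: oppr_inj; apply: (addrI (2 / e)); rewrite -h2 -h1 -RintegralB//.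
  by apply: eq_Rintegral => s _; rewrite mulrBr mulr1.
exact: integrable_laplace.
Qed.

Lemma Rintegral_laplace_sin e u : 0 < e ->
  \int[leb]_s (expR (- (e * `|s|)) * sin (u * s)) = 0.
Proof.
move=> e0.
have is_ v : leb.-integrable setT (fun s => (expR (- (e * `|s|)) * sin (v * s))%:E).
  apply: integrable_laplaceM => //; last by move=> s; exact: sin_max.
  apply: continuous_measurable_fun; exact: continuous_sinM.
(* Reflection invariance is applied to a nonnegative integrand, whence the shift by 1; once the 1 is
   split off again, the sine integral equals its opposite. *)
pose f s := expR (- (e * `|s|)) * (1 + sin (u * s)).
have f0 s : 0 <= f s.
  by rewrite mulr_ge0 ?expR_ge0// -lerBlDl sub0r; exact: sin_geN1.
have mf : measurable_fun setT f.
  apply: measurable_funM; first exact: measurable_laplace.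
  apply: measurable_funD => //; apply: continuous_measurable_fun; exact: continuous_sinM.
have fN : \int[leb]_s f s = \int[leb]_s f (- s).
  rewrite /Rintegral; congr fine.
  have /= := @ge0_integral_pushforward _ _ (measurableTypeR R) (measurableTypeR R)
     R -%R (@oppr_measurable R setT) leb setT (EFin \o f).
  rewrite preimage_setT => <-//; last 2 first.
    exact/measurable_EFinP.
    by move=> s _; rewrite lee_fin.
  by apply: eq_measure_integral => A mA _; exact/esym/lebesgue_measureN.
have fE v : \int[leb]_s (expR (- (e * `|s|)) * (1 + sin (v * s))) =
    \int[leb]_s expR (- (e * `|s|)) + \int[leb]_s (expR (- (e * `|s|)) * sin (v * s)).
  rewrite -RintegralD; [|by []|exact: integrable_laplace|exact: is_].
  by apply: eq_Rintegral => s _; rewrite mulrDr mulr1.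
have : \int[leb]_s f s = \int[leb]_s (expR (- (e * `|s|)) * (1 + sin (- u * s))).
  by rewrite fN; apply: eq_Rintegral => s _; rewrite /f normrN mulrN mulNr.
rewrite fE fE => /addrI sE.
have sN : \int[leb]_s (expR (- (e * `|s|)) * sin (- u * s)) =
    - \int[leb]_s (expR (- (e * `|s|)) * sin (u * s)).
  rewrite -[RHS]mulN1r -RintegralZl; [|by []|exact: is_].
  by apply: eq_Rintegral => s _; rewrite mulNr sinN mulN1r mulrN.
move: sE; rewrite sN; set I := (X in X = _) => IE.
by have := mulrn_eq0 I 2; rewrite mulr2n {1}IE addNr eqxx /= => /esym/eqP.
Qed.

Lemma cauchy_kernel_ge0 e x : 0 < e -> 0 <= cauchy_kernel e x.
Proof. by move=> e0; rewrite divr_ge0 ?mulr_ge0 ?addr_ge0 ?sqr_ge0// ltW. Qed.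

Lemma continuous_cauchy_kernel e : 0 < e -> continuous (cauchy_kernel e).
Proof.
move=> e0 x; apply: cvgMl_tmp; apply: cvgV.
  by rewrite gt_eqF// ltr_wpDr ?sqr_ge0// exprn_gt0.
by apply: cvgD; [exact: cvg_cst|exact: exprn_continuous].
Qed.

Lemma is_derive_cauchy_kernel e y x : 0 < e ->
  is_derive x 1 (fun x => 2 * atan ((x - y) / e)) (cauchy_kernel e (y - x)).
Proof.
move=> e0; apply: is_derive_eq; rewrite /GRing.scale/= /cauchy_kernel.
have eN0 : e != 0 by rewrite gt_eqF.
have D0 : e ^+ 2 + (x - y) ^+ 2 != 0.
  by rewrite gt_eqF// ltr_wpDr ?sqr_ge0// exprn_gt0.
by rewrite (_ : (y - x) ^+ 2 = (x - y) ^+ 2); [field; rewrite eN0 D0|ring].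
Qed.

Lemma integral_cauchy_kernel_itv e y (a b : R) : 0 < e -> a <= b ->
  (\int[leb]_(x in `[a, b]) (cauchy_kernel e (y - x))%:E =
   (2 * (atan ((b - y) / e) - atan ((a - y) / e)))%:E)%E.
Proof.
move=> e0; rewrite le_eqVlt => /predU1P[->|ab].
  by rewrite subrr mulr0 set_itv1 integral_set1.
have dF x := is_derive_cauchy_kernel y x e0.
have cF : continuous (fun x => 2 * atan ((x - y) / e)).
  by move=> x; apply/differentiable_continuous/derivable1_diffP/ex_derive.
rewrite (@continuous_FTC2 _ _ (fun x => 2 * atan ((x - y) / e)))//.
- by rewrite -EFinB -mulrBr.
- apply: continuous_subspaceT => x.
  apply: (@continuous_comp _ _ _ (fun x => y - x) (cauchy_kernel e)).
    by apply: cvgB; [exact: cvg_cst|exact: cvg_id].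
  exact: continuous_cauchy_kernel.
- split; first by move=> x _; exact: ex_derive.
    exact/cvg_at_right_filter/cF.
  exact/cvg_at_left_filter/cF.
- by move=> x _; rewrite derive1E; exact: derive_val.
Qed.

Lemma integral_cauchy_kernel e y : 0 < e ->
  (\int[leb]_x (cauchy_kernel e (y - x))%:E = (2 * pi)%:E)%E.
Proof.
move=> e0; have eN0 : e != 0 by rewrite gt_eqF.
have G0 x : 0 <= (oneDsqr x)^-1 :> R by rewrite invr_ge0.
transitivity (2%:E * \int[leb]_x ((oneDsqr x)^-1)%:E)%E; last first.
  rewrite ge0_symfun_integralT//.
  - have := @integral0y_oneDsqr R; rewrite set_itvE => ->.
    by rewrite -!EFinM; congr EFin; field.
  - exact: continuous_oneDsqrV.
  - by move=> x /=; rewrite /oneDsqr sqrrN.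
have dF x : is_derive x 1 (fun x => (x - y) / e) e^-1.
  by apply: is_derive_eq; rewrite /GRing.scale/=; ring.
have F'E : derive1 (fun x => (x - y) / e) = cst e^-1.
  by apply/funext => x; rewrite derive1E; exact: derive_val.
rewrite (@increasing_ge0_integration_by_substitutionT _ (fun x => (x - y) / e)
  (fun x => (oneDsqr x)^-1)).
- rewrite F'E -ge0_integralZl//.
  + apply: eq_integral => x _; rewrite -EFinM; congr EFin => /=.
    rewrite /cauchy_kernel /oneDsqr !fctE/=.
    have D0 : e ^+ 2 + (x - y) ^+ 2 != 0.
      by rewrite gt_eqF// ltr_wpDr ?sqr_ge0// exprn_gt0.
    by rewrite (_ : (y - x) ^+ 2 = (x - y) ^+ 2); [field; rewrite eN0 D0|ring].
  + apply/measurable_EFinP; apply: continuous_measurable_fun => x.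
    apply: cvgMr_tmp; apply: (@continuous_comp _ _ _ (fun x => (x - y) / e)
      (fun x => (oneDsqr x)^-1)); last exact: continuous_oneDsqrV.
    exact/differentiable_continuous/derivable1_diffP/ex_derive.
  + by move=> x _; rewrite lee_fin mulr_ge0// invr_ge0 ltW.
- by move=> x z xz; rewrite ltr_pM2r ?invr_gt0// ltrD2r.
- by rewrite F'E => x; exact: cvg_cst.
- by rewrite F'E; exact: is_cvg_cst.
- by rewrite F'E; exact: is_cvg_cst.
- by move=> x; exact: ex_derive.
- apply/cvgrNyPle => A; near=> x.
  by rewrite ler_pdivrMr// lerBlDr; near: x; apply: nbhs_ninfty_le; rewrite num_real.
- apply/cvgryPge => A; near=> x.
  by rewrite ler_pdivlMr// lerBrDr; near: x; apply: nbhs_pinfty_ge; rewrite num_real.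
- exact: continuous_oneDsqrV.
- by [].
Unshelve. all: by end_near. Qed.

End laplace_kernel.

(** * Products of integrals and Lebesgue measure on row vectors *)

Section product_integral.
Context d1 d2 (T1 : measurableType d1) (T2 : measurableType d2) (R : realType).
Variables (m1 : {sigma_finite_measure set T1 -> \bar R})
          (m2 : {sigma_finite_measure set T2 -> \bar R}).

Lemma integrable_prodM (a : T1 -> R) (b : T2 -> R) :
  m1.-integrable setT (EFin \o a) -> m2.-integrable setT (EFin \o b) ->
  (m1 \x m2)%E.-integrable setT (fun z => (a z.1 * b z.2)%:E).
Proof.
move=> ia ib.
have /measurable_EFinP ma := measurable_int _ ia.
have /measurable_EFinP mb := measurable_int _ ib.
have mab : measurable_fun setT (fun z : T1 * T2 => (a z.1 * b z.2)%:E).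
  by apply/measurable_EFinP; apply: measurable_funM; exact: measurableT_comp.
apply/(integrable12ltyP _ _ mab) => /=.
have E x : (\int[m2]_y `|(a x * b y)%:E| = `|(a x)%:E| * \int[m2]_y `|(b y)%:E|)%E.
  rewrite -ge0_integralZl//; last exact/measurable_EFinP/measurableT_comp.
  by apply: eq_integral => y _; rewrite EFinM abseM.
rewrite (eq_integral (fun x => (`|(a x)%:E| * \int[m2]_y `|(b y)%:E|)%E)); last first.
  by move=> x _; exact: E.
rewrite ge0_integralZr//.
- rewrite lte_mul_pinfty//; first exact: integral_ge0.
    by rewrite ge0_fin_numE ?integral_ge0//; have /integrableP[] := ia.
  by have /integrableP[] := ib.
- by apply/measurable_EFinP; exact: measurableT_comp.
- exact: integral_ge0.
Qed.

Lemma Rintegral_prodM (a : T1 -> R) (b : T2 -> R) :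
  m1.-integrable setT (EFin \o a) -> m2.-integrable setT (EFin \o b) ->
  \int[(m1 \x m2)%E]_z (a z.1 * b z.2) = (\int[m1]_x a x) * (\int[m2]_y b y).
Proof.
move=> ia ib; rewrite {1}/Rintegral -(integral12_prod_meas1 (integrable_prodM ia ib)).
rewrite /fubini_F/=.
under eq_integral => x _.
  under eq_integral => y _ do rewrite EFinM.
  rewrite integralZl//.
  rewrite -[X in (_ * X)%E]fineK; last exact: integrable_fin_num.
  over.
by rewrite integralZr// fineM//; exact: integrable_fin_num.
Qed.

End product_integral.

Section lebesgue_rV_integral.
Context {R : realType}.
Local Notation leb := (@lebesgue_measure R).
Implicit Types e : R.

Lemma consrVE0 n (p : measurableTypeR R * 'rV[R]_n) : consrV p ord0 ord0 = p.1.
Proof.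
rewrite /consrV; have -> : (ord0 : 'I_(1 + n)) = lshift n ord0 by exact/val_inj.
by rewrite row_mxEl mxE.
Qed.

Lemma consrVES n (p : measurableTypeR R * 'rV[R]_n) j :
  consrV p ord0 (lift ord0 j) = p.2 ord0 j.
Proof.
rewrite /consrV; have -> : (lift ord0 j : 'I_(1 + n)) = rshift 1 j.
  exact/val_inj.
by rewrite row_mxEr.
Qed.

Lemma dotv_consrV n (p : measurableTypeR R * 'rV[R]_n) (u : 'rV[R]_n.+1) :
  dotv (consrV p : 'rV_n.+1) u =
  u ord0 ord0 * p.1 + dotv p.2 (\row_j u ord0 (lift ord0 j)).
Proof.
rewrite /dotv big_ord_recl consrVE0 mulrC; congr (_ + _).
by apply: eq_bigr => j _; rewrite consrVES mxE.
Qed.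

Lemma measurable_coord n (j : 'I_n) :
  measurable_fun setT (fun v : 'rV[R]_n => v ord0 j).
Proof.
have /measurable_fun_mxP mid : measurable_fun [set: 'rV[R]_n] id by [].
exact: mid.
Qed.

Lemma measurable_dotv n (u : 'rV[R]_n) :
  measurable_fun setT (fun v : 'rV[R]_n => dotv v u).
Proof.
apply: measurable_sum => j; apply: measurable_funM => //; exact: measurable_coord.
Qed.

Let measurable_consrV n : measurable_fun setT (@consrV R n).
Proof. exact: measurable_funPT. Qed.

(** In dimension n + 1 [lebesgue_rV] is by construction the push-forward of a product measure under
    [consrV]; this is how Fubini enters the inductions on the dimension. *)
Lemma integrable_rVS n (f : 'rV[R]_n.+1 -> R) : measurable_fun setT f ->
  (leb \x lebesgue_rV n)%E.-integrable setT (fun p => (f (consrV p))%:E) ->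
  (lebesgue_rV n.+1).-integrable setT (EFin \o f).
Proof.
move=> mf fi; apply: (integrable_pushforward (@measurable_consrV n)) => //.
exact/measurable_EFinP.
Qed.

Lemma Rintegral_rVS n (f : 'rV[R]_n.+1 -> R) : measurable_fun setT f ->
  (leb \x lebesgue_rV n)%E.-integrable setT (fun p => (f (consrV p))%:E) ->
  \int[lebesgue_rV n.+1]_v f v = \int[(leb \x lebesgue_rV n)%E]_p f (consrV p).
Proof.
move=> mf fi; congr fine.
rewrite (@integral_pushforward _ _ _ _ _ _ (@measurable_consrV n))//.
exact/measurable_EFinP.
Qed.

Lemma measurable_prod_rV n (F : 'I_n -> R -> R) :
  (forall j, measurable_fun setT (F j)) ->
  measurable_fun setT (fun v : 'rV[R]_n => \prod_j F j (v ord0 j)).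
Proof.
move=> mF; apply: measurable_prod => j _.
by apply: measurableT_comp => //; exact: measurable_coord.
Qed.

Lemma integral_rV0 (f : 'rV[R]_0 -> R) :
  measurable_fun setT f -> (\int[lebesgue_rV 0]_v (f v)%:E = (f 0)%:E)%E.
Proof.
move=> mf; rewrite integral_dirac//=; last exact/measurable_EFinP.
by rewrite diracT mul1e.
Qed.

Lemma integrable_rV0 (f : 'rV[R]_0 -> R) :
  measurable_fun setT f -> (lebesgue_rV 0).-integrable setT (EFin \o f).
Proof.
move=> mf; apply/integrableP; split; first exact/measurable_EFinP.
by rewrite (@integral_rV0 (fun v => `|f v|)) ?ltry//; exact: measurableT_comp.
Qed.

Lemma integrable_prod_rV n (F : 'I_n -> R -> R) :
  (forall j, leb.-integrable setT (EFin \o F j)) ->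
  (lebesgue_rV n).-integrable setT (fun v => (\prod_j F j (v ord0 j))%:E) /\
  \int[lebesgue_rV n]_v (\prod_j F j (v ord0 j)) = \prod_j \int[leb]_x F j x.
Proof.
elim: n F => [|n IH] F iF.
  have m1 : measurable_fun setT (fun v : 'rV[R]_0 => \prod_j F j (v ord0 j)).
    by apply: measurable_prod => -[].
  split; first exact: integrable_rV0.
  by rewrite /Rintegral integral_rV0//= !big_ord0.
have [iG GE] := IH (fun j => F (lift ord0 j)) (fun j => iF _).
have mF j : measurable_fun setT (F j).
  by have /measurable_EFinP := measurable_int _ (iF j).
have E p : \prod_j F j (consrV p ord0 j) =
    F ord0 p.1 * \prod_(j < n) F (lift ord0 j) (p.2 ord0 j).
  rewrite big_ord_recl consrVE0; congr (_ * _).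
  by apply: eq_bigr => j _; rewrite consrVES.
have ip : (leb \x lebesgue_rV n)%E.-integrable setT
    (fun p => (\prod_j F j (consrV p ord0 j))%:E).
  apply: eq_integrable (integrable_prodM (iF ord0) iG) => // p _.
  by rewrite /= -E.
split.
  by apply: integrable_rVS => //; exact: measurable_prod_rV.
rewrite Rintegral_rVS//; last exact: measurable_prod_rV.
rewrite big_ord_recl -GE -Rintegral_prodM//.
by apply: eq_Rintegral => p _; exact: E.
Qed.

(** Damping by the l1 norm instead of the Euclidean one makes the factor a product over coordinates,
    so that its Fourier transform is the product [cauchy_rV]. *)
Definition laplace_rV n e (v : 'rV[R]_n) : R := \prod_j expR (- (e * `|v ord0 j|)).

Definition cauchy_rV n e (v : 'rV[R]_n) : R := \prod_j cauchy_kernel e (v ord0 j).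

Lemma laplace_rV_ge0 n e (v : 'rV[R]_n) : 0 <= laplace_rV e v.
Proof. by apply: prodr_ge0 => j _; exact: expR_ge0. Qed.

Lemma laplace_rV_le1 n e (v : 'rV[R]_n) : 0 < e -> laplace_rV e v <= 1.
Proof.
move=> e0; apply: prodr_ile1 => j _; rewrite expR_ge0 -expR0 ler_expR.
by rewrite oppr_le0 mulr_ge0// ltW.
Qed.

Lemma measurable_laplace_rV n e : measurable_fun setT (@laplace_rV n e).
Proof.
apply: (@measurable_prod_rV n (fun _ s => expR (- (e * `|s|)))) => j.
exact: measurable_laplace.
Qed.

Lemma integrable_laplace_rV n e : 0 < e ->
  (lebesgue_rV n).-integrable setT (EFin \o @laplace_rV n e).
Proof.
move=> e0.
by have [] := @integrable_prod_rV n _ (fun _ => integrable_laplace e0).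
Qed.

Lemma integrable_laplace_rVM n e (f : 'rV[R]_n -> R) : 0 < e ->
  measurable_fun setT f -> (forall s, `|f s| <= 1) ->
  (lebesgue_rV n).-integrable setT (fun v => (laplace_rV e v * f v)%:E).
Proof.
move=> e0 mf f1; apply: le_integrable (integrable_laplace_rV n e0) => //.
  apply/measurable_EFinP; apply: measurable_funM => //.
  exact: measurable_laplace_rV.
move=> v _ /=; rewrite lee_fin normrM ler_piMr//.
Qed.

Lemma measurable_cos_dotv n (u : 'rV[R]_n) :
  measurable_fun setT (fun v => cos (dotv v u)).
Proof.
apply: measurableT_comp; last exact: measurable_dotv.
by apply: continuous_measurable_fun; exact: continuous_cos.
Qed.

Lemma measurable_sin_dotv n (u : 'rV[R]_n) :
  measurable_fun setT (fun v => sin (dotv v u)).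
Proof.
apply: measurableT_comp; last exact: measurable_dotv.
by apply: continuous_measurable_fun; exact: continuous_sin.
Qed.

(** Both integrals go through one induction, since splitting off a coordinate by the addition
    formulas mixes cosine and sine. *)
Lemma Rintegral_laplace_rV_cos_sin n e (u : 'rV[R]_n) : 0 < e ->
  \int[lebesgue_rV n]_v (laplace_rV e v * cos (dotv v u)) = cauchy_rV e u /\
  \int[lebesgue_rV n]_v (laplace_rV e v * sin (dotv v u)) = 0.
Proof.
move=> e0; elim: n u => [|n IH] u.
  have E v : dotv v u = 0 by rewrite /dotv big_ord0.
  have L v : @laplace_rV 0 e v = 1 by rewrite /laplace_rV big_ord0.
  split.
    rewrite /Rintegral; under eq_integral do rewrite E L cos0 mul1r.
    by rewrite integral_rV0//= /cauchy_rV big_ord0.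
  rewrite /Rintegral; under eq_integral do rewrite E L sin0 mul1r.
  by rewrite integral_rV0.
set u' := \row_j u ord0 (lift ord0 j).
have [cE sE] := IH u'.
have Lc p : @laplace_rV n.+1 e (consrV p) =
    expR (- (e * `|p.1|)) * laplace_rV e p.2.
  rewrite /laplace_rV big_ord_recl consrVE0; congr (_ * _).
  by apply: eq_bigr => j _; rewrite consrVES.
have mc := measurable_cos_dotv; have ms := measurable_sin_dotv.
have i1 : leb.-integrable setT
    (EFin \o (fun s => expR (- (e * `|s|)) * cos (u ord0 ord0 * s))).
  apply: integrable_laplaceM => //; last by move=> s; exact: cos_max.
  apply: continuous_measurable_fun; exact: continuous_cosM.
have i2 : leb.-integrable setT
    (EFin \o (fun s => expR (- (e * `|s|)) * sin (u ord0 ord0 * s))).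
  apply: integrable_laplaceM => //; last by move=> s; exact: sin_max.
  apply: continuous_measurable_fun; exact: continuous_sinM.
have i3 : (lebesgue_rV n).-integrable setT
    (EFin \o (fun v => laplace_rV e v * cos (dotv v u'))).
  by apply: integrable_laplace_rVM => // v; exact: cos_max.
have i4 : (lebesgue_rV n).-integrable setT
    (EFin \o (fun v => laplace_rV e v * sin (dotv v u'))).
  by apply: integrable_laplace_rVM => // v; exact: sin_max.
have j13 := integrable_prodM i1 i3; have j24 := integrable_prodM i2 i4.
have j14 := integrable_prodM i1 i4; have j23 := integrable_prodM i2 i3.
have Ec p : laplace_rV e (consrV p : 'rV_n.+1) * cos (dotv (consrV p : 'rV_n.+1) u) =
   expR (- (e * `|p.1|)) * cos (u ord0 ord0 * p.1) *
     (laplace_rV e p.2 * cos (dotv p.2 u')) -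
   expR (- (e * `|p.1|)) * sin (u ord0 ord0 * p.1) *
     (laplace_rV e p.2 * sin (dotv p.2 u')).
  by rewrite dotv_consrV Lc cosD -/u'; ring.
have Es p : laplace_rV e (consrV p : 'rV_n.+1) * sin (dotv (consrV p : 'rV_n.+1) u) =
   expR (- (e * `|p.1|)) * cos (u ord0 ord0 * p.1) *
     (laplace_rV e p.2 * sin (dotv p.2 u')) +
   expR (- (e * `|p.1|)) * sin (u ord0 ord0 * p.1) *
     (laplace_rV e p.2 * cos (dotv p.2 u')).
  by rewrite dotv_consrV Lc sinD -/u'; ring.
split.
  rewrite Rintegral_rVS; last 2 first.
  - by apply: measurable_funM; [exact: measurable_laplace_rV|exact: mc].
  - by under eq_fun do rewrite Ec; exact: integrableB j13 j24.
  under eq_Rintegral do rewrite Ec.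
  rewrite RintegralB// (Rintegral_prodM i1 i3) (Rintegral_prodM i2 i4) cE sE.
  rewrite mulr0 subr0 Rintegral_laplace_cos// /cauchy_rV big_ord_recl.
  by congr (_ * _); apply: eq_bigr => j _; rewrite mxE.
rewrite Rintegral_rVS; last 2 first.
- by apply: measurable_funM; [exact: measurable_laplace_rV|exact: ms].
- by under eq_fun do rewrite Es; exact: integrableD j14 j23.
under eq_Rintegral do rewrite Es.
rewrite RintegralD// (Rintegral_prodM i1 i4) (Rintegral_prodM i2 i3) sE.
by rewrite mulr0 add0r Rintegral_laplace_sin// mul0r.
Qed.

Lemma cauchy_rV_ge0 n e (v : 'rV[R]_n) : 0 < e -> 0 <= cauchy_rV e v.
Proof. by move=> e0; apply: prodr_ge0 => j _; exact: cauchy_kernel_ge0. Qed.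

Lemma integrable_cauchy_kernel e y : 0 < e ->
  leb.-integrable setT (fun x => (cauchy_kernel e (y - x))%:E).
Proof.
move=> e0; apply/integrableP; split.
  apply/measurable_EFinP; apply: continuous_measurable_fun => x.
  apply: (@continuous_comp _ _ _ (fun x => y - x) (cauchy_kernel e)).
    by apply: cvgB; [exact: cvg_cst|exact: cvg_id].
  exact: continuous_cauchy_kernel.
under eq_integral do rewrite abse_EFin ger0_norm ?cauchy_kernel_ge0//.
by rewrite integral_cauchy_kernel// ltry.
Qed.

Lemma integral_cauchy_rV n e (y : 'rV[R]_n) : 0 < e ->
  (\int[lebesgue_rV n]_x (cauchy_rV e (y - x))%:E = ((2 * pi) ^+ n)%:E)%E.
Proof.
move=> e0.
have E x : cauchy_rV e (y - x) =
    \prod_j cauchy_kernel e (y ord0 j - x ord0 j).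
  by apply: eq_bigr => j _; rewrite !mxE.
have [i iE] := integrable_prod_rV
  (fun j : 'I_n => integrable_cauchy_kernel (y ord0 j) e0).
under eq_integral do rewrite E.
rewrite -[LHS]fineK; last exact: integrable_fin_num.
congr EFin; rewrite -/(Rintegral _ _ _) iE -[n in RHS]card_ord -prodr_const.
by apply: eq_bigr => j _; rewrite /Rintegral integral_cauchy_kernel.
Qed.

End lebesgue_rV_integral.

(** * Characteristic functions and Fourier inversion *)

Section bounded_functions.
Context d (T : measurableType d) (R : realType).

Lemma measurable_cosf (f : T -> R) :
  measurable_fun setT f -> measurable_fun setT (fun x => cos (f x)).
Proof.
by move=> mf; apply: measurableT_comp => //; apply: continuous_measurable_fun;
  exact: continuous_cos.
Qed.

Lemma measurable_sinf (f : T -> R) :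
  measurable_fun setT f -> measurable_fun setT (fun x => sin (f x)).
Proof.
by move=> mf; apply: measurableT_comp => //; apply: continuous_measurable_fun;
  exact: continuous_sin.
Qed.

Variable P : probability T R.

Lemma integrable_prob_bounded (f : T -> R) (M : R) : measurable_fun setT f ->
  (forall w, `|f w| <= M) -> P.-integrable setT (fun w => (f w)%:E).
Proof.
move=> mf f1; apply: measurable_bounded_integrable => //.
  by rewrite (le_lt_trans (probability_le1 _ _)) ?ltry.
exists M; split; first exact: num_real.
by move=> x Mx w _ /=; rewrite (le_trans (f1 w))// ltW.
Qed.

Lemma Rintegral_prob_cst (r : R) : \int[P]_w r = r.
Proof.
rewrite Rintegral_cst//; transitivity (r * fine 1%E); last by rewrite mulr1.
congr (_ * fine _); exact: probability_setT.
Qed.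

Lemma normr_Rintegral_prob_le (f : T -> R) (M : R) : measurable_fun setT f ->
  (forall w, `|f w| <= M) -> `|\int[P]_w f w| <= M.
Proof.
move=> mf f1; have fi := integrable_prob_bounded mf f1.
apply: (le_trans (le_normr_Rintegral _ fi)) => //.
have := @le_Rintegral _ _ _ P setT (fun w => `|f w|) (fun=> M) measurableT.
rewrite Rintegral_prob_cst; apply => //.
- apply: (@integrable_prob_bounded _ M) => [|w]; first exact: measurableT_comp.
  by rewrite normr_id.
- by apply: (@integrable_prob_bounded _ `|M|) => [|w].
Qed.

End bounded_functions.

Section fubini_Rintegral.
Context d1 d2 (T1 : measurableType d1) (T2 : measurableType d2) (R : realType).
Variables (m1 : {sigma_finite_measure set T1 -> \bar R})
          (m2 : {sigma_finite_measure set T2 -> \bar R}).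

Lemma Rintegral_Fubini (f : T1 * T2 -> R) :
  (m1 \x m2)%E.-integrable setT (EFin \o f) ->
  (forall x, m2.-integrable setT (fun y => (f (x, y))%:E)) ->
  (forall y, m1.-integrable setT (fun x => (f (x, y))%:E)) ->
  \int[m1]_x \int[m2]_y f (x, y) = \int[m2]_y \int[m1]_x f (x, y).
Proof.
move=> fi f1 f2; congr fine.
rewrite (eq_integral (fun x => \int[m2]_y (f (x, y))%:E)%E); last first.
  by move=> x _; rewrite /Rintegral fineK//; exact: integrable_fin_num.
rewrite [RHS](eq_integral (fun y => \int[m1]_x (f (x, y))%:E)%E); last first.
  by move=> y _; rewrite /Rintegral fineK//; exact: integrable_fin_num.
exact: (Fubini fi).
Qed.

Lemma integrable_prod_bounded (g : T1 -> R) (h : T1 * T2 -> R) (M : R) :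
  (m2 setT < +oo)%E -> m1.-integrable setT (EFin \o g) ->
  measurable_fun setT h -> (forall p, `|h p| <= M) ->
  (m1 \x m2)%E.-integrable setT (fun p => (g p.1 * h p)%:E).
Proof.
move=> m2oo ig mh h1.
have i1 : m2.-integrable setT (EFin \o (fun=> M)).
  apply/integrableP; split; first exact/measurable_EFinP.
  by rewrite integral_cst//= lte_mul_pinfty.
have /measurable_EFinP mg := measurable_int _ ig.
apply: le_integrable (integrable_prodM ig i1) => //.
  apply/measurable_EFinP; apply: measurable_funM => //.
  exact: measurableT_comp.
move=> p _; rewrite /= lee_fin !normrM ler_wpM2l//.
by rewrite (le_trans (h1 _))// ler_norm.
Qed.

End fubini_Rintegral.

Section characteristic_function.
Context {R : realType} {n : nat} disp (Omega : measurableType disp).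
Variable P : probability Omega R.
Variable X : Omega -> 'rV[R]_n.
Hypothesis mX : measurable_fun setT X.
Local Notation lam := (@lebesgue_rV R n).
Implicit Types (z x : 'rV[R]_n) (e : R).

(** Real and imaginary parts of the characteristic function of [X], kept apart so that all integrals
    stay real. *)
Definition cf_cos z : R := \int[P]_w cos (dotv z (X w)).
Definition cf_sin z : R := \int[P]_w sin (dotv z (X w)).

Lemma dotvB z x y : dotv z (x - y) = dotv z x - dotv z y :> R.
Proof.
rewrite /dotv -sumrB; apply: eq_bigr => j _.
by rewrite !mxE mulrBr.
Qed.

Let mXj j : measurable_fun setT (fun w => X w ord0 j).
Proof. by have /measurable_fun_mxP := mX; exact. Qed.

Let measurable_dotvX z : measurable_fun setT (fun w => dotv z (X w)).
Proof. by apply: measurable_sum => j; apply: measurable_funM. Qed.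

Let measurable_dotv2 :
  measurable_fun setT (fun p : 'rV[R]_n * Omega => dotv p.1 (X p.2)).
Proof.
apply: measurable_sum => j; apply: measurable_funM.
  exact: (measurableT_comp (measurable_coord j) measurable_fst).
exact: (measurableT_comp (mXj j) measurable_snd).
Qed.

Let icos z : P.-integrable setT (fun w => (cos (dotv z (X w)))%:E).
Proof. by apply: (@integrable_prob_bounded _ _ _ P _ 1) => [|w]; [exact: measurable_cosf|exact: cos_max]. Qed.

Let isin z : P.-integrable setT (fun w => (sin (dotv z (X w)))%:E).
Proof. by apply: (@integrable_prob_bounded _ _ _ P _ 1) => [|w]; [exact: measurable_sinf|exact: sin_max]. Qed.

Lemma cf_cos_le1 z : `|cf_cos z| <= 1.
Proof. by apply: normr_Rintegral_prob_le => [|w]; [exact: measurable_cosf|exact: cos_max]. Qed.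

Lemma cf_sin_le1 z : `|cf_sin z| <= 1.
Proof. by apply: normr_Rintegral_prob_le => [|w]; [exact: measurable_sinf|exact: sin_max]. Qed.

Let measurable_param (f : 'rV[R]_n * Omega -> R) :
  measurable_fun setT f -> (forall p, `|f p| <= 1) ->
  measurable_fun setT (fun z => \int[P]_w f (z, w)).
Proof.
move=> mf f1.
(* Tonelli yields measurability for nonnegative integrands, so 1 is added here and subtracted
   below. *)
have m1 : measurable_fun setT (fun z => \int[P]_w (1 + f (z, w))%:E)%E.
  apply: (@measurable_fun_fubini_tonelli_F _ _ _ _ _ P
    (fun p => (1 + f p)%:E)).
    by apply/measurable_EFinP; apply: measurable_funD.
  move=> p; rewrite lee_fin -lerBlDl sub0r.
  by have := f1 p; rewrite ler_norml => /andP[].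
have mfz z : measurable_fun setT (fun w => f (z, w)).
  by apply: measurableT_comp => //; exact: measurable_pair1.
have ifz z : P.-integrable setT (fun w => (f (z, w))%:E).
  by apply: (@integrable_prob_bounded _ _ _ P _ 1).
have -> : (fun z => \int[P]_w f (z, w)) =
    (fun z => fine (\int[P]_w (1 + f (z, w))%:E)%E - 1).
  apply/funext => z; rewrite -[X in _ - X](Rintegral_prob_cst P).
  have := @RintegralD _ _ _ P setT (fun=> 1) (fun w => f (z, w)) measurableT.
  rewrite /Rintegral => ->; last 2 first.
  - by apply: (@integrable_prob_bounded _ _ _ P _ 1) => // w; rewrite normr1.
  - exact: ifz.
  by rewrite addrC addKr.
by apply: measurable_funB => //; exact: measurableT_comp m1.
Qed.

Lemma measurable_cf_cos : measurable_fun setT cf_cos.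
Proof.
apply: (measurable_param (f := fun p => cos (dotv p.1 (X p.2)))) => [|p].
  exact: measurable_cosf.
exact: cos_max.
Qed.

Lemma measurable_cf_sin : measurable_fun setT cf_sin.
Proof.
apply: (measurable_param (f := fun p => sin (dotv p.1 (X p.2)))) => [|p].
  exact: measurable_sinf.
exact: sin_max.
Qed.

Let PT : (P setT < +oo)%E. Proof. by rewrite probability_setT ltry. Qed.

Let smoothing_Fubini e (f : 'rV[R]_n * Omega -> R) (M : R) : 0 < e ->
  measurable_fun setT f -> (forall p, `|f p| <= M) ->
  \int[lam]_z (laplace_rV e z * \int[P]_w f (z, w)) =
  \int[P]_w \int[lam]_z (laplace_rV e z * f (z, w)).
Proof.
move=> e0 mf fM.
have mf1 z : measurable_fun setT (fun w => f (z, w)).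
  by apply: measurableT_comp => //; exact: measurable_pair1.
have mf2 w : measurable_fun setT (fun z => f (z, w)).
  by apply: measurableT_comp => //; exact: measurable_pair2.
have fi := integrable_prod_bounded PT (integrable_laplace_rV n e0) mf fM.
rewrite -(Rintegral_Fubini (m1 := lam) (m2 := P) fi)/=; last 2 first.
- move=> z; apply: (@integrable_prob_bounded _ _ _ P _ `|laplace_rV e z * M|) => [|w].
    exact: measurable_funM.
  rewrite !normrM ler_wpM2l//; apply: le_trans (fM _) _; exact: ler_norm.
- move=> w; have := integrableZr measurableT M (integrable_laplace_rV n e0).
  apply: le_integrable => //.
    apply/measurable_EFinP; apply: measurable_funM => //.
    exact: measurable_laplace_rV.
  move=> z _ /=; rewrite lee_fin !normrM ler_wpM2l//.
  apply: le_trans (fM _) _; exact: ler_norm.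
apply: eq_Rintegral => z _; rewrite RintegralZl//.
exact: (integrable_prob_bounded P (mf1 z) (fun w => fM (z, w))).
Qed.

(** The parenthesis is the expectation of cos <z, x - X>; exchanged with the damped integral in z,
    it leaves the transform of the Laplace kernel at x - X. *)
Lemma Rintegral_smoothing_cos e x : 0 < e ->
  \int[lam]_z (laplace_rV e z *
     (cf_cos z * cos (dotv z x) + cf_sin z * sin (dotv z x))) =
  \int[P]_w cauchy_rV e (x - X w).
Proof.
move=> e0.
have E z : cf_cos z * cos (dotv z x) + cf_sin z * sin (dotv z x) =
    \int[P]_w cos (dotv z x - dotv z (X w)).
  rewrite /cf_cos /cf_sin -(RintegralZr _ measurableT (icos z)).
  rewrite -(RintegralZr _ measurableT (isin z)) -RintegralD//; last 2 first.
    exact: (integrableZr measurableT (cos (dotv z x)) (icos z)).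
    exact: (integrableZr measurableT (sin (dotv z x)) (isin z)).
  by apply: eq_Rintegral => w _; rewrite cosB; ring.
under eq_Rintegral do rewrite E.
rewrite (smoothing_Fubini (M := 1)
  (f := fun p => cos (dotv p.1 x - dotv p.1 (X p.2)))) //; last 2 first.
- apply: measurable_cosf; apply: measurable_funB => //.
  exact: (measurableT_comp (measurable_dotv x) measurable_fst).
- by move=> p; exact: cos_max.
apply: eq_Rintegral => w _ /=.
under eq_Rintegral do rewrite -dotvB.
by have [-> _] := Rintegral_laplace_rV_cos_sin (x - X w) e0.
Qed.

Lemma Rintegral_smoothing_sin e x : 0 < e ->
  \int[lam]_z (laplace_rV e z *
     (cf_cos z * sin (dotv z x) - cf_sin z * cos (dotv z x))) = 0.
Proof.
move=> e0.
have E z : cf_cos z * sin (dotv z x) - cf_sin z * cos (dotv z x) =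
    \int[P]_w sin (dotv z x - dotv z (X w)).
  rewrite /cf_cos /cf_sin -(RintegralZr _ measurableT (icos z)).
  rewrite -(RintegralZr _ measurableT (isin z)) -RintegralB//; last 2 first.
    exact: (integrableZr measurableT (sin (dotv z x)) (icos z)).
    exact: (integrableZr measurableT (cos (dotv z x)) (isin z)).
  by apply: eq_Rintegral => w _; rewrite sinB; ring.
under eq_Rintegral do rewrite E.
rewrite (smoothing_Fubini (M := 1)
  (f := fun p => sin (dotv p.1 x - dotv p.1 (X p.2)))) //; last 2 first.
- apply: measurable_sinf; apply: measurable_funB => //.
  exact: (measurableT_comp (measurable_dotv x) measurable_fst).
- by move=> p; exact: sin_max.
rewrite -[RHS](Rintegral_prob_cst P); apply: eq_Rintegral => w _ /=.
under eq_Rintegral do rewrite -dotvB.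
by have [_ ->] := Rintegral_laplace_rV_cos_sin (x - X w) e0.
Qed.

(** The squared modulus is the characteristic function of X - X' for an independent copy X'. Only
    one of its two factors is expanded; [Rintegral_smoothing_cos] at the random point X brings in
    the other. *)
Lemma Rintegral_smoothing_norm e : 0 < e ->
  \int[lam]_z (laplace_rV e z * (cf_cos z ^+ 2 + cf_sin z ^+ 2)) =
  \int[P]_w \int[P]_w' cauchy_rV e (X w - X w').
Proof.
move=> e0.
have E z : cf_cos z ^+ 2 + cf_sin z ^+ 2 =
    \int[P]_w (cf_cos z * cos (dotv z (X w)) + cf_sin z * sin (dotv z (X w))).
  rewrite RintegralD//; last 2 first.
    have := integrableZl measurableT (cf_cos z) (icos z).
    by apply: eq_integrable.
    have := integrableZl measurableT (cf_sin z) (isin z).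
    by apply: eq_integrable.
  rewrite (RintegralZl _ measurableT (icos z)).
  by rewrite (RintegralZl _ measurableT (isin z)).
under eq_Rintegral do rewrite E.
rewrite (smoothing_Fubini (M := 2) (f := fun p =>
  cf_cos p.1 * cos (dotv p.1 (X p.2)) + cf_sin p.1 * sin (dotv p.1 (X p.2)))) //=; last 2 first.
- apply: measurable_funD; apply: measurable_funM.
  + by apply: measurableT_comp measurable_fst; exact: measurable_cf_cos.
  + exact: measurable_cosf.
  + by apply: measurableT_comp measurable_fst; exact: measurable_cf_sin.
  + exact: measurable_sinf.
- move=> p; rewrite (le_trans (ler_normD _ _))// [leRHS](_ : _ = 1 * 1 + 1 * 1); last by ring.
  by rewrite !normrM lerD// ler_pM// ?cf_cos_le1 ?cf_sin_le1 ?cos_max ?sin_max.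
by apply: eq_Rintegral => w _; rewrite Rintegral_smoothing_cos.
Qed.

Lemma measurable_cauchy_rV_shift e y : 0 < e ->
  measurable_fun setT (fun x => cauchy_rV e (y - x)).
Proof.
move=> e0; apply: measurable_prod => j _.
apply: measurableT_comp.
  by apply: continuous_measurable_fun; exact: continuous_cauchy_kernel.
under eq_fun do rewrite !mxE.
by apply: measurable_funB => //; exact: measurable_coord.
Qed.

Lemma laplace_rVE e z : laplace_rV e z = expR (- (e * \sum_j `|z ord0 j|)).
Proof. by rewrite mulr_sumr -sumrN expR_sum. Qed.

Lemma cvg_laplace_rV z : laplace_rV (harmonic k) z @[k --> \oo] --> (1 : R).
Proof.
under eq_fun do rewrite laplace_rVE; rewrite -(@expR0 R).
apply: continuous_cvg; first exact: continuous_expR.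
have h := cvgN (cvgMr_tmp (b := \sum_j `|z ord0 j|) (@cvg_harmonic R)).
by have := h _ _; rewrite mul0r oppr0; exact.
Qed.

(** Monotone convergence along e = 1 / (k + 1): the damping increases to 1, so a bound uniform in
    [e] survives although [f] is not known to be integrable. *)
Lemma integral_laplace_rV_cvg (f : 'rV[R]_n -> R) (M : \bar R) :
  measurable_fun setT f -> (forall z, 0 <= f z) ->
  (forall e, (0 < e)%R -> \int[lam]_z (laplace_rV e z * f z)%:E <= M)%E ->
  (\int[lam]_z (f z)%:E <= M)%E.
Proof.
move=> mf f0 fM.
pose g k z := (laplace_rV (harmonic k) z * f z)%:E.
have mg k : measurable_fun setT (g k).
  apply/measurable_EFinP; apply: measurable_funM => //.
  exact: measurable_laplace_rV.
have g0 k z : (0 <= g k z)%E by rewrite lee_fin mulr_ge0// laplace_rV_ge0.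
have ndg z : {homo g^~ z : k l / (k <= l)%N >-> (k <= l)%E}.
  move=> k l kl; rewrite lee_fin ler_wpM2r// !laplace_rVE ler_expR lerN2.
  rewrite ler_wpM2r ?sumr_ge0//.
  by rewrite /harmonic/= lef_pV2 ?posrE ?ltr0n// ler_nat.
have cg z : g k z @[k --> \oo] --> (f z)%:E.
  apply: cvg_EFin; first exact: nearW.
  rewrite -[X in _ --> X]mul1r; apply: cvgMr_tmp.
  exact: cvg_laplace_rV.
have := cvg_monotone_convergence (mu := lam) measurableT mg
  (fun k z _ => g0 k z) (fun z _ => ndg z).
rewrite (eq_integral (fun z => (f z)%:E)); last first.
  by move=> z _; apply/cvg_lim => //; exact: cg.
move=> h; rewrite -(cvg_lim _ h)//; apply: lime_le.
  by apply/cvg_ex; eexists; exact: h.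
by apply: nearW => k; apply: fM; exact: harmonic_gt0.
Qed.

(** One half of Plancherel. If the law is dominated by M times Lebesgue measure, every translated
    Cauchy kernel, of mass (2 pi)^n, has expectation at most M (2 pi)^n, and the damped integral of
    the squared modulus averages such expectations. *)
Lemma integral_cf_norm_le (M : R) : 0 <= M ->
  (forall B, measurable B -> P (X @^-1` B) <= M%:E * lam B)%E ->
  (\int[lam]_z (cf_cos z ^+ 2 + cf_sin z ^+ 2)%:E <= (M * (2 * pi) ^+ n)%:E)%E.
Proof.
move=> M0 PM.
have key e y : 0 < e ->
    (\int[P]_w (cauchy_rV e (y - X w))%:E <= (M * (2 * pi) ^+ n)%:E)%E.
  move=> e0; have mk := measurable_cauchy_rV_shift y e0.
  have k0 x : (0 <= (cauchy_rV e (y - x))%:E)%E by rewrite lee_fin cauchy_rV_ge0.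
  rewrite EFinM -(integral_cauchy_rV y e0).
  rewrite (_ : M = (NngNum M0)%:num)// -ge0_integral_mscale//; last first.
    exact/measurable_EFinP.
  have := @ge0_integral_pushforward _ _ _ _ _ _ mX P setT
    (fun x => (cauchy_rV e (y - x))%:E) measurableT.
  rewrite preimage_setT => <-//; last exact/measurable_EFinP.
  apply: ge0_le_measure_integral => //; last exact/measurable_EFinP.
have mf : measurable_fun setT (fun z => cf_cos z ^+ 2 + cf_sin z ^+ 2).
  apply: measurable_funD; apply: measurable_funX.
    exact: measurable_cf_cos.
  exact: measurable_cf_sin.
have C0 : 0 <= M * (2 * pi) ^+ n.
  by rewrite mulr_ge0// exprn_ge0// mulr_ge0// pi_ge0.
apply: integral_laplace_rV_cvg => // [z|e e0]; first by rewrite addr_ge0 ?sqr_ge0.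
have ilf : lam.-integrable setT
    (fun z => (laplace_rV e z * (cf_cos z ^+ 2 + cf_sin z ^+ 2))%:E).
  have := integrableZr measurableT 2 (integrable_laplace_rV n e0).
  apply: le_integrable => //.
    apply/measurable_EFinP; apply: measurable_funM => //.
    exact: measurable_laplace_rV.
  move=> z _ /=; rewrite lee_fin !normrM ler_wpM2l//.
  rewrite [leRHS]ger0_norm// ger0_norm ?addr_ge0 ?sqr_ge0// -real_normK ?num_real//.
  rewrite -[X in _ + X]real_normK ?num_real//.
  have := cf_cos_le1 z; have := cf_sin_le1 z.
  by move=> /exprn_ile1 h1 /exprn_ile1 h2; rewrite lerD ?h1 ?h2.
rewrite -[leLHS]fineK; last exact: (integrable_fin_num measurableT ilf).
rewrite lee_fin -/(Rintegral _ _ _) Rintegral_smoothing_norm//.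
have h w : 0 <= \int[P]_w' cauchy_rV e (X w - X w') <= M * (2 * pi) ^+ n.
  rewrite Rintegral_ge0/= => [|w' _]; last exact: cauchy_rV_ge0.
  rewrite -lee_fin; apply: le_trans (key e (X w) e0).
  by rewrite /Rintegral fineK// ge0_fin_numE ?(le_lt_trans (key _ _ _)) ?ltry//;
    apply: integral_ge0 => w' _; rewrite lee_fin cauchy_rV_ge0.
apply: (le_trans (ler_norm _)); apply: normr_Rintegral_prob_le => [|w].
  apply: measurableT_comp => //.
  apply: (@measurable_fun_fubini_tonelli_F _ _ _ _ _ P
    (fun p => (cauchy_rV e (X p.1 - X p.2))%:E)).
    apply/measurable_EFinP; apply: measurable_prod => j _.
    apply: measurableT_comp.
      by apply: continuous_measurable_fun; exact: continuous_cauchy_kernel.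
    under eq_fun do rewrite !mxE.
    apply: measurable_funB.
      exact: (measurableT_comp (mXj j) measurable_fst).
    exact: (measurableT_comp (mXj j) measurable_snd).
  by move=> p; rewrite lee_fin cauchy_rV_ge0.
by have /andP[? ?] := h w; rewrite ger0_norm.
Qed.

End characteristic_function.

Lemma dominated_cvg_Rintegral d (T : measurableType d) (R : realType)
    (mu : {measure set T -> \bar R}) (D : set T) (f_ : nat -> T -> R)
    (f g : T -> R) : measurable D ->
  (forall k, measurable_fun D (f_ k)) ->
  (forall x, D x -> f_ k x @[k --> \oo] --> f x) ->
  mu.-integrable D (EFin \o g) ->
  (forall k x, D x -> `|f_ k x| <= g x) ->
  \int[mu]_(x in D) f_ k x @[k --> \oo] --> \int[mu]_(x in D) f x.
Proof.
move=> mD mf_ f_f ig f_g.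
have mf : measurable_fun D f by exact: measurable_fun_cvg mf_ f_f.
have [] := @dominated_convergence _ _ _ mu D mD (fun k x => (f_ k x)%:E)
    (fun x => (f x)%:E) (EFin \o g).
- by move=> k; exact/measurable_EFinP.
- exact/measurable_EFinP.
- by apply: aeW => x Dx; apply: cvg_EFin; [exact: nearW|exact: f_f].
- exact: ig.
- by apply: aeW => x k Dx; rewrite /= lee_fin; exact: f_g.
move=> fi _ h; apply: fine_cvg; rewrite /Rintegral fineK//.
exact: integrable_fin_num fi.
Qed.

Lemma cauchy_kernel_le (R : realType) (e x : R) :
  0 < e -> cauchy_kernel e x <= 2 / e.
Proof.
move=> e0; rewrite /cauchy_kernel ler_pdivrMr; last first.
  by rewrite ltr_wpDr ?sqr_ge0// exprn_gt0.
rewrite [leRHS](_ : _ = 2 * e + 2 * x ^+ 2 / e); last by field; rewrite gt_eqF.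
rewrite lerDl; apply: divr_ge0; last exact: ltW.
by apply: mulr_ge0 => //; exact: sqr_ge0.
Qed.

(** * Boxes as generators of the Borel sets *)

Section boxes.
Context {R : realType} {n : nat}.
Local Notation leb := (@lebesgue_measure R).
Local Notation lam := (@lebesgue_rV R n).
Implicit Types (a b x y : 'rV[R]_n) (e : R).

(** No order between [a] and [b] is imposed: empty boxes are allowed, which makes the family stable
    under intersection. *)
Definition cbox a b : set 'rV[R]_n :=
  [set v | forall j, a ord0 j <= v ord0 j <= b ord0 j].

Lemma measurable_cbox a b : measurable (cbox a b).
Proof.
rewrite (_ : cbox a b = \bigcap_(j in [set: 'I_n])
    ((fun v : 'rV[R]_n => v ord0 j) @^-1` `[a ord0 j, b ord0 j])).
  apply: fin_bigcap_measurable => // j _; rewrite -[X in measurable X]setTI.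
  exact: measurable_coord.
rewrite eqEsubset; split=> v /= abv j; first by move=> _ /=; rewrite in_itv/= abv.
by have := abv j I; rewrite /= in_itv.
Qed.

Lemma cboxI a b a' b' : cbox a b `&` cbox a' b' =
  cbox (\row_j Num.max (a ord0 j) (a' ord0 j)) (\row_j Num.min (b ord0 j) (b' ord0 j)).
Proof.
rewrite eqEsubset; split=> v /= => [[h h'] j|h].
  have /andP[h1 h2] := h j; have /andP[h3 h4] := h' j.
  by rewrite !mxE ge_max le_min h1 h2 h3 h4.
split=> j; have := h j; rewrite !mxE ge_max le_min.
  by move=> /andP[/andP[-> _] /andP[-> _]].
by move=> /andP[/andP[_ ->] /andP[_ ->]].
Qed.

Lemma bigcup_cbox : \bigcup_k cbox (const_mx (- k%:R)) (const_mx k%:R) = setT.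
Proof.
rewrite -subTset => v _.
have vk : \sum_j `|v ord0 j| <= (Num.bound (\sum_j `|v ord0 j|))%:R :> R.
  by rewrite ltW// archi_boundP// sumr_ge0.
exists (Num.bound (\sum_j `|v ord0 j|)) => // j; rewrite !mxE -ler_norml; apply: le_trans vk.
by rewrite (bigD1 j)//= lerDl sumr_ge0.
Qed.

(** A half-space v_j >= c is a countable union of boxes whose lower side in coordinate j is c, so
    the coordinates are measurable for the generated sigma-algebra. *)
Lemma measurable_cboxE :
  @measurable _ 'rV[R]_n = <<s [set B | exists a b, B = cbox a b] >>.
Proof.
set G := [set B | _]; rewrite eqEsubset; split; last first.
  apply: smallest_sub; first exact: sigma_algebra_measurable.
  by move=> _ [a [b ->]]; exact: measurable_cbox.
suff mid : measurable_fun setT (fun v : g_sigma_algebraType G => v : 'rV[R]_n).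
  by move=> A mA; have := mid measurableT A mA; rewrite setTI preimage_id.
apply/measurable_fun_mxP => i j; rewrite (ord1 i).
apply: (@measurability _ _ _ _ _ _ (@RGenCInfty.G R)).
  exact: RGenCInfty.measurableE.
move=> _ [_ [c ->] <-]; rewrite setTI.
rewrite (_ : _ @^-1` _ = \bigcup_k
   cbox (\row_l (if l == j then c else - k%:R)) (const_mx k%:R)).
  apply: bigcupT_measurable => k; apply: sub_sigma_algebra.
  by eexists; eexists.
rewrite eqEsubset; split => v /=.
  rewrite in_itv/= andbT => cv.
  have : [set: 'rV[R]_n] v by [].
  rewrite -bigcup_cbox => -[k _ vk]; exists k => // l.
  have := vk l; rewrite !mxE; case: eqP => // -> /andP[_ ->].
  by rewrite cv.
by move=> [k _ /(_ j)]; rewrite !mxE eqxx in_itv/= andbT => /andP[].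
Qed.

Lemma cauchy_rVN e x : cauchy_rV e (- x) = cauchy_rV e x.
Proof. by apply: eq_bigr => j _; rewrite /cauchy_kernel mxE sqrrN. Qed.

Lemma integral_cauchy_rV_cbox e a b y : 0 < e ->
  (forall j, a ord0 j <= b ord0 j) ->
  (\int[lam]_(x in cbox a b) (cauchy_rV e (x - y))%:E =
   (\prod_j (2 * (atan ((b ord0 j - y ord0 j) / e)
                  - atan ((a ord0 j - y ord0 j) / e))))%:E)%E.
Proof.
move=> e0 ab.
pose F (j : 'I_n) := (fun s => cauchy_kernel e (y ord0 j - s)) \_ `[a ord0 j, b ord0 j].
have iF j : leb.-integrable setT (EFin \o F j).
  rewrite /F -restrict_EFin; apply/integrable_restrict => //.
  rewrite setTI; apply: integrableS (integrable_cauchy_kernel (y ord0 j) e0) => //.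
have [i iE] := integrable_prod_rV iF.
rewrite integral_mkcond (eq_integral (fun x => (\prod_j F j (x ord0 j))%:E)).
  rewrite -[LHS]fineK; last exact: (integrable_fin_num measurableT i).
  congr EFin; rewrite -/(Rintegral _ _ _) iE; apply: eq_bigr => j _.
  by rewrite -Rintegral_mkcond /Rintegral integral_cauchy_kernel_itv.
move=> x _; rewrite patchE; case: ifPn => [/set_mem abx|].
  rewrite -cauchy_rVN opprB; congr EFin; apply: eq_bigr => j _.
  by rewrite /F patchE mem_set ?mxE//= in_itv/=; exact: abx.
rewrite notin_setE => /existsNP[j abxj].
rewrite (bigD1 j)//= /F patchE memNset ?mul0r//= in_itv/=.
Qed.

Lemma lebesgue_cbox_lty a b : (lam (cbox a b) < +oo)%E.
Proof.
apply: (@le_lt_trans _ _ (lam (cbox a (\row_j Num.max (a ord0 j) (b ord0 j))))).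
  apply: le_measure; rewrite ?inE; [exact: measurable_cbox..|].
  move=> v /= abv j; have /andP[h1 h2] := abv j.
  by rewrite !mxE h1 le_max h2 orbT.
rewrite [X in (X < _)%E]lebesgue_rV_box ?ltry// => j.
by rewrite mxE le_max lexx.
Qed.

End boxes.

Lemma cvg_atan_harmonic (R : realType) (c : R) :
  atan (c / harmonic k) @[k --> \oo] --> pi / 2 * Num.sg c.
Proof.
have pos (x : R) : 0 < x -> atan (x / harmonic k) @[k --> \oo] --> pi / 2.
  move=> x0; apply: (@cvg_comp _ _ _ (fun k => x / harmonic k) (@atan R) _
    (pinfty_nbhs R)); last exact: cvgy_atan.
  apply/cvgryPge => A; near=> k.
  rewrite /harmonic/= invrK -ler_pdivrMl// (@le_trans _ _ k%:R)//; last first.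
    by rewrite ler_nat.
  by near: k; exact: nbhs_infty_ger.
have [c0|c0|->] := ltrgt0P c.
- by rewrite gtr0_sg// mulr1; exact: pos.
- rewrite ltr0_sg// mulrN1.
  under eq_fun do rewrite -[X in atan (X / _)]opprK mulNr atanN.
  by apply: cvgN; apply: pos; rewrite oppr_gt0.
- by rewrite sgr0 mulr0; under eq_fun do rewrite mul0r atan0; exact: cvg_cst.
Unshelve. all: by end_near. Qed.

Section density_measure.
Local Open Scope ereal_scope.
Context d (T : measurableType d) (R : realType) (mu : {measure set T -> \bar R}).
Variables (f : T -> R) (mf : measurable_fun setT f) (f0 : forall x, (0 <= f x)%R).

(** The proofs of measurability and positivity are arguments, although the body ignores them, so
    that a measure structure can be attached to the definition. *)
Definition density_measure of measurable_fun setT f & (forall x, (0 <= f x)%R) :=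
  fun A => \int[mu]_(x in A) (f x)%:E.

Local Notation nu := (density_measure mf f0).

Let nu0 : nu set0 = 0. Proof. exact: integral_set0. Qed.

Let nu_ge0 A : 0 <= nu A.
Proof. by apply: integral_ge0 => x _; rewrite lee_fin. Qed.

Let nu_sigma_additive : semi_sigma_additive nu.
Proof.
move=> F mF tF mUF; rewrite /density_measure; apply: cvg_toP.
  apply: ereal_nondecreasing_is_cvgn => k l kl.
  apply: lee_sum_nneg_natr => // i _ _; exact: nu_ge0.
rewrite ge0_integral_bigcup//; first exact/measurable_EFinP/measurable_funTS.
by move=> x _; rewrite lee_fin.
Qed.

HB.instance Definition _ := isMeasure.Build _ _ _ nu nu0 nu_ge0 nu_sigma_additive.

End density_measure.

(** * Fourier inversion for an integrable characteristic function *)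

Section fourier_inversion.
Context {R : realType} {n : nat} disp (Omega : measurableType disp).
Variable P : probability Omega R.
Variable X : Omega -> 'rV[R]_n.
Hypothesis mX : measurable_fun setT X.
Local Notation lam := (@lebesgue_rV R n).
Local Notation C := (cf_cos P X).
Local Notation S := (cf_sin P X).
Hypothesis iC : lam.-integrable setT (EFin \o C).
Hypothesis iS : lam.-integrable setT (EFin \o S).
Implicit Types (z x a b : 'rV[R]_n) (e : R).

(** Real part of the inversion integral; [inv_density_im0] shows that the imaginary part is zero. *)
Definition inv_density x : R :=
  (2 * pi) ^- n * \int[lam]_z (C z * cos (dotv z x) + S z * sin (dotv z x)).

Let mC := measurable_cf_cos P mX.
Let mS := measurable_cf_sin P mX.

Let c0 : 0 < (2 * pi) ^- n :> R.
Proof. by rewrite invr_gt0 exprn_gt0// mulr_gt0// pi_gt0. Qed.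

(** Density of X plus independent Cauchy noise of scale 1 / (k + 1) in each coordinate. It is
    visibly nonnegative and equals the damped inversion integral, hence tends to [inv_density],
    which inherits positivity and measurability. *)
Let smooth k x : R := (2 * pi) ^- n * \int[P]_w cauchy_rV (harmonic k) (x - X w).

Let h0 k : 0 < harmonic k :> R. Proof. exact: harmonic_gt0. Qed.

Let iCS : lam.-integrable setT (EFin \o (fun z => `|C z| + `|S z|)).
Proof.
have := integrableD measurableT (integrable_norm iC) (integrable_norm iS).
exact.
Qed.

Let bound k z (f1 f2 : R) : `|f1| <= 1 -> `|f2| <= 1 ->
  `|laplace_rV (harmonic k) z * (C z * f1 + S z * f2)| <= `|C z| + `|S z|.
Proof.
move=> h1 h2; rewrite normrM -[leRHS]mul1r ler_pM//.
  by rewrite ger0_norm ?laplace_rV_ge0// laplace_rV_le1.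
rewrite (le_trans (ler_normD _ _))// !normrM.
by rewrite lerD// ler_piMr.
Qed.

Let cvg_smoothing (f g : 'rV[R]_n -> R) :
  measurable_fun setT f -> measurable_fun setT g ->
  (forall z, `|f z| <= 1) -> (forall z, `|g z| <= 1) ->
  \int[lam]_z (laplace_rV (harmonic k) z * (C z * f z + S z * g z)) @[k --> \oo]
    --> \int[lam]_z (C z * f z + S z * g z).
Proof.
move=> mf mg f1 g1; apply: dominated_cvg_Rintegral iCS _ => //.
- move=> k; apply: measurable_funM; first exact: measurable_laplace_rV.
  by apply: measurable_funD; apply: measurable_funM.
- move=> z _; rewrite -[X in _ --> X]mul1r; apply: cvgMr_tmp.
  exact: cvg_laplace_rV.
- by move=> k z _; exact: bound.
Qed.

Let cvg_smooth x : smooth k x @[k --> \oo] --> inv_density x.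
Proof.
rewrite /smooth /inv_density; apply: cvgMl_tmp.
under eq_fun do rewrite -Rintegral_smoothing_cos//.
apply: cvg_smoothing => [||z|z]; [exact: measurable_cos_dotv|
  exact: measurable_sin_dotv|exact: cos_max|exact: sin_max].
Qed.

(** True for the damped integrals by [Rintegral_smoothing_sin], then by dominated convergence. It
    identifies the real function [inv_density] with the complex formula demanded of a transition
    density. *)
Lemma inv_density_im0 x :
  \int[lam]_z (C z * sin (dotv z x) - S z * cos (dotv z x)) = 0.
Proof.
have h : \int[lam]_z (laplace_rV (harmonic k) z *
      (C z * sin (dotv z x) + S z * - cos (dotv z x))) @[k --> \oo]
    --> \int[lam]_z (C z * sin (dotv z x) + S z * - cos (dotv z x)).
  apply: cvg_smoothing => [||z|z]; [exact: measurable_sin_dotv|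
    by apply: measurableT_comp => //; exact: measurable_cos_dotv|exact: sin_max|].
  by rewrite normrN cos_max.
under eq_Rintegral do rewrite -mulrN.
apply: (cvg_unique (@Rhausdorff R) h).
rewrite (_ : (fun k => _) = cst 0); first exact: cvg_cst.
apply/funext => k; under eq_Rintegral do rewrite mulrN.
exact: Rintegral_smoothing_sin.
Qed.

Let smooth_ge0 k x : 0 <= smooth k x.
Proof.
apply: mulr_ge0; first exact: ltW.
by apply: Rintegral_ge0 => w _; exact: cauchy_rV_ge0.
Qed.

Lemma inv_density_ge0 x : 0 <= inv_density x.
Proof.
have h := @cvg_smooth x; rewrite -(cvg_lim (@Rhausdorff R) h).
apply: limr_ge; first by apply/cvg_ex; eexists; exact: h.
by apply: nearW => k; exact: smooth_ge0.
Qed.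

Let m2 k : measurable_fun setT
  (fun p : 'rV[R]_n * Omega => cauchy_rV (harmonic k) (p.1 - X p.2)).
Proof.
apply: measurable_prod => j _; apply: measurableT_comp.
  by apply: continuous_measurable_fun; exact: continuous_cauchy_kernel.
under eq_fun do rewrite !mxE.
apply: measurable_funB.
  exact: (measurableT_comp (measurable_coord j) measurable_fst).
have mXj : measurable_fun setT (fun w => X w ord0 j).
  by have /measurable_fun_mxP := mX; exact.
exact: (measurableT_comp mXj measurable_snd).
Qed.

Let measurable_smooth k : measurable_fun setT (smooth k).
Proof.
apply: measurable_funM => //; apply: measurableT_comp => //.
apply: (@measurable_fun_fubini_tonelli_F _ _ _ _ _ P
  (fun p : 'rV[R]_n * Omega => (cauchy_rV (harmonic k) (p.1 - X p.2))%:E)).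
  by apply/measurable_EFinP; exact: m2.
by move=> p; rewrite lee_fin cauchy_rV_ge0.
Qed.

Lemma measurable_inv_density : measurable_fun setT inv_density.
Proof.
apply: measurable_fun_cvg (fun k => measurable_smooth k) _ => x _.
exact: cvg_smooth.
Qed.

(** Cauchy-Schwarz for the vectors (C, S) and (cos, sin), by Lagrange's identity. The modulus [g]
    will be exp (- t Re psi). *)
Lemma inv_density_le (g : 'rV[R]_n -> R) x :
  lam.-integrable setT (EFin \o g) ->
  (forall z, 0 <= g z) -> (forall z, C z ^+ 2 + S z ^+ 2 = g z ^+ 2) ->
  inv_density x <= (2 * pi) ^- n * \int[lam]_z g z.
Proof.
move=> ig g0 gE; rewrite ler_pM2l//; apply: le_Rintegral => //.
  apply: le_integrable iCS => //.
    apply/measurable_EFinP; apply: measurable_funD; apply: measurable_funM => //.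
      exact: measurable_cos_dotv.
    exact: measurable_sin_dotv.
  move=> z _ /=; rewrite lee_fin [leRHS]ger0_norm ?addr_ge0//.
  rewrite (le_trans (ler_normD _ _))// !normrM lerD// ler_piMr// ?cos_max ?sin_max//.
move=> z _; apply: le_trans (ler_norm _) _.
rewrite -(@ler_pXn2r _ 2) ?nnegrE// -gE real_normK ?num_real//.
rewrite -[leRHS]mulr1 -(cos2Dsin2 (dotv z x)) -subr_ge0.
rewrite [leRHS](_ : _ = (C z * sin (dotv z x) - S z * cos (dotv z x)) ^+ 2) ?sqr_ge0//.
by ring.
Qed.

Let smooth_le k x : smooth k x <= (2 * pi) ^- n * \int[lam]_z (`|C z| + `|S z|).
Proof.
rewrite /smooth -Rintegral_smoothing_cos// ler_pM2l//.
have b z := @bound k z (cos (dotv z x)) (sin (dotv z x)) (cos_max _) (sin_max _).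
apply: le_Rintegral => //; last by move=> z _; apply: le_trans (ler_norm _) _.
apply: le_integrable iCS => //.
  apply/measurable_EFinP; apply: measurable_funM; first exact: measurable_laplace_rV.
  apply: measurable_funD; apply: measurable_funM => //.
    exact: measurable_cos_dotv.
  exact: measurable_sin_dotv.
by move=> z _ /=; rewrite lee_fin [leRHS]ger0_norm ?addr_ge0.
Qed.

(** Limit of [itv_at], the probability that u plus Cauchy noise falls in [s, t]. For s < t it is 1
    inside, 0 outside and 1/2 at the end points, so it is only squeezed between the indicators of
    the open and of the closed interval. *)
Let itv_sg (s t u : R) : R := (Num.sg (t - u) - Num.sg (s - u)) / 2.

Let itv_at k (s t u : R) : R :=
  (atan ((t - u) / harmonic k) - atan ((s - u) / harmonic k)) / pi.

Let itv_at_bound k s t u : s <= t -> 0 <= itv_at k s t u <= 1.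
Proof.
move=> st; rewrite divr_ge0 ?pi_ge0//=; last first.
  have := integral_cauchy_kernel_itv u (h0 k) st.
  have : (0 <= \int[@lebesgue_measure R]_(x in `[s, t])
      (cauchy_kernel (harmonic k) (u - x))%:E)%E.
    by apply: integral_ge0 => x _; rewrite lee_fin cauchy_kernel_ge0.
  by move=> + E; rewrite E lee_fin pmulr_rge0.
rewrite ler_pdivrMr ?pi_gt0// mul1r.
have := @atan_ltpi2 R ((t - u) / harmonic k).
have := @atan_gtNpi2 R ((s - u) / harmonic k).
lra.
Qed.

Let cvg_itv_at s t u : itv_at k s t u @[k --> \oo] --> itv_sg s t u.
Proof.
rewrite /itv_at /itv_sg.
rewrite (_ : (_ - _) / 2 = (pi / 2 * Num.sg (t - u) - pi / 2 * Num.sg (s - u)) / pi).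
  by apply: cvgMr_tmp; apply: cvgB; exact: cvg_atan_harmonic.
by rewrite -mulrBr [RHS]mulrC !mulrA mulVf ?gt_eqF ?pi_gt0// mul1r mulrC.
Qed.

Let smooth_box k a b : (forall j, a ord0 j <= b ord0 j) ->
  (\int[lam]_(x in cbox a b) (smooth k x)%:E =
   \int[P]_w (\prod_j itv_at k (a ord0 j) (b ord0 j) (X w ord0 j))%:E)%E.
Proof.
move=> ab; have mbox := measurable_cbox a b.
pose K p : R := (2 * pi) ^- n * cauchy_rV (harmonic k) (p.1 - X p.2).
have K0 p : 0 <= K p by apply: mulr_ge0; [exact: ltW|exact: cauchy_rV_ge0].
have mK : measurable_fun setT K by apply: measurable_funM => //; exact: m2.
have K_le p : K p <= (2 * pi) ^- n * (2 / harmonic k) ^+ n.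
  rewrite ler_pM2l// -[in leRHS](card_ord n) -prodr_const; apply: ler_prod => j _.
  by rewrite cauchy_kernel_ge0//= cauchy_kernel_le.
have iK x : P.-integrable setT (fun w => (K (x, w))%:E).
  apply: (@integrable_prob_bounded _ _ _ P _ ((2 * pi) ^- n * (2 / harmonic k) ^+ n)).
    by apply: measurableT_comp => //; exact: measurable_pair1.
  by move=> w; rewrite ger0_norm.
transitivity (\int[lam]_x \int[P]_w (\1_(cbox a b) x * K (x, w))%:E)%E.
  rewrite integral_mkcond; apply: eq_integral => x _.
  rewrite patchE indicE; case: ifPn => _.
    under eq_integral do rewrite mul1r.
    rewrite -[RHS]fineK; last exact: (integrable_fin_num measurableT (iK x)).
    congr EFin; rewrite /smooth -RintegralZl//.
    apply: (@integrable_prob_bounded _ _ _ P _ ((2 / harmonic k) ^+ n)).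
      exact: (measurableT_comp (m2 k) (measurable_pair1 x)).
    move=> w; rewrite ger0_norm ?cauchy_rV_ge0//.
    rewrite -[in leRHS](card_ord n) -prodr_const; apply: ler_prod => j _.
    by rewrite cauchy_kernel_ge0//= cauchy_kernel_le.
  by under eq_integral do rewrite mul0r; rewrite integral0.
have mG : measurable_fun setT (fun p => (\1_(cbox a b) p.1 * K p)%:E).
  apply/measurable_EFinP; apply: measurable_funM => //.
  have m1 : measurable_fun setT (\1_(cbox a b) : 'rV[R]_n -> R).
    exact: measurable_indic.
  exact: (measurableT_comp m1 measurable_fst).
have := @fubini_tonelli _ _ _ _ _ lam P (fun p => (\1_(cbox a b) p.1 * K p)%:E) mG.
move=> ->; last by move=> p; rewrite lee_fin mulr_ge0// indicE ler0n.
apply: eq_integral => w _ /=.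
transitivity (\int[lam]_(x in cbox a b)
    (((2 * pi) ^- n)%:E * (cauchy_rV (harmonic k) (x - X w))%:E))%E.
  rewrite [RHS]integral_mkcond; apply: eq_integral => x _.
  by rewrite patchE indicE; case: ifPn => _; rewrite ?mul1r ?mul0r.
rewrite ge0_integralZl//; last 3 first.
- apply: measurable_funTS; apply/measurable_EFinP.
  exact: (measurableT_comp (m2 k) (measurable_pair2 w)).
- by move=> x _; rewrite lee_fin cauchy_rV_ge0.
- by rewrite lee_fin ltW.
rewrite integral_cauchy_rV_cbox// -EFinM; congr EFin.
rewrite -exprVn -[n in _ ^+ n]card_ord -prodr_const -big_split/=.
apply: eq_bigr => j _; rewrite /itv_at.
by rewrite invfM mulrACA mulVf// mul1r mulrC.
Qed.

Let prod_itv_at_bound k a b w : (forall j, a ord0 j <= b ord0 j) ->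
  0 <= \prod_j itv_at k (a ord0 j) (b ord0 j) (X w ord0 j) <= 1.
Proof.
move=> ab; rewrite prodr_ge0/= => [|j _]; last first.
  by have /andP[] := itv_at_bound k (X w ord0 j) (ab j).
by apply: prodr_ile1 => j _; exact: itv_at_bound.
Qed.

Let measurable_itv_at k s t : measurable_fun setT (itv_at k s t).
Proof.
have mat c : measurable_fun setT (fun u : R => atan ((c - u) / harmonic k)).
  apply: continuous_measurable_fun => u; apply: continuous_comp.
    by apply: cvgMr_tmp; apply: cvgB; [exact: cvg_cst|exact: cvg_id].
  exact: continuous_atan.
by apply: measurable_funM => //; apply: measurable_funB.
Qed.

Let itv_sg_bound (s t u : R) : s <= t ->
  ((s < u < t)%R%:R : R) <= itv_sg s t u <= (s <= u <= t)%R%:R.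
Proof.
move=> st; rewrite /itv_sg.
have [tu|tu|tu] := ltrgt0P (t - u); have [su|su|su] := ltrgt0P (s - u);
  rewrite ?(gtr0_sg tu) ?(ltr0_sg tu) ?(gtr0_sg su) ?(ltr0_sg su) ?tu ?su ?sgr0;
  move: tu su; rewrite ?subr_gt0 ?subr_lt0; do ?[move/eqP; rewrite subr_eq0 => /eqP];
  case: (ltgtP s u); case: (ltgtP u t) => //=; lra.
Qed.

Let integral_inv_density_cbox a b : (forall j, a ord0 j <= b ord0 j) ->
  \int[lam]_(x in cbox a b) inv_density x =
  \int[P]_w \prod_j itv_sg (a ord0 j) (b ord0 j) (X w ord0 j).
Proof.
move=> ab; have mbox := measurable_cbox a b.
pose M := (2 * pi) ^- n * \int[lam]_z (`|C z| + `|S z|).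
have h1 : \int[lam]_(x in cbox a b) smooth k x @[k --> \oo]
    --> \int[lam]_(x in cbox a b) inv_density x.
  apply: (@dominated_cvg_Rintegral _ _ _ lam _ smooth _ (fun=> M)) => //.
  - by move=> k; apply: measurable_funTS; exact: measurable_smooth.
  - apply/integrableP; split; first exact/measurable_EFinP.
    by rewrite integral_cst//= lte_mul_pinfty// lebesgue_cbox_lty.
  - by move=> k x _; rewrite ger0_norm// smooth_le.
have mXj j : measurable_fun setT (fun w => X w ord0 j).
  by have /measurable_fun_mxP := mX; exact.
have h2 : \int[P]_w \prod_j itv_at k (a ord0 j) (b ord0 j) (X w ord0 j) @[k --> \oo]
    --> \int[P]_w \prod_j itv_sg (a ord0 j) (b ord0 j) (X w ord0 j).
  apply: (@dominated_cvg_Rintegral _ _ _ P setT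
    (fun k w => \prod_j itv_at k (a ord0 j) (b ord0 j) (X w ord0 j)) _ (fun=> 1)) => //.
  - move=> k; apply: measurable_prod => j _.
    exact: (measurableT_comp (measurable_itv_at k _ _) (mXj j)).
  - move=> w _; apply: cvg_big => [|j _]; first exact: mul_continuous.
    exact: cvg_itv_at.
  - by apply: (@integrable_prob_bounded _ _ _ P _ 1) => // w; rewrite normr1.
  - by move=> k w _; have /andP[? ?] := prod_itv_at_bound k w ab; rewrite ger0_norm.
rewrite (_ : (fun k => _) = (fun k => \int[lam]_(x in cbox a b) smooth k x)) in h2.
  exact: (cvg_unique (@Rhausdorff R) h1 h2).
by apply/funext => k; rewrite /Rintegral smooth_box.
Qed.

Let nu := density_measure lam measurable_inv_density inv_density_ge0.

Let nu_cbox_fin a b : (nu (cbox a b) < +oo)%E.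
Proof.
pose M := (2 * pi) ^- n * \int[lam]_z (`|C z| + `|S z|).
have mbox := measurable_cbox a b.
apply: (@le_lt_trans _ _ (\int[lam]_(x in cbox a b) M%:E)%E).
  apply: ge0_le_integral => //.
  - by move=> x _; rewrite lee_fin inv_density_ge0.
  - by apply/measurable_EFinP/measurable_funTS; exact: measurable_inv_density.
  - move=> x _; rewrite lee_fin; have h := @cvg_smooth x.
    rewrite -(cvg_lim (@Rhausdorff R) h); apply: limr_le.
      by apply/cvg_ex; eexists; exact: h.
    by apply: nearW => k; exact: smooth_le.
rewrite integral_cst// lte_mul_pinfty ?lebesgue_cbox_lty// lee_fin.
by apply: mulr_ge0; [exact: ltW|exact: Rintegral_ge0].
Qed.

Let measurable_preimageX B : measurable B -> measurable (X @^-1` B).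
Proof. by move=> mB; rewrite -[X in measurable X]setTI; exact: mX. Qed.

Let obox a b : set 'rV[R]_n := \bigcap_(j in [set: 'I_n])
    ((fun v : 'rV[R]_n => v ord0 j) @^-1` `]a ord0 j, b ord0 j[).

Let measurable_obox a b : measurable (obox a b).
Proof.
apply: fin_bigcap_measurable => // j _; rewrite -[X in measurable X]setTI.
exact: measurable_coord.
Qed.

Let nu_squeeze a b : (forall j, a ord0 j <= b ord0 j) ->
  (P (X @^-1` obox a b) <= nu (cbox a b) <= P (X @^-1` cbox a b))%E.
Proof.
move=> ab.
have mXj j : measurable_fun setT (fun w => X w ord0 j).
  by have /measurable_fun_mxP := mX; exact.
have nuE : nu (cbox a b) =
    (\int[P]_w (\prod_j itv_sg (a ord0 j) (b ord0 j) (X w ord0 j))%:E)%E.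
  have bd w : 0 <= \prod_j itv_sg (a ord0 j) (b ord0 j) (X w ord0 j) <= 1.
    have bj j : 0 <= itv_sg (a ord0 j) (b ord0 j) (X w ord0 j) <= 1.
      have /andP[h1 h2] := itv_sg_bound (X w ord0 j) (ab j).
      by rewrite (le_trans _ h1)//= (le_trans h2)// lern1 leq_b1.
    rewrite prodr_ge0/= => [|j _]; last by have /andP[] := bj j.
    by apply: prodr_ile1 => j _; exact: bj.
  have ms s t : measurable_fun setT (itv_sg s t).
    by apply: measurable_fun_cvg (fun k => measurable_itv_at k s t) _ => u _;
      exact: cvg_itv_at.
  rewrite -[RHS]fineK; last first.
    apply: (@integrable_fin_num _ _ _ P setT measurableT).
    apply: (@integrable_prob_bounded _ _ _ P _ 1).
      apply: measurable_prod => j _; exact: (measurableT_comp (ms _ _) (mXj j)).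
    by move=> w; have /andP[? ?] := bd w; rewrite ger0_norm.
  rewrite -/(Rintegral _ _ _) -integral_inv_density_cbox// /Rintegral fineK//.
  have h : nu (cbox a b) \is a fin_num.
    by rewrite ge0_fin_numE//; exact: nu_cbox_fin.
  exact: h.
have ms : measurable_fun setT (fun w => (\prod_j itv_sg (a ord0 j) (b ord0 j) (X w ord0 j))%:E).
  apply/measurable_EFinP; apply: measurable_prod => j _.
  apply: (measurableT_comp _ (mXj j)).
  by apply: measurable_fun_cvg (fun k => measurable_itv_at k _ _) _ => u _;
      exact: cvg_itv_at.
have p0 w : 0 <= \prod_j itv_sg (a ord0 j) (b ord0 j) (X w ord0 j).
  apply: prodr_ge0 => j _; have /andP[h1 _] := itv_sg_bound (X w ord0 j) (ab j).
  by apply: le_trans h1.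
have i1 B : measurable B -> (\int[P]_w (\1_(X @^-1` B) w)%:E = P (X @^-1` B))%E.
  by move=> mB; rewrite integral_indic ?setIT//; exact: measurable_preimageX.
apply/andP; split; rewrite nuE -i1; do ?[exact: measurable_obox|exact: measurable_cbox];
  apply: ge0_le_integral => //; do ?[by move=> w _; rewrite lee_fin];
  do ?[by apply/measurable_EFinP; apply: measurable_indic; apply: measurable_preimageX;
         first [exact: measurable_obox|exact: measurable_cbox]].
- move=> w _; rewrite lee_fin indicE; have [/set_mem h|_] := boolP (w \in _); last exact: p0.
  rewrite big1// => j _; have /andP[h1 h2] := itv_sg_bound (X w ord0 j) (ab j).
  have := h j I; rewrite /= in_itv/= => hj; rewrite hj in h1.
  by apply/eqP; rewrite eq_le h1 andbT (le_trans h2)// lern1 leq_b1.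
- move=> w _; rewrite lee_fin indicE; have [_|] := boolP (w \in _).
    apply: prodr_ile1 => j _; have /andP[h1 h2] := itv_sg_bound (X w ord0 j) (ab j).
    by rewrite (le_trans _ h1)//= (le_trans h2)// lern1 leq_b1.
  rewrite notin_setE => /existsNP[j /negP hj].
  rewrite (bigD1 j)//=; have /andP[h1 h2] := itv_sg_bound (X w ord0 j) (ab j).
  rewrite (negbTE hj) in h2.
  rewrite (_ : itv_sg _ _ _ = 0) ?mul0r//; apply/eqP; rewrite eq_le h2/=.
  exact: le_trans h1.
Qed.

(** The law might charge the boundary of the box, so the squeeze alone does not give equality. But
    the closed box lies in the open boxes enlarged by 1 / (k + 1), and [nu], finite on boxes, is
    continuous from above along the enlarged closed ones. *)
Let nu_cboxE a b : nu (cbox a b) = P (X @^-1` cbox a b).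
Proof.
have [ab|] := pselect (forall j, a ord0 j <= b ord0 j); last first.
  move=> /existsNP[j /negP jab].
  have -> : cbox a b = set0.
    rewrite -subset0 => v /(_ j) /andP[h1 h2]; apply: (negP jab).
    exact: le_trans h2.
  by rewrite preimage_set0 !measure0.
apply/eqP; rewrite eq_le; apply/andP; split; first by have /andP[] := nu_squeeze ab.
pose F k := cbox (\row_j (a ord0 j - harmonic k)) (\row_j (b ord0 j + harmonic k)).
have FE : \bigcap_k F k = cbox a b.
  rewrite eqEsubset; split => v h.
    move=> j; apply/andP; split.
      apply/ler_addgt0Pr => e e0.
      have [k _ /(_ k (leqnn k)) ke] := near_infty_natSinv_lt (PosNum e0).
      have /(_ j)/andP[+ _] := h k I; rewrite mxE lerBlDr => /le_trans; apply.
      by rewrite lerD2l ltW.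
    apply/ler_addgt0Pr => e e0.
    have [k _ /(_ k (leqnn k)) ke] := near_infty_natSinv_lt (PosNum e0).
    have /(_ j)/andP[_] := h k I; rewrite mxE => /le_trans; apply.
    by rewrite lerD2l ltW.
  move=> k _ j; have /andP[h1 h2] := h j; rewrite !mxE lerBlDr.
  have hk := ltW (h0 k).
  by rewrite (le_trans h1) ?lerDl// (le_trans h2) ?lerDl.
have mF k : measurable (F k) by exact: measurable_cbox.
have := @nonincreasing_cvg_mu _ _ _ nu F (nu_cbox_fin _ _) mF.
rewrite FE => /(_ (measurable_cbox a b)) cF.
have {}cF : nu (F k) @[k --> \oo] --> nu (cbox a b).
  apply: cF => k l kl; apply/subsetPset => v h j.
  have /andP[h1 h2] := h j; rewrite !mxE in h1 h2 *.
  have hl : harmonic l <= harmonic k :> R by rewrite /harmonic/= lef_pV2 ?posrE// ler_nat.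
  by rewrite (le_trans _ h1) ?lerB// (le_trans h2) ?lerD.
rewrite -(cvg_lim _ cF)//; apply: lime_ge; first by apply/cvg_ex; eexists; exact: cF.
apply: nearW => k.
have abk j : (\row_j (a ord0 j - harmonic k)) ord0 j <=
    (\row_j (b ord0 j + harmonic k)) ord0 j :> R.
  by rewrite !mxE; have := ab j; have := h0 k; move: (harmonic k) => h; lra.
have /andP[h _] := nu_squeeze abk; apply: le_trans h.
apply: le_measure; rewrite ?inE; do ?[apply: measurable_preimageX].
- exact: measurable_cbox.
- exact: measurable_obox.
move=> w h j _; have /andP[h1 h2] := h j; rewrite /= in_itv/= !mxE.
have := h0 k; rewrite /harmonic/=; move: h1 h2.
move: (a _ _) (b _ _) (X w _ _) (_^-1) => s t u v h1 h2 hv.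
by apply/andP; split; lra.
Qed.

Lemma inv_density_is_density : is_density P X inv_density.
Proof.
split; [exact: measurable_inv_density|exact: inv_density_ge0|] => B mB.
have E := @measure_unique _ R 'rV[R]_n _ (fun k => cbox (const_mx (- k%:R)) (const_mx k%:R))
  measurable_cboxE _ _ bigcup_cbox (pushforward P X) nu.
apply: (E _ _ mX) => //.
- move=> _ _ [a [b ->]] [a' [b' ->]]; rewrite cboxI; eexists; eexists; reflexivity.
- by move=> k; eexists; eexists.
- by move=> _ [a [b ->]]; exact: (esym (nu_cboxE a b)).
- move=> k; rewrite (le_lt_trans (probability_le1 _ _)) ?ltry//.
  by apply: measurable_preimageX; exact: measurable_cbox.
Qed.

End fourier_inversion.

(** * Elementary inequalities for the cosine *)

Section trigonometric_inequalities.
Context {R : realType}.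
Implicit Types u v : R.

Let ge0_of_derive (f df : R -> R) (b : R) : (forall x : R, is_derive x 1 f (df x)) ->
  f 0 = 0 -> 0 <= b -> (forall x, 0 <= x <= b -> 0 <= df x) -> 0 <= f b.
Proof.
move=> fdf f0 b0 df0.
have cf : continuous f.
  move=> x; have := fdf x => ?.
  exact/differentiable_continuous/derivable1_diffP/ex_derive.
have [|c cb] := MVT_segment b0 (fun x _ => fdf x).
  exact: continuous_subspaceT.
by rewrite f0 !subr0 => ->; rewrite mulr_ge0// df0.
Qed.

Lemma sin_le u : 0 <= u -> sin u <= u.
Proof.
move=> u0; rewrite -subr_ge0.
apply: (@ge0_of_derive (fun x => x - sin x) (fun x => 1 - cos x)) => //.
by rewrite sin0 subrr.
Qed.

Lemma one_sub_cos_le u : 1 - cos u <= u ^+ 2 / 2.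
Proof.
rewrite -cos_norm -(@real_normK _ u) ?num_real//; move: `|u| (normr_ge0 u) => {}u u0.
rewrite -subr_ge0.
apply: (@ge0_of_derive (fun x => x ^+ 2 / 2 - (1 - cos x)) (fun x => x - sin x)) => //.
- by move=> x; apply: is_derive_eq; rewrite /GRing.scale/=; field.
- by rewrite cos0; ring.
- by move=> x /andP[x0 _]; rewrite subr_ge0 sin_le.
Qed.

Lemma one_sub_cos_ge u : `|u| <= 1 -> u ^+ 2 / 4 <= 1 - cos u.
Proof.
rewrite -cos_norm -(@real_normK _ u) ?num_real//; move: `|u| (normr_ge0 u) => {}u u0 u1.
have half v : 0 <= v <= 1 -> v / 2 <= sin v.
  move=> /andP[v0 v1]; rewrite -subr_ge0.
  apply: (@ge0_of_derive (fun x => sin x - x / 2) (fun x => cos x - 2^-1)) => //.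
  - by move=> x; apply: is_derive_eq; rewrite /GRing.scale/=; field.
  - by rewrite sin0; ring.
  - move=> x /andP[x0 xv]; have := one_sub_cos_le x.
    have : x ^+ 2 <= 1 by rewrite exprn_ile1// (le_trans xv).
    lra.
rewrite -subr_ge0.
apply: (@ge0_of_derive (fun x => 1 - cos x - x ^+ 2 / 4) (fun x => sin x - x / 2)) => //.
- by move=> x; apply: is_derive_eq; rewrite /GRing.scale/=; field.
- by rewrite cos0; ring.
- by move=> x /andP[x0 xu]; rewrite subr_ge0 half// x0 (le_trans xu).
Qed.

Let one_sub_cosE u : 1 - cos u = 2 * sin (u / 2) ^+ 2.
Proof.
have {1}-> : u = (u / 2) *+ 2 by rewrite -mulr_natr; field.
by rewrite cos_mulr2n sin2cos2; ring.
Qed.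

(** Through 1 - cos u = 2 sin^2 (u / 2) this follows from the addition formula for the sine and (p +
    q)^2 <= 2 p^2 + 2 q^2. *)
Lemma one_sub_cosD u v :
  1 - cos (u + v) <= 2 * (1 - cos u) + 2 * (1 - cos v).
Proof.
rewrite !one_sub_cosE (mulrDl u v) sinD.
set s := sin (u / 2); set t := sin (v / 2).
set c := cos (u / 2); set e := cos (v / 2).
have h1 : (s * e) ^+ 2 <= s ^+ 2.
  by rewrite exprMn ler_piMr ?sqr_ge0// /e cos2sin2 lerBlDr lerDl sqr_ge0.
have h2 : (c * t) ^+ 2 <= t ^+ 2.
  by rewrite exprMn ler_piMl ?sqr_ge0// /c cos2sin2 lerBlDr lerDl sqr_ge0.
have := sqr_ge0 (s * e - c * t).
rewrite (_ : (s * e - c * t) ^+ 2 =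
  2 * (s * e) ^+ 2 + 2 * (c * t) ^+ 2 - (s * e + c * t) ^+ 2); last by ring.
lra.
Qed.

(** Comes from |sin (k v)| <= k |sin v|. The factor has to be an integer: at u = 2 pi the right-hand
    side vanishes, whereas cos (s u) differs from 1 when s is not an integer. *)
Lemma one_sub_cosM (k : nat) u : 1 - cos (k%:R * u) <= k%:R ^+ 2 * (1 - cos u).
Proof.
rewrite !one_sub_cosE -(mulrA _ u) [leRHS]mulrCA ler_pM2l//.
have h : `|sin (k%:R * (u / 2))| <= k%:R * `|sin (u / 2)|.
  elim: k => [|k IH]; first by rewrite !mul0r sin0 normr0.
  rewrite -natr1 !mulrDl !mul1r sinD (le_trans (ler_normD _ _))//.
  rewrite !normrM lerD//.
    by rewrite (le_trans _ IH)// ler_piMr// cos_max.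
  by rewrite ler_piMl// cos_max.
rewrite -[leLHS]real_normK ?num_real// -[X in _ <= _ * X]real_normK ?num_real//.
by rewrite -exprMn lerXn2r ?nnegrE ?mulr_ge0.
Qed.

Lemma one_sub_cos_min u : 1 - cos u <= 2 * Num.min 1 (u ^+ 2).
Proof.
have := one_sub_cos_le u; have := cos_geN1 u; have := sqr_ge0 u.
by case: (leP 1 (u ^+ 2)) => *; lra.
Qed.

End trigonometric_inequalities.

(** * Euclidean geometry and the operator norm *)

Section euclidean_space.
Context {R : realType} {d : nat}.
Implicit Types (x y z : 'rV[R]_d) (A : 'M[R]_d).

Lemma discr_le0 (a b c : R) : 0 <= a ->
  (forall s, 0 <= c + 2 * s * b + s ^+ 2 * a) -> b ^+ 2 <= a * c.
Proof.
rewrite le_eqVlt => /predU1P[<-|a0] h.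
  have [->|b0] := eqVneq b 0; first by rewrite expr0n/= mul0r.
  (* With a = 0 the form is affine in s, and this s gives it the value -1. *)
  have := h (- (c + 1) / (2 * b)).
  rewrite (_ : _ + _ = - 1) ?oppr_ge0 ?ler10//.
  by field.
have := h (- b / a); rewrite (_ : _ + _ = (a * c - b ^+ 2) / a); last first.
  by field; rewrite gt_eqF.
by rewrite pmulr_lge0 ?invr_gt0// subr_ge0.
Qed.

Lemma dotvC x y : dotv x y = dotv y x.
Proof. by apply: eq_bigr => j _; rewrite mulrC. Qed.

Lemma dotvDl x y z : dotv (x + y) z = dotv x z + dotv y z.
Proof. by rewrite /dotv -big_split/=; apply: eq_bigr => j _; rewrite mxE mulrDl. Qed.

Lemma dotvZl (s : R) x z : dotv (s *: x) z = s * dotv x z.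
Proof. by rewrite /dotv mulr_sumr; apply: eq_bigr => j _; rewrite mxE mulrA. Qed.

Lemma dotv_ge0 x : 0 <= dotv x x.
Proof. by apply: sumr_ge0 => j _; rewrite -expr2 sqr_ge0. Qed.

Lemma enorm_ge0 x : 0 <= enorm x. Proof. exact: sqrtr_ge0. Qed.

Lemma sqr_enorm x : enorm x ^+ 2 = dotv x x.
Proof. by rewrite sqr_sqrtr ?dotv_ge0. Qed.

Lemma enormZ (s : R) x : enorm (s *: x) = `|s| * enorm x.
Proof.
by rewrite /enorm dotvZl dotvC dotvZl mulrA -expr2 sqrtrM ?sqr_ge0// sqrtr_sqr.
Qed.

Lemma dotv_mulmv A x y : dotv (mulmv A x) y = dotv x (mulmv A^T y).
Proof.
have E u v : dotv u v = (u *m v^T) ord0 ord0.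
  by rewrite mxE; apply: eq_bigr => j _; rewrite mxE.
by rewrite !E /mulmv trmx_mul !trmxK mulmxA.
Qed.

Lemma mulmvD A x y : mulmv A (x + y) = mulmv A x + mulmv A y.
Proof. by rewrite /mulmv mulmxDl. Qed.

Lemma mulmvZ A (s : R) x : mulmv A (s *: x) = s *: mulmv A x.
Proof. by rewrite /mulmv scalemxAl. Qed.

Lemma dotv_CS x y : dotv x y ^+ 2 <= dotv x x * dotv y y.
Proof.
apply: discr_le0; first exact: dotv_ge0.
move=> s; have := dotv_ge0 (y + s *: x).
rewrite !(dotvDl, dotvZl) ![dotv _ (_ + _)]dotvC !(dotvDl, dotvZl) (dotvC y x).
by congr (_ <= _); ring.
Qed.

Lemma normr_dotv_le x y : `|dotv x y| <= enorm x * enorm y.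
Proof.
rewrite -(@ler_pXn2r _ 2) ?nnegrE ?mulr_ge0 ?enorm_ge0//.
by rewrite real_normK ?num_real// exprMn !sqr_enorm dotv_CS.
Qed.

Lemma normr_coord_le x j : `|x ord0 j| <= enorm x.
Proof.
rewrite -(@ler_pXn2r _ 2) ?nnegrE ?enorm_ge0// real_normK ?num_real// sqr_enorm.
rewrite /dotv (bigD1 j)//= -expr2 lerDl.
by apply: sumr_ge0 => i _; rewrite -expr2 sqr_ge0.
Qed.

Lemma enorm_le_sum x : enorm x <= \sum_j `|x ord0 j|.
Proof.
rewrite -(@ler_pXn2r _ 2) ?nnegrE ?enorm_ge0 ?sumr_ge0// sqr_enorm /dotv expr2 mulr_suml.
apply: ler_sum => j _; rewrite -expr2 -real_normK ?num_real// expr2 ler_wpM2l//.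
by rewrite (bigD1 j)//= lerDl sumr_ge0.
Qed.

Lemma enorm_le_max x (M : R) : (forall j, `|x ord0 j| <= M) -> enorm x <= d%:R * M.
Proof.
move=> h; apply: le_trans (enorm_le_sum x) _.
apply: le_trans (ler_sum _ (fun j _ => h j)) _.
by rewrite sumr_const card_ord mulr_natl.
Qed.

Variable A : 'M[R]_d.
Hypothesis A_sym : A^T = A.
Hypothesis A_psd : forall x, 0 <= dotv x (mulmv A x).

Lemma quad_CS x y : dotv x (mulmv A y) ^+ 2 <=
  dotv x (mulmv A x) * dotv y (mulmv A y).
Proof.
apply: discr_le0 => // s; have := A_psd (y + s *: x).
rewrite mulmvD mulmvZ !(dotvDl, dotvZl) ![dotv _ (_ + _)]dotvC !(dotvDl, dotvZl).
rewrite (dotvC (mulmv A y) y) (dotvC (mulmv A x) x) (dotvC (mulmv A y) x).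
rewrite dotv_mulmv A_sym.
by congr (_ <= _); ring.
Qed.

Lemma quadD x y : dotv (x + y) (mulmv A (x + y)) <=
  2 * dotv x (mulmv A x) + 2 * dotv y (mulmv A y).
Proof.
have := A_psd (x - y); rewrite -scaleN1r.
rewrite mulmvD mulmvZ !(dotvDl, dotvZl) ![dotv _ (_ + _)]dotvC !(dotvDl, dotvZl).
rewrite mulmvD ![dotv _ (_ + _)]dotvC !(dotvDl, dotvZl).
rewrite (dotvC (mulmv A y) y) (dotvC (mulmv A x) x) (dotvC (mulmv A y) x).
rewrite !dotv_mulmv A_sym. lra.
Qed.

Lemma quadZ (s : R) x : dotv (s *: x) (mulmv A (s *: x)) = s ^+ 2 * dotv x (mulmv A x).
Proof. by rewrite mulmvZ dotvZl dotvC dotvZl dotvC mulrA expr2. Qed.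

Let opset := [set enorm (mulmv A x) | x in [set x | enorm x <= 1]].

Let has_sup_opset : has_sup opset.
Proof.
split.
  by exists (enorm (mulmv A 0)), 0 => //=; rewrite -(scale0r 0) enormZ normr0 mul0r.
exists (d%:R * (\sum_i enorm (row i A))) => _ [x /= x1 <-].
apply: enorm_le_max => j.
have -> : mulmv A x ord0 j = dotv x (row j A).
  by rewrite /mulmv mxE; apply: eq_bigr => i _; rewrite !mxE.
apply: le_trans (normr_dotv_le _ _) _.
apply: (@le_trans _ _ (enorm (row j A))).
  by rewrite ler_piMl// enorm_ge0.
by rewrite (bigD1 j)//= lerDl sumr_ge0// => i _; exact: enorm_ge0.
Qed.

Lemma opnorm_ge0 : 0 <= opnorm A.
Proof.
have [[y [x /= x1 xy]] ub] := has_sup_opset.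
apply: le_trans (ub_le_sup ub _); last by exists x; eauto.
by rewrite ?xy; rewrite -xy enorm_ge0.
Qed.

Lemma quad_le_opnorm x : dotv x (mulmv A x) <= opnorm A * enorm x ^+ 2.
Proof.
have [x0|x0] := eqVneq (enorm x) 0.
  have := normr_dotv_le x (mulmv A x); rewrite x0 mul0r normr_le0 => /eqP->.
  by rewrite expr0n/= mulr0.
have xp : 0 < enorm x by rewrite lt_neqAle eq_sym x0 enorm_ge0.
have [_ ub] := has_sup_opset.
have h : enorm (mulmv A ((enorm x)^-1 *: x)) <= opnorm A.
  apply: ub_le_sup => //; exists ((enorm x)^-1 *: x) => //=.
  by rewrite enormZ ger0_norm ?invr_ge0 ?enorm_ge0// mulVf.
apply: le_trans (ler_norm _) _; apply: le_trans (normr_dotv_le _ _) _.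
rewrite mulmvZ enormZ ger0_norm ?invr_ge0 ?enorm_ge0// ler_pdivrMl// in h.
by rewrite [leRHS]mulrC expr2 -mulrA ler_pM2l.
Qed.

(** Uses that A is symmetric and nonnegative: for y = A x, Cauchy-Schwarz in the form of A gives
    |y|^4 <= <y, A y> <x, A x> <= ||A|| |y|^2 M, hence ||A||^2 <= ||A|| M. *)
Lemma opnorm_le (M : R) :
  (forall x, enorm x <= 1 -> dotv x (mulmv A x) <= M) -> opnorm A <= M.
Proof.
move=> h; have [ne ub] := has_sup_opset.
have M0 : 0 <= M.
  have [_ [x /= x1 _]] := ne; exact: le_trans (A_psd x) (h x x1).
have key x : enorm x <= 1 -> enorm (mulmv A x) ^+ 2 <= opnorm A * M.
  move=> x1; have [y0|y0] := eqVneq (enorm (mulmv A x)) 0.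
    by rewrite y0 expr0n/= mulr_ge0// opnorm_ge0.
  have yp : 0 < enorm (mulmv A x) ^+ 2 by rewrite exprn_even_gt0.
  rewrite -(ler_pM2l yp) -expr2 {1}sqr_enorm.
  apply: le_trans (quad_CS _ _) _.
  rewrite mulrA; apply: ler_pM => //; last exact: h.
  by rewrite mulrC quad_le_opnorm.
have key2 : opnorm A ^+ 2 <= opnorm A * M.
  rewrite -[leRHS]sqr_sqrtr ?mulr_ge0 ?opnorm_ge0//.
  rewrite lerXn2r ?nnegrE ?sqrtr_ge0 ?opnorm_ge0//.
  apply: ge_sup => // _ [x /= x1 <-].
  by rewrite -[leLHS](ger0_norm (enorm_ge0 _)) -sqrtr_sqr ler_wsqrtr// key.
have := opnorm_ge0; rewrite le_eqVlt => /predU1P[<-//|p].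
by rewrite -(ler_pM2l p) -expr2.
Qed.

End euclidean_space.

(** * The characteristic exponent and the function h *)

Section sigma_finite_copy.
Context d (T : measurableType d) (R : realType) (mu : {measure set T -> \bar R}).

(* N is only a measure in the statement: a copy carrying the proof of
   sigma-finiteness is needed by Fubini-Tonelli. *)
Definition sigma_finite_copy of sigma_finite setT mu : set T -> \bar R := mu.

Variable sf : sigma_finite setT mu.

HB.instance Definition _ := Measure.copy (sigma_finite_copy sf) mu.

HB.instance Definition _ :=
  Measure_isSigmaFinite.Build _ _ _ (sigma_finite_copy sf) sf.

End sigma_finite_copy.

Lemma min1_sum_le (R : realType) (I : finType) (a : I -> R) :
  (forall i, 0 <= a i) -> Num.min 1 (\sum_i a i) <= \sum_i Num.min 1 (a i).
Proof.
(* Nonnegativity of the partial sums is carried along the induction, where the truncation needs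
   it. *)
move=> a0; suff : Num.min 1 (\sum_i a i) <= \sum_i Num.min 1 (a i) /\ 0 <= \sum_i a i by case.
elim/big_rec2 : _ => [|i x y _ [ih y0]]; first by rewrite ge_min lexx orbT.
split; last by rewrite addr_ge0.
have := a0 i; move: ih; rewrite !minEle; do ! case: ifPn; rewrite -?ltNge; lra.
Qed.

Section levy_exponent.
Local Open Scope complex_scope.
Context {R : realType} {d : nat}.
Variables (A : 'M[R]_d) (N : {measure set 'rV[R]_d -> \bar R}) (b : 'rV[R]_d).
Hypothesis triplet : generating_triplet A N.
Implicit Types (x y z : 'rV[R]_d) (r s u v w : R).

Let A_sym : A^T = A. Proof. by case: triplet. Qed.
Let A_psd x : 0 <= dotv x (mulmv A x). Proof. by case: triplet. Qed.
Let N0 : N [set 0] = 0%E. Proof. by case: triplet => _ _ []. Qed.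
Let Noo : (\int[N]_z (Num.min 1 (enorm z ^+ 2))%:E < +oo)%E.
Proof. by case: triplet => _ _ []. Qed.

Lemma re_psiE x :
  re_psi A N b x = dotv x (mulmv A x) - \int[N]_z (cos (dotv x z) - 1).
Proof.
rewrite /re_psi /psi /cintegral /= !(mul0r, mulr0, mul1r, subrr, subr0, add0r, oppr0, addr0).
congr (_ - _); apply: eq_Rintegral => z _.
by rewrite !(mul0r, mulr0, mul1r, subrr, subr0, add0r, oppr0, addr0, expR0).
Qed.

Let mdot x : measurable_fun setT (fun z => dotv x z).
Proof. by under eq_fun do rewrite dotvC; exact: measurable_dotv. Qed.

Let menorm2 : measurable_fun setT (fun z : 'rV[R]_d => enorm z ^+ 2).
Proof.
under eq_fun do rewrite sqr_enorm.
by apply: measurable_sum => j; apply: measurable_funM; exact: measurable_coord.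
Qed.

Let mmin u : measurable_fun setT (fun z : 'rV[R]_d => Num.min 1 (u * enorm z ^+ 2)).
Proof. by apply: measurable_minr => //; apply: measurable_funM. Qed.

Let min_ge0 u s : 0 <= u -> 0 <= s -> 0 <= Num.min 1 (u * s) :> R.
Proof. by move=> u0 s0; rewrite le_min ler01 mulr_ge0. Qed.

Let enorm2_ge0 z : 0 <= enorm z ^+ 2. Proof. exact: sqr_ge0. Qed.

Lemma integrable_min u : 0 <= u ->
  N.-integrable setT (fun z => (Num.min 1 (u * enorm z ^+ 2))%:E).
Proof.
move=> u0.
have i1 : N.-integrable setT (fun z => (Num.min 1 (enorm z ^+ 2))%:E).
  apply/integrableP; split.
    by apply/measurable_EFinP; apply: measurable_minr.
  under eq_integral do rewrite gee0_abs ?lee_fin ?le_min ?ler01 ?enorm2_ge0//.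
  exact: Noo.
have := integrableZl measurableT (1 + u) i1; apply: le_integrable => //.
  exact/measurable_EFinP.
move=> z _; rewrite lee_fin ger0_norm ?min_ge0//.
rewrite ger0_norm ?mulr_ge0 ?addr_ge0 ?le_min ?ler01 ?enorm2_ge0//.
have := enorm2_ge0 z; move: (enorm z ^+ 2) => s s0.
rewrite ge_min; case: (leP 1 s) => s1; first by rewrite mulr1 lerDl u0.
by apply/orP; right; rewrite mulrDl mul1r lerDr.
Qed.

Lemma integrable_one_sub_cos x :
  N.-integrable setT (fun z => (1 - cos (dotv x z))%:E).
Proof.
have := integrableZl measurableT 2 (integrable_min (enorm2_ge0 x)).
apply: le_integrable => //.
  by apply/measurable_EFinP; apply: measurable_funB => //; exact: measurable_cosf.
move=> z _; rewrite lee_fin ger0_norm ?subr_ge0 ?cos_le1//.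
rewrite ger0_norm ?mulr_ge0 ?min_ge0//.
apply: le_trans (one_sub_cos_min _) _; rewrite ler_pM2l//.
apply: le_min2 => //.
rewrite -real_normK ?num_real// -exprMn lerXn2r ?nnegrE ?mulr_ge0 ?enorm_ge0//.
exact: normr_dotv_le.
Qed.

Lemma re_psi_1Bcos x :
  re_psi A N b x = dotv x (mulmv A x) + \int[N]_z (1 - cos (dotv x z)).
Proof.
rewrite re_psiE; congr (_ + _); rewrite -[LHS]mulN1r -RintegralZl//.
  by apply: eq_Rintegral => z _; rewrite mulN1r opprB.
have := integrableZl measurableT (-1) (integrable_one_sub_cos x).
by apply: eq_integrable => // z _; rewrite -EFinM mulN1r opprB.
Qed.

Let int_cos_ge0 x : 0 <= \int[N]_z (1 - cos (dotv x z)).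
Proof. by apply: Rintegral_ge0 => z _; rewrite subr_ge0 cos_le1. Qed.

Lemma re_psi_ge0 x : 0 <= re_psi A N b x.
Proof. by rewrite re_psi_1Bcos addr_ge0. Qed.

Lemma quad_le_re_psi x : dotv x (mulmv A x) <= re_psi A N b x.
Proof. by rewrite re_psi_1Bcos lerDl. Qed.

Lemma re_psiD x y :
  re_psi A N b (x + y) <= 2 * re_psi A N b x + 2 * re_psi A N b y.
Proof.
have ix := integrable_one_sub_cos x; have iy := integrable_one_sub_cos y.
rewrite !re_psi_1Bcos !mulrDr addrACA lerD//; first exact: quadD.
rewrite -!RintegralZl// -RintegralD//; last 2 first.
- exact: (integrableZl measurableT 2 ix).
- exact: (integrableZl measurableT 2 iy).
apply: le_Rintegral => //; first exact: integrable_one_sub_cos.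
  exact: (integrableD measurableT (integrableZl measurableT 2 ix)
    (integrableZl measurableT 2 iy)).
by move=> z _; rewrite dotvDl one_sub_cosD.
Qed.

Lemma re_psiM (k : nat) x : re_psi A N b (k%:R *: x) <= k%:R ^+ 2 * re_psi A N b x.
Proof.
have ix := integrable_one_sub_cos x.
rewrite !re_psi_1Bcos !mulrDr lerD//; first by rewrite quadZ.
rewrite -!RintegralZl//; apply: le_Rintegral => //.
- exact: integrable_one_sub_cos.
- exact: (integrableZl measurableT (k%:R ^+ 2) ix).
- by move=> z _; rewrite dotvZl one_sub_cosM.
Qed.

(* h (r) as a function of u = r^-2, in which it is concave. *)
Definition conc u : R := u * opnorm A + \int[N]_z Num.min 1 (u * enorm z ^+ 2).

Lemma levy_h_conc r : levy_h A N r = conc (r ^- 2).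
Proof. by congr (_ + _); apply: eq_Rintegral => z _; rewrite mulrC. Qed.

Let opA0 : 0 <= opnorm A. Proof. exact: opnorm_ge0. Qed.

Lemma conc_ge0 u : 0 <= u -> 0 <= conc u.
Proof.
move=> u0; rewrite addr_ge0 ?mulr_ge0//.
by apply: Rintegral_ge0 => z _; exact: min_ge0.
Qed.

Lemma le_conc u v : 0 <= u -> u <= v -> conc u <= conc v.
Proof.
move=> u0 uv; have v0 := le_trans u0 uv; rewrite lerD ?ler_wpM2r//.
apply: le_Rintegral => //; [exact: integrable_min..|].
by move=> z _; apply: le_min2 => //; rewrite ler_wpM2r.
Qed.

Lemma concM s u : 1 <= s -> 0 <= u -> conc (s * u) <= s * conc u.
Proof.
move=> s1 u0; have s0 : 0 <= s by apply: le_trans s1.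
rewrite /conc mulrDr mulrA lerD2l -RintegralZl//; last exact: integrable_min.
apply: le_Rintegral => //; first by apply: integrable_min; exact: mulr_ge0.
  exact: (integrableZl measurableT s (integrable_min u0)).
move=> z _; rewrite -mulrA ge_min; have [h|h] := leP 1 (u * enorm z ^+ 2).
  by rewrite mulr1 s1.
by rewrite lexx orbT.
Qed.

(** Integrated concavity of u -> min (1, u s). Written without divisions, so that coinciding points
    need no separate case. *)
Lemma conc_concave u v w : 0 <= u -> u <= v -> v <= w ->
  (w - v) * conc u + (v - u) * conc w <= (w - u) * conc v.
Proof.
move=> u0 uv vw; have v0 := le_trans u0 uv; have w0 := le_trans v0 vw.
have iu := integrable_min u0; have iv := integrable_min v0.
have iw := integrable_min w0.
rewrite /conc !mulrDr addrACA lerD//.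
  by rewrite !mulrA -mulrDl ler_wpM2r//; lra.
rewrite -!RintegralZl// -RintegralD//; last 2 first.
- exact: (integrableZl measurableT (w - v) iu).
- exact: (integrableZl measurableT (v - u) iw).
apply: le_Rintegral => //.
- exact: (integrableD measurableT (integrableZl measurableT (w - v) iu)
    (integrableZl measurableT (v - u) iw)).
- exact: (integrableZl measurableT (w - u) iv).
move=> z _; move: (enorm z ^+ 2) (enorm2_ge0 z) => s s0.
have p1 : (w - v) * Num.min 1 (u * s) <= w - v.
  by rewrite ler_piMr ?subr_ge0// ge_min lexx.
have p2 : (v - u) * Num.min 1 (w * s) <= v - u.
  by rewrite ler_piMr ?subr_ge0// ge_min lexx.
have p3 : (w - v) * Num.min 1 (u * s) <= (w - v) * (u * s).
  by rewrite ler_wpM2l ?subr_ge0// ge_min lexx orbT.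
have p4 : (v - u) * Num.min 1 (w * s) <= (v - u) * (w * s).
  by rewrite ler_wpM2l ?subr_ge0// ge_min lexx orbT.
have [h|h] := leP 1 (v * s); first lra.
have -> : (w - u) * (v * s) = (w - v) * (u * s) + (v - u) * (w * s) by ring.
lra.
Qed.

Lemma re_psi_le_conc x s : enorm x <= s -> re_psi A N b x <= 2 * conc (s ^+ 2).
Proof.
move=> xs; have s0 := le_trans (enorm_ge0 x) xs.
have xs2 : enorm x ^+ 2 <= s ^+ 2 by rewrite lerXn2r ?nnegrE ?enorm_ge0.
rewrite re_psi_1Bcos /conc mulrDr lerD//.
  apply: le_trans (quad_le_opnorm A x) _; rewrite mulrC.
  by have := ler_wpM2r opA0 xs2; have := mulr_ge0 (sqr_ge0 s) opA0; lra.
rewrite -RintegralZl//; last exact: integrable_min (sqr_ge0 s).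
apply: le_Rintegral => //; first exact: integrable_one_sub_cos.
  exact: (integrableZl measurableT 2 (integrable_min (sqr_ge0 s))).
move=> z _; apply: le_trans (one_sub_cos_min _) _; rewrite ler_pM2l//.
apply: le_min2 => //; rewrite -real_normK ?num_real//.
apply: (@le_trans _ _ ((enorm x * enorm z) ^+ 2)).
  rewrite lerXn2r ?nnegrE ?mulr_ge0 ?enorm_ge0//; exact: normr_dotv_le.
by rewrite exprMn ler_wpM2r.
Qed.

Let star s := [set re_psi A N b z | z in [set z | enorm z <= s]].

Let has_sup_star s : 0 <= s -> has_sup (star s).
Proof.
move=> s0; split.
  exists (re_psi A N b 0), 0 => //=.
  by rewrite -(scale0r 0) enormZ normr0 mul0r.
by exists (2 * conc (s ^+ 2)) => _ [x /= xs <-]; exact: re_psi_le_conc.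
Qed.

Lemma re_psi_le_star x s : enorm x <= s -> re_psi A N b x <= psi_star A N b s.
Proof.
move=> xs; have s0 := le_trans (enorm_ge0 x) xs.
by have [_ ub] := has_sup_star s0; apply: ub_le_sup => //; exists x.
Qed.

Lemma psi_star_le s (M : R) : 0 <= s ->
  (forall x, enorm x <= s -> re_psi A N b x <= M) -> psi_star A N b s <= M.
Proof.
move=> s0 h; have [ne _] := has_sup_star s0.
by apply: ge_sup => // _ [x /= xs <-]; exact: h.
Qed.

Lemma psi_star_le_conc s : 0 <= s -> psi_star A N b s <= 2 * conc (s ^+ 2).
Proof. by move=> s0; apply: psi_star_le => // x; exact: re_psi_le_conc. Qed.

Lemma psi_star_ge0 s : 0 <= s -> 0 <= psi_star A N b s.
Proof.
move=> s0; apply: le_trans (re_psi_ge0 0) _; apply: re_psi_le_star.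
by rewrite -(scale0r 0) enormZ normr0 mul0r.
Qed.

(** [re_psiM] handles integer factors only. A real s is written as k (s / k) with an integer k
    between |s| and 1 + |s|; the contraction s / k stays in the ball of radius |x|, at the price of
    psi^* on the right. *)
Lemma re_psiZ_le s x :
  re_psi A N b (s *: x) <= (1 + `|s|) ^+ 2 * psi_star A N b (enorm x).
Proof.
pose k := (Num.truncn `|s|).+1.
have k0 : (0 : R) < k%:R by rewrite ltr0n.
have sk : `|s| <= k%:R by rewrite ltW// truncnS_gt.
have ks : k%:R <= 1 + `|s| by rewrite /k -natr1 addrC lerD2l truncn_le.
have -> : s *: x = k%:R *: ((s / k%:R) *: x).
  by rewrite scalerA; congr (_ *: _); field; rewrite gt_eqF.
apply: le_trans (re_psiM _ _) _; apply: ler_pM.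
- exact: sqr_ge0.
- exact: re_psi_ge0.
- by rewrite lerXn2r ?nnegrE ?addr_ge0// ltW.
apply: re_psi_le_star; rewrite enormZ ler_piMl ?enorm_ge0//.
by rewrite normrM normfV (gtr0_norm k0) ler_pdivrMr// mul1r.
Qed.

(** By Markov's inequality the sets where min (1, |z|^2) >= 1 / n have finite mass; they miss only
    the origin, which is a null set. *)
Let sigma_finiteN : sigma_finite setT N.
Proof.
pose F n := [set z : 'rV[R]_d | z = 0 \/ 1 <= n%:R * Num.min 1 (enorm z ^+ 2)].
have mmin1 : measurable_fun setT (fun z : 'rV[R]_d => Num.min 1 (enorm z ^+ 2)).
  exact: measurable_minr.
have z0P z : enorm z = 0 -> z = 0.
  move=> h; apply/rowP => j; rewrite mxE; apply/eqP; rewrite -normr_le0 -h.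
  exact: normr_coord_le.
have m00 : Num.min 1 (enorm (0 : 'rV[R]_d) ^+ 2) = 0.
  by rewrite -(scale0r 0) enormZ normr0 mul0r expr0n/= min_r ?ler01.
have m0 z : 0 <= Num.min 1 (enorm z ^+ 2) by rewrite le_min ler01 enorm2_ge0.
have m1 : measurable [set 0 : 'rV[R]_d].
  rewrite (_ : [set 0] = (fun z : 'rV[R]_d => Num.min 1 (enorm z ^+ 2)) @^-1` [set 0]).
    by rewrite -[X in measurable X]setTI; exact: mmin1.
  rewrite eqEsubset; split => z /= => [->//|h]; apply: z0P.
  apply/eqP; rewrite -sqrf_eq0 -h; case: (leP 1 (enorm z ^+ 2)) => // h1.
  by move: h; rewrite min_l// => /eqP; rewrite oner_eq0.
have m2 n : measurable [set z : 'rV[R]_d | 1 <= n%:R * Num.min 1 (enorm z ^+ 2)].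
  rewrite -[X in measurable X]setTI.
  rewrite (_ : [set z | _] = (fun z : 'rV[R]_d => n%:R * Num.min 1 (enorm z ^+ 2)) @^-1` `[1, +oo[).
    by apply: measurable_funM => //.
  by rewrite eqEsubset; split => z /=; rewrite in_itv/= andbT.
exists F.
  apply/esym; rewrite -subTset => z _; have [->|z0] := eqVneq z 0; first by exists 0%N => //; left.
  have p : 0 < Num.min 1 (enorm z ^+ 2).
    rewrite lt_min ltr01 exprn_even_gt0//=; apply/eqP => /z0P h.
    by rewrite h eqxx in z0.
  exists (Num.truncn (Num.min 1 (enorm z ^+ 2))^-1).+1 => //; right.
  by rewrite -ler_pdivrMr// mul1r ltW// truncnS_gt.
move=> n; have mF : measurable (F n) by exact: (measurableU _ _ m1 (m2 n)).
split => //.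
have h : (N (F n) <= N [set 0%R] + N [set z | 1 <= n%:R * Num.min 1 (enorm z ^+ 2)]%R)%E.
  exact: (measureU2 N m1 (m2 n)).
apply: le_lt_trans h _; rewrite N0 add0e -[X in N X]setIT -integral_indic//.
apply: (@le_lt_trans _ _ (\int[N]_z (n%:R%:E * (Num.min 1 (enorm z ^+ 2))%:E)))%E.
  apply: ge0_le_integral => //.
  - by apply/measurable_EFinP; exact: measurable_indic.
  - by apply/measurable_EFinP; apply: measurable_funM.
  - move=> z _; rewrite lee_fin indicE; case: (boolP (z \in _)) => [/set_mem//|_].
    by rewrite mulr_ge0.
rewrite ge0_integralZl//; last 2 first.
- exact/measurable_EFinP.
- by move=> z _; rewrite lee_fin.
by rewrite lte_mul_pinfty// lee_fin.
Qed.

Let N' := sigma_finite_copy sigma_finiteN.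

Let tonelli_cos x :
  (\int[N]_z \int[@lebesgue_measure R]_s
     (expR (- (1 * `|s|)) * (1 - cos (dotv x z * s)))%:E =
   \int[@lebesgue_measure R]_s
     (expR (- (1 * `|s|)) * \int[N]_z (1 - cos (dotv (s *: x) z)))%:E)%E.
Proof.
pose f (p : 'rV[R]_d * measurableTypeR R) : R :=
  expR (- (1 * `|p.2|)) * (1 - cos (dotv x p.1 * p.2)).
have mf : measurable_fun setT f.
  apply: measurable_funM.
    exact: (measurableT_comp (measurable_laplace 1) measurable_snd).
  apply: measurable_funB => //; apply: measurable_cosf; apply: measurable_funM => //.
  exact: (measurableT_comp (mdot x) measurable_fst).
have f0 p : 0 <= f p by rewrite mulr_ge0 ?expR_ge0// subr_ge0 cos_le1.
have := @fubini_tonelli _ _ _ _ _ N' (@lebesgue_measure R) (EFin \o f).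
move=> ->//; last exact/measurable_EFinP.
apply: eq_integral => s _ /=; rewrite /f/=.
under eq_integral do rewrite EFinM.
rewrite ge0_integralZl//; last first.
  apply/measurable_EFinP; apply: measurable_funB => //; apply: measurable_cosf.
  exact: measurable_funM.
rewrite EFinM; congr (_ * _)%E; rewrite /Rintegral fineK.
  by apply: eq_integral => z _; rewrite dotvZl mulrC.
exact: (integrable_fin_num measurableT (integrable_one_sub_cos (s *: x))).
Qed.

Lemma measurable_re_psi : measurable_fun setT (re_psi A N b).
Proof.
have -> : re_psi A N b = fun x => dotv x (mulmv A x) +
    fine (\int[N']_z (1 - cos (dotv x z))%:E)%E.
  by apply/funext => x; rewrite re_psi_1Bcos.
have mdot2 : measurable_fun setT (fun p : 'rV[R]_d * 'rV[R]_d => dotv p.1 p.2).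
  apply: measurable_sum => j; apply: measurable_funM.
    exact: (measurableT_comp (measurable_coord j) measurable_fst).
  exact: (measurableT_comp (measurable_coord j) measurable_snd).
apply: measurable_funD.
  apply: measurable_sum => j; apply: measurable_funM; first exact: measurable_coord.
  under eq_fun do rewrite mxE.
  apply: measurable_sum => i; apply: measurable_funM => //; exact: measurable_coord.
apply: measurableT_comp => //.
apply: (@measurable_fun_fubini_tonelli_F _ _ _ _ _ N'
  (fun p : 'rV[R]_d * 'rV[R]_d => (1 - cos (dotv p.1 p.2))%:E)).
  apply/measurable_EFinP; apply: measurable_funB => //; exact: measurable_cosf.
by move=> p; rewrite lee_fin subr_ge0 cos_le1.
Qed.

(* min (1, u^2) <= 2 u^2 / (1 + u^2), the integral over s of
   exp (- |s|) (1 - cos (s u)), and Re psi (s x) <= (1 + |s|)^2 psi^*(|x|). *)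
Let integral_min_dotv_le x : (\int[N]_z (Num.min 1 (dotv x z ^+ 2))%:E <=
  (64 * psi_star A N b (enorm x))%:E)%E.
Proof.
have star0 := psi_star_ge0 (enorm_ge0 x).
apply: (@le_trans _ _ (\int[N]_z \int[@lebesgue_measure R]_s
     (expR (- (1 * `|s|)) * (1 - cos (dotv x z * s)))%:E)%E).
  apply: ge0_le_integral => //.
  - by move=> z _; rewrite lee_fin le_min ler01 sqr_ge0.
  - by apply/measurable_EFinP; apply: measurable_minr => //; exact: measurable_funX.
  - under eq_fun do rewrite integral_laplace_1Bcos//.
    apply/measurable_EFinP; apply: measurable_funB => //.
    apply: (@measurableT_comp _ _ _ _ _ _ (cauchy_kernel 1) _ (dotv x)) => //.
    apply: continuous_measurable_fun; exact: (continuous_cauchy_kernel ltr01).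
  - move=> z _; rewrite integral_laplace_1Bcos// lee_fin.
    have := sqr_ge0 (dotv x z); move: (_ ^+ 2) => v v0.
    rewrite (_ : 2 / 1 - _ = 2 * v / (1 + v)); last by field; lra.
    rewrite ler_pdivlMr; last lra.
    by have [v1|v1] := leP 1 v; [lra|have := mulr_ge0 v0 (ltW (ltr01 : 0 < 1 :> R)); nra].
rewrite tonelli_cos.
apply: (@le_trans _ _ (\int[@lebesgue_measure R]_s
   ((16 * psi_star A N b (enorm x))%:E * (expR (- (2^-1 * `|s|)))%:E))%E).
  apply: ge0_le_integral => //.
  - by move=> s _; rewrite lee_fin mulr_ge0 ?expR_ge0.
  - apply/measurable_EFinP; apply: measurable_funM; first exact: measurable_laplace.
    have -> : (fun s => \int[N]_z (1 - cos (dotv (s *: x) z))) =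
        (fun s => re_psi A N b (s *: x) - s ^+ 2 * dotv x (mulmv A x)).
      by apply/funext => s; rewrite re_psi_1Bcos quadZ addrC addKr.
    apply: measurable_funB; last by apply: measurable_funM => //; exact: measurable_funX.
    apply: (measurableT_comp measurable_re_psi).
    apply/measurable_fun_mxP => i j; under eq_fun do rewrite mxE.
    exact: measurable_funM.
  - apply/measurable_EFinP; apply: measurable_funM => //; exact: measurable_laplace.
  - move=> s _; rewrite -EFinM lee_fin.
    have h1 : \int[N]_z (1 - cos (dotv (s *: x) z)) <= (1 + `|s|) ^+ 2 * psi_star A N b (enorm x).
      apply: le_trans (re_psiZ_le s x); rewrite re_psi_1Bcos lerDr//.
    (* Square 1 + |s| <= 4 exp (|s| / 4). Half of the exponential decay remains and integrates to 4,
       whence the constant 64 = 16 times 4. *)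
    have h2 : (1 + `|s|) ^+ 2 <= 16 * expR (2^-1 * `|s|).
      have e4 := expR_ge1Dx (`|s| / 4).
      rewrite (_ : 2^-1 * `|s| = `|s| / 4 + `|s| / 4); last by field.
      rewrite expRD; have := normr_ge0 s; nra.
    apply: (@le_trans _ _ (expR (- (1 * `|s|)) * ((1 + `|s|) ^+ 2 * psi_star A N b (enorm x)))).
      by rewrite ler_wpM2l ?expR_ge0.
    rewrite mulrCA mulrA [leLHS]mulrC -[leRHS]mulrA [leRHS]mulrCA ler_wpM2l//.
    apply: (@le_trans _ _ ((16 * expR (2^-1 * `|s|)) * expR (- (1 * `|s|)))).
      by rewrite ler_wpM2r ?expR_ge0.
    by rewrite -mulrA -expRD ler_wpM2l// ler_expR; lra.
rewrite ge0_integralZl//; last 2 first.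
- by apply/measurable_EFinP; exact: measurable_laplace.
- by rewrite lee_fin mulr_ge0.
by rewrite integral_laplace// -EFinM lee_fin; lra.
Qed.

(** The 1 pays for the Gaussian part, through [opnorm_le]. The jump part is split over the d axes,
    min (1, s^2 |z|^2) <= sum_j min (1, s^2 z_j^2), each axis costing 64. *)
Lemma conc_le_psi_star s : 0 <= s ->
  conc (s ^+ 2) <= (1 + 64 * d%:R) * psi_star A N b s.
Proof.
move=> s0; rewrite mulrDl mul1r; apply: lerD.
  have [->|sN0] := eqVneq s 0; first by rewrite expr0n/= mul0r psi_star_ge0.
  have s20 : 0 < s ^+ 2 by rewrite exprn_even_gt0.
  rewrite mulrC -ler_pdivlMr//; apply: opnorm_le => // x x1.
  rewrite ler_pdivlMr// mulrC -quadZ; apply: le_trans (quad_le_re_psi _) _.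
  by apply: re_psi_le_star; rewrite enormZ ger0_norm// ler_piMr.
pose e (j : 'I_d) : 'rV[R]_d := s *: delta_mx ord0 j.
have dote j z : dotv (e j) z = s * z ord0 j.
  rewrite dotvZl /dotv (bigD1 j)//= big1 => [|i ij]; last first.
    by rewrite mxE eqxx/= (negbTE ij) mul0r.
  by rewrite mxE !eqxx/= mul1r addr0.
have enorme j : enorm (e j) = s.
  rewrite enormZ ger0_norm// /enorm /dotv (bigD1 j)//= big1 => [|i ij]; last first.
    by rewrite mxE eqxx/= (negbTE ij) mul0r.
  by rewrite mxE !eqxx/= mul1r addr0 sqrtr1 mulr1.
rewrite -lee_fin /Rintegral fineK; last first.
  exact: (integrable_fin_num measurableT (integrable_min (sqr_ge0 s))).
apply: (@le_trans _ _ (\int[N]_z (\sum_(j < d) (Num.min 1 (dotv (e j) z ^+ 2))%:E))%E).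
  apply: ge0_le_integral => //.
  - by move=> z _; rewrite lee_fin min_ge0// sqr_ge0.
  - exact/measurable_EFinP.
  - apply: emeasurable_sum => j; apply/measurable_EFinP; apply: measurable_minr => //.
    exact: measurable_funX.
  - move=> z _; rewrite sumEFin lee_fin sqr_enorm /dotv mulr_sumr.
    rewrite (eq_bigr (fun j => dotv (e j) z ^+ 2)); last first.
      by move=> j _; rewrite dote exprMn -expr2.
    by apply: min1_sum_le => j; exact: sqr_ge0.
rewrite ge0_integral_sum//; last 2 first.
- move=> j; apply/measurable_EFinP; apply: measurable_minr => //; exact: measurable_funX.
- by move=> j z _; rewrite lee_fin le_min ler01 sqr_ge0.
apply: (@le_trans _ _ (\sum_(j < d) (64 * psi_star A N b s)%:E)%E).
  apply: lee_sum => j _; rewrite -[in leRHS](enorme j); exact: integral_min_dotv_le.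
by rewrite sumEFin lee_fin sumr_const card_ord -[leLHS]mulr_natr [leLHS]mulrAC lexx.
Qed.

End levy_exponent.

(** * The function h as a bijection, and its inverse *)

Section levy_h_inverse.
Context {R : realType} {d : nat}.
Variables (A : 'M[R]_d) (N : {measure set 'rV[R]_d -> \bar R}) (b : 'rV[R]_d).
Hypothesis triplet : generating_triplet A N.
Hypothesis levy_h0 : levy_h A N r @[r --> 0^'+] --> +oo.
Implicit Types (x z : 'rV[R]_d) (r s u v w y : R).

Lemma conc_unbounded u (M : R) : 0 < u -> exists w, u <= w /\ M < conc A N w.
Proof.
move=> u0; have su0 : 0 < Num.sqrt u^-1 by rewrite sqrtr_gt0 invr_gt0.
have : \forall r \near 0^'+, [/\ 0 < r, r < Num.sqrt u^-1 & M < levy_h A N r].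
  near=> r; split; near: r; [exact: nbhs_right_gt|exact: nbhs_right_lt|].
  by move/cvgryPgt: levy_h0; exact.
move=> /filter_ex[r [r0 ru hr]]; exists (r ^- 2); rewrite -levy_h_conc; split => //.
rewrite -[leLHS]invrK lef_pV2 ?posrE ?invr_gt0 ?exprn_gt0//.
rewrite -[leRHS]sqr_sqrtr ?invr_ge0 ?(ltW u0)//.
by rewrite lerXn2r ?nnegrE ?ltW.
Unshelve. all: by end_near. Qed.

(** A concave function that fails to increase between u and v stays below its value at u from then
    on, against unboundedness. *)
Lemma lt_conc u v : 0 < u -> u < v -> conc A N u < conc A N v.
Proof.
move=> u0 uv; have v0 := lt_trans u0 uv; rewrite ltNge; apply/negP => vu.
have [w [vw cw]] := conc_unbounded (conc A N u) v0.
have := conc_concave triplet (ltW u0) (ltW uv) vw.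
have vu0 : 0 < v - u by rewrite subr_gt0.
have := ltr_pM2l vu0 (conc A N u) (conc A N w); rewrite cw => h.
have wv0 : 0 <= w - v by rewrite subr_ge0.
have h2 : (w - u) * conc A N v <= (w - u) * conc A N u by rewrite ler_wpM2l//; lra.
by move: h h2 => /idP; nra.
Qed.

(** By [concM] the ratio conc v / v is nonincreasing, so every chord from u has slope at most conc u
    / u. *)
Lemma conc_lipschitz u v : 0 < u -> 0 < v ->
  `|conc A N u - conc A N v| <= conc A N u / u * `|u - v|.
Proof.
move=> u0 v0; have c0 := conc_ge0 A N (ltW u0).
have [vu|uv] := leP v u.
  have h : u * conc A N v >= v * conc A N u.
    have uv1 : 1 <= u / v by rewrite ler_pdivlMr// mul1r.
    have := concM triplet uv1 (ltW v0); rewrite divfK ?gt_eqF// mulrAC ler_pdivlMr//.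
    by rewrite [leLHS]mulrC.
  rewrite ger0_norm ?subr_ge0 ?le_conc ?(ltW v0)// (ger0_norm (_ : 0 <= u - v)) ?subr_ge0//.
  rewrite mulrAC ler_pdivlMr//; lra.
have h : u * conc A N v <= v * conc A N u.
  have uv1 : 1 <= v / u by rewrite ler_pdivlMr// mul1r ltW.
  have := concM triplet uv1 (ltW u0); rewrite divfK ?gt_eqF// mulrAC ler_pdivlMr//.
  by rewrite [leLHS]mulrC.
rewrite distrC ger0_norm ?subr_ge0 ?le_conc ?(ltW u0) ?(ltW uv)//.
rewrite distrC ger0_norm ?subr_ge0 ?(ltW uv)// mulrAC ler_pdivlMr//; lra.
Qed.

Lemma continuous_conc u : 0 < u -> {for u, continuous (conc A N)}.
Proof.
move=> u0; have c0 := conc_ge0 A N (ltW u0).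
have p : 0 < conc A N u + 1 by rewrite ltr_wpDl.
apply/cvgrPdist_le => e e0.
have q : 0 < e * u / (conc A N u + 1) by rewrite divr_gt0 ?mulr_gt0.
near=> v.
have v0 : 0 < v by near: v; exact: lt_nbhsr.
apply: le_trans (conc_lipschitz u0 v0) _.
rewrite mulrAC ler_pdivrMr//.
apply: (@le_trans _ _ ((conc A N u + 1) * `|u - v|)).
  by rewrite ler_wpM2r ?lerDl.
rewrite mulrC -ler_pdivlMr//; by near: v.
Unshelve. all: by end_near. Qed.

Lemma cvg_conc0 : conc A N (harmonic k) @[k --> \oo] --> 0.
Proof.
rewrite -[X in _ --> X]addr0 /conc; apply: cvgD.
  rewrite -[X in _ --> X](mul0r (opnorm A)); apply: cvgMr_tmp; exact: cvg_harmonic.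
rewrite (_ : 0 = \int[N]_(z in setT) (fun=> 0) z); last first.
  by rewrite /Rintegral integral0.
have menorm2 : measurable_fun setT (fun z : 'rV[R]_d => enorm z ^+ 2).
  under eq_fun do rewrite sqr_enorm.
  by apply: measurable_sum => j; apply: measurable_funM; exact: measurable_coord.
have h0 k : 0 <= @harmonic R k by rewrite /harmonic /= invr_ge0.
have h1 k : @harmonic R k <= 1 by rewrite /harmonic /= invf_le1// ler1n.
apply: (@dominated_cvg_Rintegral _ _ _ N setT _ _ (fun z => Num.min 1 (1 * enorm z ^+ 2))) => //.
- by move=> k; apply: measurable_minr => //; apply: measurable_funM.
- move=> z _; apply: (@squeeze_cvgr _ _ _ _ (cst 0) (fun k => harmonic k * enorm z ^+ 2)).
  + by near=> k; rewrite le_min ler01 mulr_ge0 ?exprn_ge0 ?enorm_ge0//= ge_min lexx orbT.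
  + exact: cvg_cst.
  + rewrite -[X in _ --> X](mul0r (enorm z ^+ 2)); apply: cvgMr_tmp; exact: cvg_harmonic.
- exact: (integrable_min triplet ler01).
- move=> k z _; rewrite ger0_norm ?le_min ?ler01 ?mulr_ge0 ?sqr_ge0 ?exprn_ge0 ?enorm_ge0//.
  apply/andP; split; rewrite ge_min ?lexx//; apply/orP; right.
  by rewrite ler_wpM2r ?exprn_ge0 ?enorm_ge0.
Unshelve. all: by end_near. Qed.

Lemma levy_h_gt0 r : 0 < r -> 0 < levy_h A N r.
Proof.
move=> r0; rewrite levy_h_conc; have p : 0 < r ^- 2 by rewrite invr_gt0 exprn_gt0.
have p2 : 0 < r ^- 2 / 2 by rewrite divr_gt0.
apply: le_lt_trans (conc_ge0 A N (ltW p2)) (lt_conc p2 _).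
by rewrite gtr_pMr// invf_lt1// ltr1n.
Qed.

Lemma levy_h_lt r s : 0 < r -> r < s -> levy_h A N s < levy_h A N r.
Proof.
move=> r0 rs; have s0 := lt_trans r0 rs; rewrite !levy_h_conc; apply: lt_conc.
  by rewrite invr_gt0 exprn_gt0.
by rewrite ltf_pV2 ?posrE ?exprn_gt0// ltrXn2r ?nnegrE ?ltW.
Qed.

Lemma levy_h_surj : set_surj [set r : R | 0 < r] [set y : R | 0 < y] (levy_h A N).
Proof.
move=> y /= y0.
have [u [u0 uy]] : exists u, 0 < u /\ conc A N u < y.
  have /filter_ex[k hk] : \forall k \near \oo, conc A N (harmonic k) < y.
    by move/cvgr_lt: cvg_conc0; exact.
  by exists (harmonic k); split => //; rewrite /harmonic /= invr_gt0.
have [w [uw wy]] := conc_unbounded y u0.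
have w0 := lt_le_trans u0 uw.
have [| |c] := @IVT _ (conc A N) u w y uw.
- apply: continuous_in_subspaceT => v; rewrite inE/= in_itv/= => /andP[uv _].
  exact: continuous_conc (lt_le_trans u0 uv).
- by rewrite ge_min le_max (ltW uy) (ltW wy) orbT.
rewrite in_itv/= => /andP[uc _] cy; have c0 := lt_le_trans u0 uc.
exists (Num.sqrt c^-1); first by rewrite /= sqrtr_gt0 invr_gt0.
by rewrite levy_h_conc sqr_sqrtr ?invrK// invr_ge0 ltW.
Qed.

Lemma levy_hinv_gt0 y : 0 < y -> 0 < levy_hinv A N y.
Proof. by move=> y0; apply: (surjpinv_image_sub levy_h_surj); exists y. Qed.

Lemma levy_hinvK y : 0 < y -> levy_h A N (levy_hinv A N y) = y.
Proof. by move=> y0; apply: (surjpK _ levy_h_surj); rewrite inE. Qed.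

Lemma levy_hinv_le r y : 0 < r -> 0 < y -> levy_h A N r <= y -> levy_hinv A N y <= r.
Proof.
move=> r0 y0; rewrite -{1}(levy_hinvK y0) !leNgt; apply: contra.
exact: levy_h_lt.
Qed.

Lemma levy_hinv_ge r y : 0 < r -> 0 < y -> y <= levy_h A N r -> r <= levy_hinv A N y.
Proof.
move=> r0 y0; rewrite -{1}(levy_hinvK y0) !leNgt; apply: contra.
by apply: levy_h_lt; exact: levy_hinv_gt0.
Qed.

Lemma levy_hK r : 0 < r -> levy_hinv A N (levy_h A N r) = r.
Proof.
move=> r0; have h0 := levy_h_gt0 r0.
by apply/eqP; rewrite eq_le levy_hinv_le ?levy_hinv_ge.
Qed.

Lemma levy_h_le r s : 0 < r -> r <= s -> levy_h A N s <= levy_h A N r.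
Proof. by move=> r0; rewrite le_eqVlt => /predU1P[->//|rs]; exact/ltW/levy_h_lt. Qed.

Lemma psi_star_le_levy_h r : 0 < r -> psi_star A N b r^-1 <= 2 * levy_h A N r.
Proof.
move=> r0; rewrite levy_h_conc -exprVn; apply: psi_star_le_conc => //.
by rewrite invr_ge0 ltW.
Qed.

Lemma levy_h_le_psi_star r : 0 < r ->
  levy_h A N r <= (1 + 64 * d%:R) * psi_star A N b r^-1.
Proof.
move=> r0; rewrite levy_h_conc -exprVn; apply: conc_le_psi_star => //.
by rewrite invr_ge0 ltW.
Qed.

End levy_h_inverse.

(** * The integral of exp (- t Re psi) *)

Section cube.
Context {R : realType} {d : nat}.
Implicit Types (x z : 'rV[R]_d) (a : R).

Definition cube x a : set 'rV[R]_d := cbox (x - const_mx a) (x + const_mx a).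

Lemma measurable_cube x a : measurable (cube x a).
Proof. exact: measurable_cbox. Qed.

Lemma lebesgue_cube x a : 0 <= a ->
  lebesgue_rV d (cube x a) = ((2 * a) ^+ d)%:E.
Proof.
move=> a0; rewrite [LHS]lebesgue_rV_box => [|j]; last by rewrite !mxE; lra.
congr EFin; rewrite -[RHS](_ : \prod_(j < d) (2 * a) = _); last first.
  by rewrite prodr_const card_ord.
by apply: eq_bigr => j _; rewrite !mxE; lra.
Qed.

Lemma cubeP x a z : cube x a z -> forall j, `|(z - x) ord0 j| <= a.
Proof.
move=> h j; have := h j; rewrite !mxE ler_norml.
by move: (z ord0 j) (x ord0 j) => u v /andP[? ?]; apply/andP; split; lra.
Qed.

Lemma enorm_cube x a z : cube x a z -> enorm (z - x) <= d%:R * a.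
Proof. by move=> /cubeP h; exact: enorm_le_max. Qed.

End cube.

Section geometric_growth.
Context {R : realType}.
Implicit Types (f : R -> R) (r q k c : R).

(** Growth along the powers of k becomes power growth with exponent ln q / ln k; rounding l down to
    a power of k costs the factor q. *)
Lemma powR_growth f k q c r : 1 < k -> 1 < q -> 0 < c -> 0 < r -> 0 <= f r ->
  (forall s u, 0 <= s -> s <= u -> f s <= f u) ->
  (forall n, c * q ^+ n * f r <= f (k ^+ n * r)) ->
  forall l, 1 <= l -> c / q * l `^ (ln q / ln k) * f r <= f (l * r).
Proof.
move=> k1 q1 c0 r0 f0 fm fk l l1.
have lk0 : 0 < ln k by rewrite ln_gt0.
have lq0 : 0 < ln q by rewrite ln_gt0.
have l0 : 0 < l by apply: lt_le_trans l1.
have [k0 q0] : 0 < k /\ 0 < q by split; [apply: lt_trans k1|apply: lt_trans q1].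
pose n := Num.truncn (ln l / ln k).
have n1 : n%:R <= ln l / ln k.
  by rewrite truncn_le; apply: divr_ge0; [exact: ln_ge0|exact: ltW].
have n2 : ln l / ln k <= n.+1%:R by rewrite ltW// truncnS_gt.
apply: (@le_trans _ _ (f (k ^+ n * r))); last first.
  apply: fm; first by rewrite mulr_ge0 ?exprn_ge0 ?ltW.
  rewrite ler_pM2r// -ler_ln ?posrE ?exprn_gt0// lnXn// -mulr_natl.
  by rewrite -ler_pdivlMr.
apply: le_trans (fk n); rewrite ler_wpM2r// -mulrA ler_pM2l//.
rewrite ler_pdivrMl// -exprS /powR gt_eqF//.
rewrite -[leRHS]lnK ?posrE ?exprn_gt0// ler_expR lnXn// -mulr_natl.
by rewrite mulrAC [ln q * _]mulrC mulrAC ler_pM2r.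
Qed.

End geometric_growth.

Definition psi_integral (R : realType) d (A : 'M[R]_d)
    (N : {measure set 'rV[R]_d -> \bar R}) (b : 'rV[R]_d) (t : R) : \bar R :=
  (\int[lebesgue_rV d]_z (expR (- t * re_psi A N b z))%:E)%E.

Section psi_integral.
Context {R : realType} {d : nat}.
Variables (A : 'M[R]_d) (N : {measure set 'rV[R]_d -> \bar R}) (b : 'rV[R]_d).
Hypothesis d_gt0 : (0 < d)%N.
Hypothesis triplet : generating_triplet A N.
Hypothesis levy_h0 : levy_h A N r @[r --> 0^'+] --> +oo.
Implicit Types (x z : 'rV[R]_d) (r s t u v w y c a : R).

Notation rpsi := (re_psi A N b).
Notation star := (psi_star A N b).
Notation h := (levy_h A N).
Notation hinv := (levy_hinv A N).
Notation lam := (lebesgue_rV d).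
Notation psi_integral := (psi_integral A N b).

Let dR0 : 0 < d%:R :> R. Proof. by rewrite ltr0n. Qed.

Let mrpsi := measurable_re_psi b triplet.

Let mexp t : measurable_fun setT (fun z => (expR (- t * rpsi z))%:E).
Proof.
apply/measurable_EFinP; apply: measurableT_comp => //.
exact: measurable_funM.
Qed.

Lemma le_psi_integral s t : s <= t -> (psi_integral t <= psi_integral s)%E.
Proof.
move=> st; apply: ge0_le_integral => //.
by move=> z _; rewrite lee_fin ler_expR ler_wpM2r ?re_psi_ge0// lerN2.
Qed.

Lemma psi_integral_ge B t (M : R) : measurable B ->
  (forall z, B z -> t * rpsi z <= M) ->
  ((expR (- M))%:E * lam B <= psi_integral t)%E.
Proof.
move=> mB hM; rewrite -integral_cst//.
apply: (@le_trans _ _ (\int[lam]_(z in B) (expR (- t * rpsi z))%:E)%E).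
  apply: ge0_le_integral => //.
  - by move=> z _; rewrite lee_fin expR_ge0.
  - exact: measurable_funTS.
  - by move=> z /hM h1; rewrite lee_fin ler_expR mulNr lerN2.
by apply: ge0_subset_integral => // z _; rewrite lee_fin expR_ge0.
Qed.

Lemma re_psi_le_levy_h r z : 0 < r -> enorm z <= r^-1 -> rpsi z <= 2 * h r.
Proof.
move=> r0 zr; apply: le_trans (psi_star_le_levy_h b triplet r0).
exact: re_psi_le_star.
Qed.

(** The cube of half-side 1 / (d s) lies in the ball of radius 1 / s, where Re psi <= 2 h(s). *)
Lemma psi_integral_levy_h t s : 0 <= t -> 0 < s ->
  (((2 / (d%:R * s)) ^+ d * expR (- (2 * t * h s)))%:E <= psi_integral t)%E.
Proof.
move=> t0 s0; pose a := (d%:R * s)^-1.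
have a0 : 0 < a by rewrite invr_gt0 mulr_gt0.
have h1 : ((expR (- (2 * t * h s)))%:E * lam (cube 0 a) <= psi_integral t)%E.
  apply: psi_integral_ge => [|z /enorm_cube]; first exact: measurable_cube.
  rewrite subr0 /a invfM mulrA divff ?gt_eqF// mul1r => /(re_psi_le_levy_h s0) h1.
  by rewrite -mulrA mulrCA ler_wpM2l.
by apply: le_trans h1; rewrite lebesgue_cube ?(ltW a0)// -EFinM mulrC.
Qed.

(** At the scale s = h^-1(2/t), [psi_integral_levy_h] bounds the integral below by a multiple of
    s^-d, with exponent 2 (m t) (2 / t) = 4 m; against the upper bound in r = h^-1(1/t) this
    controls (r / s)^d. The parameter m is 1 under C2 and 2 under a density bound. *)
Lemma levy_hinv_doubling m t c : 0 < m -> 0 < t -> 0 < c ->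
  (psi_integral (m * t) <= (c * hinv t^-1 ^- d)%:E)%E ->
  hinv t^-1 <= (1 + c * expR (4 * m) * (d%:R / 2) ^+ d) * hinv (2 / t).
Proof.
move=> m0 t0 c0 It; have mt0 : 0 <= m * t by rewrite mulr_ge0// ltW.
 set r := hinv t^-1; set s := hinv (2 / t).
have ti0 : 0 < t^-1 by rewrite invr_gt0.
have t20 : 0 < 2 / t by rewrite divr_gt0.
have r0 : 0 < r by exact: levy_hinv_gt0.
have s0 : 0 < s by exact: levy_hinv_gt0.
have := le_trans (psi_integral_levy_h mt0 s0) It.
rewrite lee_fin levy_hinvK// => h1.
have e4 : 2 * (m * t) * (2 / t) = 4 * m by field; rewrite gt_eqF.
have {}h1 : (r / s) ^+ d <= c * expR (4 * m) * (d%:R / 2) ^+ d.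
  have hd0 : 0 < (d%:R / 2) ^+ d :> R by rewrite exprn_gt0// divr_gt0.
  have rd0 : 0 < r ^+ d by rewrite exprn_gt0.
  have e0 := expR_gt0 (4 * m).
  have p : 0 < r ^+ d * expR (4 * m) * (d%:R / 2) ^+ d by rewrite !mulr_gt0.
  move: h1; rewrite -(ler_pM2l p) e4 expRN.
  rewrite (_ : _ * (_ / expR (4 * m)) = (r / s) ^+ d); last first.
    have -> : (r / s) ^+ d = r ^+ d * (d%:R / 2) ^+ d * (2 / (d%:R * s)) ^+ d.
      by rewrite -!exprMn; congr (_ ^+ _); field; rewrite !gt_eqF.
    by field; rewrite gt_eqF.
  move=> /le_trans-> //; rewrite le_eqVlt; apply/orP; left; apply/eqP.
  by field; rewrite gt_eqF.
(* To remove the exponent d: a ratio above 1 is at most its d-th power, and a ratio below 1 is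
   absorbed by the summand 1. *)
rewrite -ler_pdivrMr//; have [rs|rs] := leP (r / s) 1.
  by apply: le_trans rs _; rewrite lerDl mulr_ge0 ?mulr_ge0 ?expR_ge0 ?(ltW c0).
apply: (@le_trans _ _ ((r / s) ^+ d)); first by rewrite ler_eXnr ?(ltW rs).
by apply: le_trans h1 _; rewrite lerDr.
Qed.

Lemma le_psi_star s u : 0 <= s -> s <= u -> star s <= star u.
Proof.
move=> s0 su; apply: psi_star_le => // x xs.
by apply: re_psi_le_star => //; exact: le_trans su.
Qed.

End psi_integral.

Lemma inve_ltV (R : realType) (T : \bar R) (r : R) : (0 < T)%E -> 0 < r ->
  (T^-1 < (r^-1)%:E)%E = (r%:E < T)%E.
Proof.
case: T => [T| |]// T0 r0.
  by rewrite inver gt_eqF// !lte_fin ltf_pV2.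
by rewrite invey lte_fin invr_gt0 r0 ltry.
Qed.

(** * From C2 to C3 *)

Section C2_implies_C3.
Context {R : realType} {d : nat}.
Variables (A : 'M[R]_d) (N : {measure set 'rV[R]_d -> \bar R}) (b : 'rV[R]_d).
Hypothesis d_gt0 : (0 < d)%N.
Hypothesis triplet : generating_triplet A N.
Hypothesis levy_h0 : levy_h A N r @[r --> 0^'+] --> +oo.
Implicit Types (x z : 'rV[R]_d) (r s t u v w y c a : R).

Notation rpsi := (re_psi A N b).
Notation star := (psi_star A N b).
Notation h := (levy_h A N).
Notation hinv := (levy_hinv A N).
Notation lam := (lebesgue_rV d).
Notation psi_integral := (psi_integral A N b).

Let dR0 : 0 < d%:R :> R. Proof. by rewrite ltr0n. Qed.

(* The hypothesis is what a bound on the density of Y_t gives. *)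
Lemma C2_of_half (T : \bar R) c : (0 < T)%E -> 0 < c ->
  (forall t, 0 < t -> (t%:E < T)%E ->
    (psi_integral (2 * t) <= (c * hinv t^-1 ^- d)%:E)%E) -> C2 A N b.
Proof.
move=> T0 c0 hT; pose k := 1 + c * expR (4 * 2) * (d%:R / 2) ^+ d.
have k0 : 0 < k by rewrite ltr_pwDl// !mulr_ge0 ?expR_ge0 ?exprn_ge0 ?divr_ge0// ltW.
exists T, (c * k ^+ d); split => // [|t t0 tT]; first by rewrite mulr_gt0// exprn_gt0.
(* At t / 2 the hypothesis bounds the integral at time t by a multiple of h^-1(2/t)^-d, and doubling
   replaces h^-1(2/t) by h^-1(1/t). *)
have t20 : 0 < t / 2 by rewrite divr_gt0.
have t2T : ((t / 2)%:E < T)%E.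
  by apply: le_lt_trans tT; rewrite lee_fin ler_pdivrMr//; lra.
have := hT _ t20 t2T; rewrite mulrCA divff// mulr1 invf_div => /le_trans; apply.
have hk := levy_hinv_doubling d_gt0 triplet levy_h0 (ltr0n _ 2) t0 c0 (hT _ t0 tT).
have r0 : 0 < hinv t^-1 by apply: levy_hinv_gt0; rewrite ?invr_gt0.
have s0 : 0 < hinv (2 / t) by apply: levy_hinv_gt0; rewrite ?divr_gt0.
rewrite lee_fin -mulrA ler_pM2l// ler_pdivlMr ?exprn_gt0// mulrC.
rewrite ler_pdivrMr ?exprn_gt0// -exprMn lerXn2r ?nnegrE ?mulr_ge0 ?(ltW r0) ?(ltW k0) ?(ltW s0)//.
Qed.

Section local_bound.
Variables r1 c : R.
Hypothesis c0 : 0 < c.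
(** C2 with time parametrised as t = 1 / h(r), so that h^-1(1/t) is simply r. *)
Hypothesis psi_integral_levy_h_le : forall r, 0 < r -> r < r1 ->
  (psi_integral (h r)^-1 <= (c * r ^- d)%:E)%E.

(** One more than the doubling constant for m = 1: this ensures k >= 2 and so keeps the exponent
    [alpha] at most 1. *)
Let k : R := 2 + c * expR (4 * 1) * (d%:R / 2) ^+ d.

Let k2 : 2 <= k.
Proof. by rewrite lerDl !mulr_ge0 ?expR_ge0 ?exprn_ge0 ?divr_ge0 ?(ltW c0). Qed.

Let k0 : 0 < k. Proof. by apply: lt_le_trans k2. Qed.

Let levy_h_doubling r : 0 < r -> r < r1 -> 2 * h r <= h (r / k).
Proof.
move=> r0 rr1; have hr0 := levy_h_gt0 triplet levy_h0 r0.
have ti0 : 0 < (h r)^-1 by rewrite invr_gt0.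
have h20 : 0 < 2 * h r by rewrite mulr_gt0.
have := @levy_hinv_doubling _ _ _ _ b d_gt0 triplet levy_h0 1 _ c ltr01 ti0 c0.
rewrite mul1r invrK levy_hK// => /(_ (psi_integral_levy_h_le r0 rr1)) hk.
have s0 := levy_hinv_gt0 triplet levy_h0 h20.
have rk : r / k <= hinv (2 * h r).
  rewrite ler_pdivrMr// mulrC; apply: le_trans hk _; rewrite ler_pM2r//.
  by rewrite /k lerD2r ler1n.
have := levy_h_le triplet levy_h0 (divr_gt0 r0 k0) rk.
by rewrite levy_hinvK.
Qed.

Lemma levy_h_growth r n : 0 < r -> r < r1 -> 2 ^+ n * h r <= h (r / k ^+ n).
Proof.
move=> r0 rr1; elim: n => [|n ih]; first by rewrite !expr0 mul1r divr1.
rewrite exprS -mulrA.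
have -> : r / k ^+ n.+1 = r / k ^+ n / k by rewrite exprSr invfM mulrA.
have kn1 : 1 <= k ^+ n by rewrite exprn_ege1// (le_trans _ k2)// ler1n.
have rkn : r / k ^+ n <= r by rewrite ler_pdivrMr ?ler_pMr// (lt_le_trans _ kn1).
apply: le_trans (levy_h_doubling _ (le_lt_trans rkn rr1)); last first.
  by rewrite divr_gt0// exprn_gt0.
by rewrite ler_pM2l.
Qed.

Let q : R := 1 + 64 * d%:R.

Let q1 : 1 <= q. Proof. by rewrite lerDl mulr_ge0// ltW. Qed.

Let q0 : 0 < q. Proof. by apply: lt_le_trans q1. Qed.

Let alpha : R := ln 2 / ln k.

(** Doubling of h iterated, then carried over to psi^*: the comparison at both ends costs 2 q, the
    rounding in [powR_growth] another 2. *)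
Lemma psi_star_growth s l : 0 < s -> s^-1 < r1 -> 1 <= l ->
  (4 * q)^-1 * l `^ alpha * star s <= star (l * s).
Proof.
move=> s0 sr1 l1; have p : 0 < (2 * q)^-1 by rewrite invr_gt0 mulr_gt0.
have -> : (4 * q)^-1 = (2 * q)^-1 / 2 by rewrite -invfM; congr (_^-1); ring.
apply: powR_growth => //; [by apply: lt_le_trans k2; rewrite ltr1n|by rewrite ltr1n|..].
- exact: psi_star_ge0 (ltW s0).
- by move=> u v; exact: le_psi_star.
move=> n; have kn0 : 0 < k ^+ n by rewrite exprn_gt0.
have sn0 : 0 < s^-1 / k ^+ n by rewrite divr_gt0// invr_gt0.
have h1 := levy_h_le_psi_star b triplet sn0.
have h2 := @levy_h_growth s^-1 n; rewrite invr_gt0 s0 sr1 in h2.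
have h3 := psi_star_le_levy_h b triplet (_ : 0 < s^-1); rewrite invrK invr_gt0 in h3.
rewrite invf_div invrK in h1.
rewrite -mulrA ler_pdivrMl ?mulr_gt0//.
have e0 : 0 < 2 ^+ n :> R by rewrite exprn_gt0.
have := h3 s0; rewrite -(ler_pM2l e0) => /le_trans; apply.
rewrite mulrCA -mulrA ler_pM2l//; apply: le_trans (h2 isT isT) _.
by apply: le_trans h1 _; rewrite mulrC.
Qed.

(** Points of a cube are within |x| / 4 of its centre, while distinct centres are at least |x|
    apart. *)
Lemma trivIset_cubes x m : 0 < enorm x ->
  trivIset `I_m (fun i => cube (i%:R *: x) (enorm x / (4 * d%:R))).
Proof.
move=> x0 i j _ _ [z [zi zj]].
have h1 : enorm ((i%:R - j%:R) *: x) <= d%:R * (2 * (enorm x / (4 * d%:R))).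
  apply: enorm_le_max => l; have := cubeP zi l; have := cubeP zj l.
  rewrite !mxE !ler_norml => /andP[a1 a2] /andP[b1 b2]; apply/andP; split; move: a1 a2 b1 b2.
    set X := _ / _; lra.
  set X := _ / _; lra.
rewrite enormZ in h1.
have {}h1 : `|i%:R - j%:R : R| <= 1 / 2.
  rewrite -(ler_pM2r x0); apply: le_trans h1 _.
  by rewrite le_eqVlt; apply/orP; left; apply/eqP; field; rewrite gt_eqF.
move: h1; rewrite ler_norml; case: (ltngtP i j) => // ij /andP[a1 a2].
  exfalso; have : (i.+1%:R : R) <= j%:R by rewrite ler_nat.
  by rewrite -natr1; lra.
exfalso; have : (j.+1%:R : R) <= i%:R by rewrite ler_nat.
by rewrite -natr1; lra.
Qed.

(** Each cube has volume (|x| / (2 d))^d and the integrand there will be at least exp (- 6): with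
    this K the cubes together contribute more than c |x|^d. *)
Let K : nat := (Num.truncn (c * expR 6 * (2 * d%:R) ^+ d)).+1.

(* Otherwise exp (- t Re psi) would be of order 1 on K disjoint cubes with
   centres k x, for t = 1 / h (1 / |x|), and its integral too large. *)
Lemma levy_h_le_re_psi x : 0 < enorm x -> (enorm x)^-1 < r1 ->
  h (enorm x)^-1 <= K%:R ^+ 2 * rpsi x.
Proof.
move=> x0 xr1; set s := enorm x in x0 xr1 *; have r0 : 0 < s^-1 by rewrite invr_gt0.
have h0 := levy_h_gt0 triplet levy_h0 r0.
rewrite leNgt; apply/negP => small.
have a0 : 0 <= s / (4 * d%:R) by rewrite divr_ge0 ?mulr_ge0 ?(ltW x0).
pose B := \bigcup_(i < K) cube (i%:R *: x) (s / (4 * d%:R)).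
have mB : measurable B by apply: bigcup_measurable => i _; exact: measurable_cube.
have BE : lam B = ((K%:R * (s / (2 * d%:R)) ^+ d)%:E : \bar R).
  have := measure_semi_additive_ord_I lam
    (fun i (_ : (i < K)%N) => measurable_cube (i%:R *: x) _) (@trivIset_cubes x K x0).
  have <- : B = \big[setU/set0]_(i < K) cube (i%:R *: x) (s / (4 * d%:R)).
    by rewrite /B bigcup_mkord.
  move=> /(_ mB) BE; rewrite [LHS]BE.
  rewrite (eq_bigr (fun=> ((s / (2 * d%:R)) ^+ d)%:E)) => [|i _]; last first.
    transitivity ((2 * (s / (4 * d%:R))) ^+ d)%:E; first exact: lebesgue_cube.
    by congr (_ ^+ _)%:E; field; rewrite gt_eqF.
  by rewrite sumEFin sumr_const card_ord -[_ *+ _]mulr_natl.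
(* Here 6 = 2 + 4 by [re_psiD]: Re psi is at most h at the centre and at most 2 h at the offset from
   it. *)
have le6 z : B z -> (h s^-1)^-1 * rpsi z <= 6.
  move=> [i /= iK zi]; rewrite ler_pdivrMl//.
  have -> : z = i%:R *: x + (z - i%:R *: x) by rewrite addrC subrK.
  apply: le_trans (re_psiD b triplet _ _) _.
  have h1 : rpsi (i%:R *: x) <= h s^-1.
    apply: le_trans (re_psiM b triplet i x) _; apply: le_trans (ltW small).
    by rewrite ler_wpM2r ?re_psi_ge0// lerXn2r ?nnegrE// ler_nat ltnW.
  have h2 : rpsi (z - i%:R *: x) <= 2 * h s^-1.
    apply: re_psi_le_levy_h => //; rewrite invrK; apply: le_trans (enorm_cube zi) _.
    rewrite (_ : _ * _ = s / 4); last by field; rewrite gt_eqF.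
    by rewrite ler_pdivrMr// ler_pMr// ler1n.
  lra.
have := le_trans (psi_integral_ge triplet mB le6) (psi_integral_levy_h_le r0 xr1).
rewrite BE -EFinM lee_fin exprVn invrK expr_div_n expRN.
have sd0 : 0 < s ^+ d by rewrite exprn_gt0.
have dd0 : 0 < (2 * d%:R) ^+ d :> R by rewrite exprn_gt0// mulr_gt0.
have e0 := expR_gt0 (6 : R).
have p : 0 < expR 6 * (2 * d%:R) ^+ d / s ^+ d by rewrite divr_gt0 ?mulr_gt0.
rewrite -(ler_pM2l p) (_ : _ * (_^-1 * _) = K%:R); last by field; rewrite !gt_eqF.
rewrite (_ : _ * (c * _) = c * expR 6 * (2 * d%:R) ^+ d); last by field; rewrite !gt_eqF.
by rewrite leNgt truncnS_gt.
Qed.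

Lemma C3_of_local_bound : 0 < r1 -> C3 A N b.
Proof.
move=> r10; have K1 : (1 : R) <= K%:R ^+ 2 by rewrite exprn_ege1// ler1n.
have K0 : (0 : R) < 2 * K%:R ^+ 2 by rewrite mulr_gt0// (lt_le_trans _ K1).
have lk0 : 0 < ln k by rewrite ln_gt0// (lt_le_trans _ k2)// ltr1n.
have inv_lt s : (r1%:E^-1 < s%:E)%E -> 0 < s /\ s^-1 < r1.
  rewrite inver gt_eqF// lte_fin => rs; have s0 : 0 < s by apply: lt_trans rs; rewrite invr_gt0.
  by split => //; rewrite -[r1]invrK ltf_pV2 ?posrE ?invr_gt0.
(* The two halves of C3 hold with (2 K^2)^-1 and (4 q)^-1; the sum in the denominator makes [c3]
   smaller than both. *)
pose c3 := (4 * q + 2 * K%:R ^+ 2)^-1.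
have c30 : 0 < c3 by rewrite invr_gt0 addr_gt0// mulr_gt0.
have ln20 : 0 < ln (2 : R) by rewrite ln_gt0// ltr1n.
exists r1%:E, c3, alpha; split => //.
- by rewrite c30 invf_le1 ?addr_gt0 ?mulr_gt0//; have := q1; lra.
- rewrite divr_gt0//= ler_pdivrMr// (@le_trans _ _ (ln k))//.
    by rewrite ler_ln ?posrE.
  by rewrite ler_pMl// ler1n.
split.
- move=> x /inv_lt[x0 xr1]; have := levy_h_le_re_psi x0 xr1.
  have := @psi_star_le_levy_h _ _ A N b triplet (enorm x)^-1; rewrite invr_gt0 => /(_ x0).
  rewrite invrK => h1 h2; rewrite ler_pdivrMl ?invr_gt0 ?addr_gt0 ?mulr_gt0//.
  have := re_psi_ge0 b triplet x; have := mulr_ge0 (ltW q0) (re_psi_ge0 b triplet x).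
  by move: h1 h2; rewrite mulrDl; lra.
- move=> l s l1 /inv_lt[s0 sr1]; apply: le_trans (psi_star_growth s0 sr1 l1).
  rewrite ler_wpM2r ?psi_star_ge0 ?(ltW s0)// ler_wpM2r ?powR_ge0//.
  by rewrite lef_pV2 ?posrE ?addr_gt0 ?mulr_gt0// lerDl ltW.
Qed.

End local_bound.

Lemma C2_C3 : C2 A N b -> C3 A N b.
Proof.
move=> [T [c [T0 c0 hT]]].
(* An infinite horizon is cut down to 1, since the local argument works below a finite radius. *)
have [t0 t00 ht] : exists2 t0 : R, 0 < t0 & forall t, t < t0 -> (t%:E < T)%E.
  case: T T0 {hT} => [T| |]// T0; first by exists T.
  by exists 1 => // t _; rewrite ltry.
have t0i : 0 < t0^-1 by rewrite invr_gt0.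
have r10 : 0 < hinv t0^-1 by exact: levy_hinv_gt0.
apply: (C3_of_local_bound c0) r10 => r r0 rr1.
have h0 := levy_h_gt0 triplet levy_h0 r0.
have := hT (h r)^-1; rewrite invr_gt0 invrK levy_hK//; apply => //; apply: ht.
rewrite -[t0]invrK ltf_pV2 ?posrE// -{1}(levy_hinvK triplet levy_h0 t0i).
exact: levy_h_lt.
Qed.

End C2_implies_C3.

(** * From C3 to C2 through stretched exponentials *)

Section stretched_exponential.
Context {R : realType}.
Implicit Types (k a y r c : R).

(** From exp (w / m) >= w / m follows exp w >= (w / m)^m; for w = k y^a the condition 2 d <= a m
    then gives y^(a m) >= y^(2 d), as y >= 1. *)
Lemma expR_powR_le k a y (m d : nat) : 0 < k -> (0 < m)%N ->
  2 * d%:R <= a * m%:R -> 1 <= y ->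
  expR (- (k * y `^ a)) <= (m%:R / k) ^+ m * (y ^+ 2) ^- d.
Proof.
move=> k0 m0 dm y1; have y0 : 0 < y by apply: lt_le_trans y1.
have mR0 : 0 < m%:R :> R by rewrite ltr0n.
pose w := k * y `^ a; have w0 : 0 < w by rewrite mulr_gt0 ?powR_gt0.
have h1 : (w / m%:R) ^+ m <= expR w.
  have e : w = m%:R * (w / m%:R) by rewrite mulrC divfK ?gt_eqF.
  rewrite [in X in _ <= X]e expRM_natl.
  rewrite lerXn2r ?nnegrE ?expR_ge0 ?divr_ge0 ?(ltW w0)//.
  by apply: le_trans (expR_ge1Dx _); rewrite lerDr.
have h2 : (y ^+ 2) ^+ d <= (w / k) ^+ m.
  rewrite /w mulrAC divff ?gt_eqF// mul1r -exprM -!powR_mulrn ?powR_ge0 ?(ltW y0)//.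
  by rewrite -powRrM ler_powR// natrM.
rewrite -/w expRN ler_pdivlMr ?exprn_gt0// mulrC ler_pdivrMr ?expR_gt0//.
apply: le_trans h2 _; rewrite (_ : w / k = (m%:R / k) * (w / m%:R)).
  by rewrite exprMn ler_pM2l// exprn_gt0// divr_gt0.
by field; rewrite !gt_eqF.
Qed.

(** Here m is an integer above 2 d / a, as [expR_powR_le] wants. The factor 2^d comes from 1 + y^2
    <= 2 max (1, y^2), and the summand 1 serves the range y < 1. *)
Definition stretched_cst (d : nat) k a : R :=
  let m := (Num.truncn (2 * d%:R / a)).+1 in 2 ^+ d * (1 + (m%:R / k) ^+ m).

Lemma expR_powR_le_cauchy (d : nat) k a y v : 0 < k -> 0 < a -> 0 <= y -> 0 <= v ->
  (1 <= y -> k * y `^ a <= v) ->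
  expR (- v) <= stretched_cst d k a * (1 + y ^+ 2) ^- d.
Proof.
move=> k0 a0 y0 v0 hv; rewrite /stretched_cst; set m := (Num.truncn _).+1.
have mR0 : 0 < m%:R / k by rewrite divr_gt0.
have q0 : 0 < 1 + y ^+ 2 by rewrite ltr_pwDl// sqr_ge0.
have [y1|y1] := ltP y 1.
  apply: (@le_trans _ _ 1); first by rewrite -expR0 ler_expR oppr_le0.
  rewrite ler_pdivlMr ?exprn_gt0// mul1r.
  apply: (@le_trans _ _ (2 ^+ d)).
    rewrite lerXn2r ?nnegrE ?(ltW q0)//.
    by rewrite -[leRHS]/(1 + 1) lerD2l expr_le1// ltW.
  by rewrite ler_pMr ?exprn_gt0// lerDl exprn_ge0// ltW.
apply: (@le_trans _ _ (expR (- (k * y `^ a)))); first by rewrite ler_expR lerN2 hv.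
apply: le_trans (expR_powR_le (m := m) (d := d) k0 _ _ y1) _ => //.
  by rewrite -ler_pdivrMl// mulrC ltW// truncnS_gt.
have y_gt0 : 0 < y by rewrite (lt_le_trans _ y1).
have y20 : 0 < y ^+ 2 by rewrite exprn_gt0.
rewrite ler_pdivlMr ?exprn_gt0// mulrAC ler_pdivrMr ?exprn_gt0//.
rewrite [leRHS]mulrAC [leRHS]mulrC -exprMn.
apply: ler_pM; [by rewrite exprn_ge0// ltW|by rewrite exprn_ge0// ltW| |].
  by rewrite lerDr.
rewrite lerXn2r ?nnegrE ?mulr_ge0 ?(ltW q0) ?(ltW y20)//.
have : 1 <= y ^+ 2 by rewrite exprn_ege1.
by lra.
Qed.

End stretched_exponential.

Section C3_implies_C2.
Context {R : realType} {d : nat}.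
Variables (A : 'M[R]_d) (N : {measure set 'rV[R]_d -> \bar R}) (b : 'rV[R]_d).
Hypothesis triplet : generating_triplet A N.
Hypothesis levy_h0 : levy_h A N r @[r --> 0^'+] --> +oo.
Implicit Types (x z : 'rV[R]_d) (r s t u v w y c a : R).

Notation rpsi := (re_psi A N b).
Notation star := (psi_star A N b).
Notation h := (levy_h A N).
Notation hinv := (levy_hinv A N).
Notation lam := (lebesgue_rV d).
Notation psi_integral := (psi_integral A N b).

(** Free of the process, as uniformity demands. The power of pi is the mass (2 pi)^n of the Cauchy
    product divided by the 2^n of its rescaling. *)
Definition C3_cst (n : nat) c a : R :=
  stretched_cst n (c ^+ 2 / (1 + 64 * n%:R)) a * pi ^+ n.

(** Each half of C3 contributes one factor c, and passing from psi^*(1/r) to h(r) contributes the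
    denominator. *)
Lemma C3_re_psi_ge T c a r z : (0 < T)%E -> 0 < c -> C3_with A N b T c a ->
  0 < r -> (r%:E < T)%E -> 1 <= r * enorm z ->
  c ^+ 2 / (1 + 64 * d%:R) * (r * enorm z) `^ a <= (h r)^-1 * rpsi z.
Proof.
move=> T0 c0 [C3a C3b] r0 rT rz.
have q0 : 0 < 1 + 64 * d%:R :> R by rewrite ltr_pwDl.
have h0 := levy_h_gt0 triplet levy_h0 r0.
have rT' : (T^-1 < (r^-1)%:E)%E by rewrite inve_ltV.
have rz' : r^-1 <= enorm z by rewrite -[leLHS]mulr1 ler_pdivrMl.
have h1 := C3a z (lt_le_trans rT' (_ : _ <= _)%E); rewrite lee_fin in h1.
have h2 := C3b _ _ rz rT'; rewrite [r * _]mulrC mulfK ?gt_eqF// mulrC in h2.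
have h3 := levy_h_le_psi_star b triplet r0.
rewrite ler_pdivlMl//; apply: le_trans (h1 rz'); rewrite expr2.
rewrite (_ : h r * _ = c * (c * (r * enorm z) `^ a * (h r / (1 + 64 * d%:R)))); last first.
  by field; rewrite gt_eqF.
rewrite ler_pM2l//; apply: (le_trans _ h2).
rewrite ler_wpM2l ?mulr_ge0 ?powR_ge0 ?(ltW c0)//.
by rewrite ler_pdivrMr// mulrC.
Qed.

(** After rescaling, the right-hand side is the product of the 1 / (1 + r^2 z_j^2), and |z_j| <= |z|
    for each j. *)
Lemma cauchy_rV_ge r z : 0 < r ->
  (1 + (r * enorm z) ^+ 2) ^- d <= (2 * r) ^- d * cauchy_rV r^-1 (0 - z).
Proof.
move=> r0; rewrite -!exprVn /cauchy_rV.
have prodE u : u ^+ d = \prod_(j < d) u by rewrite prodr_const card_ord.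
rewrite !prodE -big_split/=.
apply: ler_prod => j _; rewrite invr_ge0 addr_ge0 ?sqr_ge0//=.
rewrite /cauchy_kernel !mxE sub0r sqrrN.
have p : 0 < 1 + r ^+ 2 * z ord0 j ^+ 2.
  by rewrite ltr_pwDl// mulr_ge0 ?sqr_ge0.
rewrite [leRHS](_ : _ = (1 + r ^+ 2 * z ord0 j ^+ 2)^-1); last first.
  have -> : r^-1 ^+ 2 + z ord0 j ^+ 2 = (1 + r ^+ 2 * z ord0 j ^+ 2) / r ^+ 2.
    by field; rewrite gt_eqF.
  by move: (1 + _ * _) p => w w0; field; rewrite !gt_eqF.
have p1 : 0 < 1 + (r * enorm z) ^+ 2 by rewrite ltr_pwDl ?sqr_ge0.
rewrite lef_pV2 ?posrE// lerD2l exprMn.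
rewrite ler_wpM2l ?sqr_ge0// -real_normK ?num_real//.
by rewrite lerXn2r ?nnegrE ?enorm_ge0// normr_coord_le.
Qed.

Lemma C3_psi_integral_le T c a r : (0 < T)%E -> 0 < c -> 0 < a ->
  C3_with A N b T c a -> 0 < r -> (r%:E < T)%E ->
  (psi_integral (h r)^-1 <= (C3_cst d c a * r ^- d)%:E)%E.
Proof.
move=> T0 c0 a0 C3T r0 rT; have h0 := levy_h_gt0 triplet levy_h0 r0.
have q0 : 0 < 1 + 64 * d%:R :> R by rewrite ltr_pwDl.
pose k := c ^+ 2 / (1 + 64 * d%:R).
have k0 : 0 < k by rewrite divr_gt0// exprn_gt0.
have B0 : 0 <= stretched_cst d k a.
  rewrite mulr_ge0 ?exprn_ge0// addr_ge0// exprn_ge0// divr_ge0// ltW//.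
have ri0 : 0 < r^-1 by rewrite invr_gt0.
have B1 : 0 <= stretched_cst d k a * (2 * r) ^- d.
  by rewrite mulr_ge0// invr_ge0 exprn_ge0// mulr_ge0// ltW.
apply: (@le_trans _ _ (\int[lam]_z
    ((stretched_cst d k a * (2 * r) ^- d)%:E * (cauchy_rV r^-1 (0 - z))%:E))%E).
  apply: ge0_le_integral => //.
  - apply/measurable_EFinP; apply: measurableT_comp => //.
    by apply: measurable_funM => //; exact: measurable_re_psi.
  - by apply/measurable_EFinP; apply: measurable_funM => //; exact: measurable_cauchy_rV_shift.
  - move=> z _; rewrite -EFinM lee_fin mulNr -mulrA.
    apply: le_trans (expR_powR_le_cauchy d k0 a0 (_ : 0 <= r * enorm z) _ _) _.
    + by rewrite mulr_ge0 ?enorm_ge0// ltW.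
    + by rewrite mulr_ge0 ?re_psi_ge0// invr_ge0 ltW.
    + exact: C3_re_psi_ge C3T _ _.
    + by rewrite ler_wpM2l// cauchy_rV_ge.
rewrite ge0_integralZl//; last 2 first.
- by apply/measurable_EFinP; exact: measurable_cauchy_rV_shift.
- by move=> z _; rewrite lee_fin cauchy_rV_ge0.
rewrite integral_cauchy_rV// -EFinM lee_fin /C3_cst -/k.
rewrite -2!mulrA ler_wpM2l// !exprMn -!exprVn.
rewrite exprVn le_eqVlt; apply/orP; left; apply/eqP.
by field; rewrite !gt_eqF ?exprn_gt0.
Qed.

Lemma C3_cst_gt0 (n : nat) c a : 0 < c -> 0 < C3_cst n c a.
Proof.
move=> c0; apply: mulr_gt0; last by rewrite exprn_gt0// pi_gt0.
apply: mulr_gt0; first by rewrite exprn_gt0.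
by rewrite ltr_pwDl// exprn_ge0// divr_ge0// divr_ge0 ?sqr_ge0.
Qed.

Lemma levy_hinv_lt T t : (0 < T)%E -> 0 < t -> (t%:E < (levy_hE A N T)^-1)%E ->
  ((hinv t^-1)%:E < T)%E.
Proof.
case: T => [T| |]// T0 t0; last by rewrite ltry.
have ti0 : 0 < t^-1 by rewrite invr_gt0.
have hT0 := levy_h_gt0 triplet levy_h0 T0.
rewrite /= inver gt_eqF// !lte_fin => tT; rewrite ltNge; apply/negP => Tt.
have := levy_h_le triplet levy_h0 T0 Tt; rewrite levy_hinvK//.
by apply/negP; rewrite -ltNge -[h T]invrK ltf_pV2 ?posrE ?invr_gt0.
Qed.

Lemma C3_psi_integral_levy_hinv T c a t : (0 < T)%E -> 0 < c -> 0 < a ->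
  C3_with A N b T c a -> 0 < t -> (t%:E < (levy_hE A N T)^-1)%E ->
  (psi_integral t <= (C3_cst d c a * hinv t^-1 ^- d)%:E)%E.
Proof.
move=> T0 c0 a0 C3T t0 tT; have ti0 : 0 < t^-1 by rewrite invr_gt0.
rewrite -[t in psi_integral t]invrK -[in psi_integral _](levy_hinvK triplet levy_h0 ti0).
apply: C3_psi_integral_le C3T _ _ => //; [exact: levy_hinv_gt0|exact: levy_hinv_lt].
Qed.

Lemma levy_hE_inv_gt0 T : (0 < T)%E -> (0 < (levy_hE A N T)^-1)%E.
Proof.
case: T => [T| |]// T0; last by rewrite /= inve0 ltry.
have hT0 := levy_h_gt0 triplet levy_h0 T0.
by rewrite /= inver gt_eqF// lte_fin invr_gt0.
Qed.

Lemma C3_C2 : C3 A N b -> C2 A N b.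
Proof.
move=> [T [c [a [T0 /andP[c0 c1] /andP[a0 a2] C3T]]]].
exists (levy_hE A N T)^-1%E, (C3_cst d c a); split.
- exact: levy_hE_inv_gt0.
- exact: C3_cst_gt0.
- by move=> t; exact: C3_psi_integral_levy_hinv.
Qed.

End C3_implies_C2.

(** * Conditions C3 and C4 *)

Section C3_C4.
Context {R : realType} {d : nat}.
Variables (A : 'M[R]_d) (N : {measure set 'rV[R]_d -> \bar R}) (b : 'rV[R]_d).
Hypothesis d_gt0 : (0 < d)%N.
Hypothesis triplet : generating_triplet A N.
Implicit Types (x z : 'rV[R]_d) (r s t u v w y c a : R).

Notation rpsi := (re_psi A N b).
Notation star := (psi_star A N b).

Let dR0 : 0 < d%:R :> R. Proof. by rewrite ltr0n. Qed.

Let mdot x : measurable_fun setT (fun z => dotv x z).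
Proof. by under eq_fun do rewrite dotvC; exact: measurable_dotv. Qed.

Let quad x := dotv x (mulmv A x).

Let quad_ge0 x : 0 <= quad x.
Proof. by case: triplet => _ + _; exact. Qed.

(** The analogue of [conc] in the single direction x. This is the K of the overview, and
    [proj_trunc] is its G. *)
Definition proj_conc x : R := quad x + \int[N]_z Num.min 1 (dotv x z ^+ 2).

Definition trunc2 x z : R := if `|dotv x z| < 1 then dotv x z ^+ 2 else 0.

Definition proj_trunc x : R := quad x + \int[N]_z trunc2 x z.

Let proj_truncE x : quad x +
  \int[N]_(z in [set z | `|dotv x z| < 1]) (`|dotv x z| ^+ 2) = proj_trunc x.
Proof.
rewrite /proj_trunc Rintegral_mkcond; congr (_ + _); apply: eq_Rintegral => z _.
rewrite patchE /trunc2; case: ifPn => [/set_mem/= ->|]; first by rewrite real_normK ?num_real.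
by rewrite notin_setE/= => /negP/negbTE->.
Qed.

Let trunc2_ge0 x z : 0 <= trunc2 x z.
Proof. by rewrite /trunc2; case: ifPn => // _; exact: sqr_ge0. Qed.

Let sqr_lt1 u : (u ^+ 2 < 1) = (`|u| < 1).
Proof. by rewrite -real_normK ?num_real// expr_lt1. Qed.

Let trunc2_le x z : trunc2 x z <= Num.min 1 (dotv x z ^+ 2).
Proof.
rewrite /trunc2; case: ifPn => [|_]; last by rewrite le_min ler01 sqr_ge0.
by rewrite -sqr_lt1 le_min lexx andbT => /ltW.
Qed.

Let integrable_min_dotv x : N.-integrable setT (fun z => (Num.min 1 (dotv x z ^+ 2))%:E).
Proof.
have := integrable_min triplet (sqr_ge0 (enorm x)); apply: le_integrable => //.
  by apply/measurable_EFinP; apply: measurable_minr => //; exact: measurable_funX.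
move=> z _; rewrite lee_fin ger0_norm; last by rewrite le_min ler01 sqr_ge0.
rewrite ger0_norm; last by rewrite le_min ler01 -exprMn sqr_ge0.
apply: le_min2 => //; rewrite -exprMn -[dotv x z ^+ 2]real_normK ?num_real//.
by rewrite lerXn2r ?nnegrE ?mulr_ge0 ?enorm_ge0 ?normr_dotv_le.
Qed.

Let integrable_trunc2 x : N.-integrable setT (fun z => (trunc2 x z)%:E).
Proof.
have := integrable_min_dotv x; apply: le_integrable => //.
  apply/measurable_EFinP; apply: measurable_fun_ifT => //.
    by apply: measurable_fun_ltr => //; exact: measurableT_comp.
  exact: measurable_funX.
move=> z _; rewrite lee_fin !ger0_norm ?trunc2_le//.
by rewrite le_min ler01 sqr_ge0.
Qed.

Lemma proj_trunc_le_conc x : proj_trunc x <= proj_conc x.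
Proof.
rewrite lerD2l; apply: le_Rintegral => //.
  exact: (integrable_trunc2 x).
exact: (integrable_min_dotv x).
Qed.

Lemma proj_conc_le_psi_star x : proj_conc x <= (1 + 64 * d%:R) * star (enorm x).
Proof.
apply: le_trans (conc_le_psi_star b triplet (enorm_ge0 x)).
apply: lerD.
  by rewrite mulrC; apply: quad_le_opnorm; case: triplet.
apply: le_Rintegral => //.
- exact: (integrable_min_dotv x).
- exact: (integrable_min triplet (sqr_ge0 _)).
move=> z _; apply: le_min2 => //; rewrite -exprMn -[dotv x z ^+ 2]real_normK ?num_real//.
by rewrite lerXn2r ?nnegrE ?mulr_ge0 ?enorm_ge0 ?normr_dotv_le.
Qed.

Lemma re_psi_le_proj_conc x : rpsi x <= 2 * proj_conc x.
Proof.
rewrite re_psi_1Bcos// mulrDr; apply: lerD.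
  by have := quad_ge0 x; rewrite /quad; lra.
rewrite -RintegralZl//; last exact: (integrable_min_dotv x).
apply: le_Rintegral => //.
- exact: (integrable_one_sub_cos triplet x).
- exact: (integrableZl measurableT 2 (integrable_min_dotv x)).
- by move=> z _; exact: one_sub_cos_min.
Qed.

Lemma proj_trunc_le_re_psi x : proj_trunc x <= 4 * rpsi x.
Proof.
rewrite re_psi_1Bcos// mulrDr; apply: lerD.
  by have := quad_ge0 x; rewrite /quad; lra.
rewrite -RintegralZl//; last exact: (integrable_one_sub_cos triplet x).
apply: le_Rintegral => //.
- exact: (integrable_trunc2 x).
- exact: (integrableZl measurableT 4 (integrable_one_sub_cos triplet x)).
move=> z _; rewrite /trunc2; case: ifPn => [/ltW/one_sub_cos_ge|_]; first lra.
by rewrite mulr_ge0// subr_ge0 cos_le1.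
Qed.

(** Pointwise with u = <x, z>^2: for 4 u < 1 both sides equal 4 u; otherwise the truncated term
    vanishes and the right-hand side is 1. *)
Lemma proj_conc_double x : proj_conc x + 3 / 4 * proj_trunc (2 *: x) <= proj_conc (2 *: x).
Proof.
have i1 := integrable_min_dotv x; have i2 := integrable_trunc2 (2 *: x).
rewrite /proj_conc /proj_trunc mulrDr addrACA lerD//.
  by rewrite /quad quadZ -/(quad x); lra.
rewrite -RintegralZl// -RintegralD//; last exact: (integrableZl measurableT (3 / 4) i2).
apply: le_Rintegral => //.
- exact: (integrableD measurableT i1 (integrableZl measurableT (3 / 4) i2)).
- exact: (integrable_min_dotv (2 *: x)).
move=> z _; rewrite /trunc2 -sqr_lt1 dotvZl exprMn.
move: (dotv x z ^+ 2) (sqr_ge0 (dotv x z)) => u u0.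
by rewrite !minEle; do ! case: ifPn; rewrite -?ltNge -?leNgt; lra.
Qed.

Lemma proj_concZ l x : proj_conc (l *: x) <= l ^+ 2 * proj_trunc x + proj_conc x.
Proof.
have i1 := integrable_min_dotv x; have i2 := integrable_trunc2 x.
have l0 := sqr_ge0 l.
rewrite /proj_conc /proj_trunc mulrDr addrACA lerD//.
  by rewrite /quad quadZ -/(quad x) lerDl.
rewrite -RintegralZl// -RintegralD//; last exact: (integrableZl measurableT (l ^+ 2) i2).
apply: le_Rintegral => //.
- exact: (integrable_min_dotv (l *: x)).
- exact: (integrableD measurableT (integrableZl measurableT (l ^+ 2) i2) i1).
move=> z _; rewrite /trunc2 -sqr_lt1 dotvZl exprMn.
move: (dotv x z ^+ 2) (sqr_ge0 (dotv x z)) => u u0.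
have [u1|u1] := ltP u 1.
  by rewrite ge_min lerDl u0 orbT.
by rewrite mulr0 add0r ge_min lexx.
Qed.

Let q : R := 1 + 64 * d%:R.

Let q1 : 1 <= q. Proof. by rewrite lerDl mulr_ge0// ltW. Qed.

Let q0 : 0 < q. Proof. by apply: lt_le_trans q1. Qed.

Lemma C3_C4 : C3 A N b -> C4 A N b.
Proof.
move=> [T [c [a [T0 /andP[c0 c1] /andP[a0 a2] [h1 h2]]]]].
(* Chosen so that l^a = 4 q / c^2, the value for which C3 yields K(l x) >= 2 K(x). *)
pose l := (4 * q / c ^+ 2) `^ a^-1.
have c20 : 0 < c ^+ 2 by rewrite exprn_gt0.
have c21 : c ^+ 2 <= 1 by rewrite expr_le1// ltW.
have q4 : 1 <= 4 * q / c ^+ 2.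
  by rewrite ler_pdivlMr// mul1r; have := q1; lra.
have l1 : 1 <= l by rewrite -(powRr0 (4 * q / c ^+ 2)) ler_powR// invr_ge0 ltW.
have la : l `^ a = 4 * q / c ^+ 2.
  by rewrite -powRrM mulVf ?gt_eqF// powRr1// (le_trans _ q4).
exists T, (2 * l ^+ 2 / c); split => //.
  rewrite ler_pdivlMr// mul1r; apply: le_trans c1 _.
  by have := exprn_ege1 2 l1; lra.
move=> x xT; rewrite -/(quad x) proj_truncE.
have l0 : 0 < l by apply: lt_le_trans l1.
have lx : enorm (l *: x) = l * enorm x by rewrite enormZ gtr0_norm.
have xlx : enorm x <= enorm (l *: x) by rewrite lx ler_peMl ?enorm_ge0.
have e1 := h1 _ (lt_le_trans xT (_ : _ <= (enorm (l *: x))%:E)%E).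
have {}e1 := e1 xlx.
have e2 := h2 _ _ l1 xT; rewrite -lx in e2.
have e3 := re_psi_le_proj_conc (l *: x).
have e4 := proj_concZ l x; have e5 := proj_conc_le_psi_star x.
have e6 := re_psi_le_proj_conc x; have e7 := h1 _ xT.
(* This doubling turns [proj_concZ] into K(x) <= l^2 G(x); C4 follows from psi^* <= Re psi / c <= 2
   K / c. *)
have e8 : 2 * proj_conc x <= proj_conc (l *: x).
  have h : c * (c * (4 * q / c ^+ 2) * star (enorm x)) <= 2 * proj_conc (l *: x).
    by rewrite -la; apply: le_trans e3; apply: le_trans e1; rewrite ler_pM2l.
  have E : c * (c * (4 * q / c ^+ 2) * star (enorm x)) = 4 * (q * star (enorm x)).
    by field; rewrite gt_eqF.
  by move: h; rewrite E -/q in e5 *; lra.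
rewrite mulrAC ler_pdivlMr// mulrC; lra.
Qed.

(** C4 makes psi^*, a supremum over directions, visible in each single one, so growth can be
    followed along a fixed axis: K(2 y) >= K(y) + (3/4) G(2 y), where G(2 y) >= psi^*(|y|) / c >=
    K(y) / (c q). *)
Lemma C4_growth (T : \bar R) c s n : (0 < T)%E -> 1 <= c ->
  (forall x, (T^-1 < (enorm x)%:E)%E -> star (enorm x) <= c * proj_trunc x) ->
  (T^-1 < s%:E)%E ->
  (c * q)^-1 * (1 + 3 / (4 * (c * q))) ^+ n * star s <= star (2 ^+ n * s).
Proof.
move=> T0 c1 hc sT; have c0 : 0 < c by apply: lt_le_trans c1.
have cq0 : 0 < c * q by rewrite mulr_gt0.
have s0 : 0 < s by rewrite -lte_fin; apply: le_lt_trans sT; rewrite inve_ge0 ltW.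
pose x : 'rV[R]_d := s *: delta_mx ord0 (Ordinal d_gt0).
have xs : enorm x = s.
  rewrite enormZ gtr0_norm// /enorm /dotv (bigD1 (Ordinal d_gt0))//= big1 => [|i ij]; last first.
    by rewrite mxE eqxx/= (negbTE ij) mul0r.
  by rewrite mxE !eqxx/= mul1r addr0 sqrtr1 mulr1.
have xk k : enorm (2 ^+ k *: x) = 2 ^+ k * s by rewrite enormZ gtr0_norm ?exprn_gt0// xs.
have kT k : (T^-1 < (enorm (2 ^+ k *: x))%:E)%E.
  apply: lt_le_trans sT _; rewrite lee_fin xk ler_peMl ?(ltW s0)//.
  by rewrite exprn_ege1// ler1n.
have grow : (1 + 3 / (4 * (c * q))) ^+ n * proj_conc x <= proj_conc (2 ^+ n *: x).
  elim: n => [|n ih]; first by rewrite !expr0 mul1r scale1r.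
  rewrite [_ ^+ n.+1]exprS -mulrA exprS -scalerA.
  set y := 2 ^+ n *: x in ih *.
  apply: (@le_trans _ _ ((1 + 3 / (4 * (c * q))) * proj_conc y)).
    by rewrite ler_wpM2l// addr_ge0// divr_ge0// mulr_ge0// ltW.
  apply: le_trans (proj_conc_double y); rewrite mulrDl mul1r lerD2l.
  have yn : 2 *: y = 2 ^+ n.+1 *: x by rewrite scalerA -exprS.
  have g1 := hc _ (kT n.+1); rewrite -yn in g1.
  have g2 : enorm y <= enorm (2 *: y).
    by rewrite enormZ ger0_norm// ler_peMl ?enorm_ge0// ler1n.
  have g3 := proj_conc_le_psi_star y; have g4 := le_psi_star b triplet (enorm_ge0 y) g2.
  rewrite -/q in g3.
  have g5 : proj_conc y <= c * q * proj_trunc (2 *: y).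
    apply: le_trans g3 _; rewrite [c * q]mulrC -mulrA ler_pM2l//.
    exact: le_trans g4 g1.
  rewrite (_ : 3 / (4 * (c * q)) * _ = 3 / 4 * (proj_conc y / (c * q))); last first.
    by field; rewrite !gt_eqF.
  by rewrite ler_pM2l// ler_pdivrMr// mulrC.
have g1 := hc x; rewrite xs in g1; have {}g1 := g1 sT.
have g2 := proj_trunc_le_conc x.
have g3 := proj_conc_le_psi_star (2 ^+ n *: x); rewrite xk -/q in g3.
rewrite -mulrA ler_pdivrMl//.
have p : 0 < (1 + 3 / (4 * (c * q))) ^+ n.
  by rewrite exprn_gt0// ltr_pwDl// divr_ge0// mulr_ge0// ltW.
apply: (@le_trans _ _ (c * ((1 + 3 / (4 * (c * q))) ^+ n * proj_conc x))).
  rewrite [leRHS]mulrCA ler_pM2l//; apply: le_trans g1 _; by rewrite ler_pM2l.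
rewrite -mulrA ler_pM2l//; exact: le_trans grow g3.
Qed.

Lemma C4_C3 : C4 A N b -> C3 A N b.
Proof.
move=> [T [c [T0 c1 hT]]]; have c0 : 0 < c by apply: lt_le_trans c1.
have hc x : (T^-1 < (enorm x)%:E)%E -> star (enorm x) <= c * proj_trunc x.
  by rewrite -proj_truncE; exact: hT.
have cq0 : 0 < c * q by rewrite mulr_gt0.
have cq1 : 1 <= c * q by rewrite -[leLHS]mulr1 ler_pM.
pose g := 1 + 3 / (4 * (c * q)).
have g1 : 1 < g by rewrite ltrDl divr_gt0// mulr_gt0.
(* Keeps the exponent ln g / ln 2 at most 2. *)
have g4 : g <= 4.
  rewrite (_ : 4 = 1 + 3); last by ring.
  rewrite lerD2l ler_pdivrMr ?mulr_gt0//; lra.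
have g0 : 0 < g by apply: lt_trans g1.
have ln20 : 0 < ln (2 : R) by rewrite ln_gt0// ltr1n.
(* The division by g is the rounding loss in [powR_growth]; the extra 4 brings the constant below 1
   / (4 c), which the first half of C3 needs. *)
pose c3 := (c * q)^-1 / (4 * g).
exists T, c3, (ln g / ln 2); split => //.
- rewrite divr_gt0 ?invr_gt0 ?mulr_gt0//=.
  rewrite /c3 -invfM invf_le1 ?mulr_gt0//.
  rewrite -[leLHS]mulr1 ler_pM//; lra.
- have lg0 : 0 < ln g by rewrite ln_gt0.
  apply/andP; split; first by rewrite divr_gt0.
  rewrite ler_pdivrMr// mulr_natl -lnXn// ler_ln ?posrE ?exprn_gt0//.
  by rewrite expr2; lra.
split.
- move=> x xT; have h1 := hc x xT; have h2 := proj_trunc_le_re_psi x.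
  have r0 := re_psi_ge0 b triplet x.
  rewrite /c3 -invfM ler_pdivrMl ?mulr_gt0//; apply: le_trans h1 _.
  apply: (@le_trans _ _ (c * (4 * rpsi x))); first by rewrite ler_pM2l.
  rewrite mulrA ler_wpM2r// -mulrA ler_pM2l//.
  rewrite -[leLHS]mul1r ler_pM//; rewrite -[leLHS]mulr1 ler_pM// ltW//.
- move=> l s l1 sT.
  have s0 : 0 < s by rewrite -lte_fin; apply: le_lt_trans sT; rewrite inve_ge0 ltW.
  have st0 := psi_star_ge0 b triplet (ltW s0).
  have k1 : 1 < 2 :> R by rewrite ltr1n.
  have cq' : 0 < (c * q)^-1 by rewrite invr_gt0.
  apply: le_trans (powR_growth k1 g1 cq' s0 st0 _ _ l1).
  + rewrite ler_wpM2r// ler_wpM2r ?powR_ge0// /c3 ler_pM2l//.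
    by rewrite lef_pV2 ?posrE ?mulr_gt0// ler_peMl// ?(ltW g0)// ler1n.
  + by move=> u v; exact: le_psi_star.
  + by move=> n; exact: C4_growth hc sT.
Qed.

End C3_C4.

(** * Densities of the process *)

Section density_bounds.
Local Open Scope complex_scope.
Context {R : realType} {d : nat} disp (Omega : measurableType disp).
Variables (P : probability Omega R) (Y : R -> Omega -> 'rV[R]_d).
Variables (A : 'M[R]_d) (N : {measure set 'rV[R]_d -> \bar R}) (b : 'rV[R]_d).
Hypothesis d_gt0 : (0 < d)%N.
Hypothesis setting : levy_setting A N b P Y.
Implicit Types (x z : 'rV[R]_d) (t c r : R).

Let triplet : generating_triplet A N. Proof. by case: setting. Qed.

Let levy_h0 : levy_h A N r @[r --> 0^'+] --> +oo. Proof. by case: setting. Qed.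

Let mY t : 0 <= t -> measurable_fun setT (Y t).
Proof. by case: setting => LP _ _ _; exact: (levy_measurable LP). Qed.

Notation rpsi := (re_psi A N b).
Notation hinv := (levy_hinv A N).
Notation lam := (lebesgue_rV d).
Notation psi_integral := (psi_integral A N b).

Lemma cexp_psi t z : 0 <= t ->
  cexp (- t%:C * psi A N b z) = cf_cos P (Y t) z +i* cf_sin P (Y t) z.
Proof.
move=> t0; have [_ _ /(_ t z t0) <- _] := setting.
rewrite /cintegral; apply/eqP; rewrite eq_complex /=; apply/andP; split; apply/eqP;
  apply: eq_Rintegral => w _ /=.
  by rewrite !(mul0r, mulr0, mul1r, oppr0, addr0, add0r, expR0).
by rewrite !(mul0r, mulr0, mul1r, oppr0, addr0, add0r, expR0).
Qed.

Lemma cf_norm_psi t z : 0 <= t ->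
  cf_cos P (Y t) z ^+ 2 + cf_sin P (Y t) z ^+ 2 = expR (- t * rpsi z) ^+ 2.
Proof.
move=> t0; have := cexp_psi z t0; rewrite /cexp /re_psi.
case: (psi A N b z) => u v /= -[<- <-].
rewrite !exprMn -mulrDr cos2Dsin2 mulr1; congr (expR _ ^+ 2).
by rewrite oppr0 mul0r subr0.
Qed.

Lemma psi_integral_le_density t f (M : R) : 0 <= t -> is_density P (Y t) f ->
  (forall x, f x <= M) -> (psi_integral (2 * t) <= (M * (2 * pi) ^+ d)%:E)%E.
Proof.
move=> t0 [mf f0 Pf] fM; have M0 : 0 <= M by exact: le_trans (f0 0) (fM 0).
apply: le_trans (@integral_cf_norm_le _ _ _ _ P (Y t) (mY t0) M M0 _); last first.
  move=> B mB; rewrite Pf// -integral_cst//; apply: ge0_le_integral => //.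
  - by move=> x _; rewrite lee_fin.
  - by apply/measurable_EFinP; exact: measurable_funTS.
  - by move=> x _; rewrite lee_fin.
rewrite le_eqVlt; apply/orP; left; apply/eqP; apply: eq_integral => z _.
by rewrite cf_norm_psi// -expRM_natl mulrA mulrN.
Qed.

(** What [psi_integral_levy_h] leaves at time 2t and scale h^-1(1/t), where the exponent is 2 (2 t)
    (1 / t) = 4, after division by (2 pi)^d. *)
Definition density_lower_cst : R := (2 * pi) ^- d * (2 / d%:R) ^+ d * expR (- 4).

Lemma density_lower_cst_gt0 : 0 < density_lower_cst.
Proof.
rewrite !mulr_gt0 ?expR_gt0// ?invr_gt0 ?exprn_gt0 ?mulr_gt0 ?pi_gt0//.
by rewrite invr_gt0 ltr0n.
Qed.

Lemma sup_density_ge t f : 0 < t -> is_density P (Y t) f ->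
  ((density_lower_cst * hinv t^-1 ^- d)%:E <= sup_density f)%E.
Proof.
move=> t0 df; have ub x : ((f x)%:E <= sup_density f)%E.
  by apply: ereal_sup_ubound; exists x.
case: (sup_density f) ub => [M ub|_|/(_ 0)//]; last by rewrite leey.
have r0 : 0 < hinv t^-1 by apply: levy_hinv_gt0; rewrite ?invr_gt0.
have t20 : 0 <= 2 * t by rewrite mulr_ge0// ltW.
have := le_trans (psi_integral_levy_h b d_gt0 triplet t20 r0)
  (psi_integral_le_density (ltW t0) df ub).
rewrite !lee_fin levy_hinvK ?invr_gt0// mulrA mulfK ?gt_eqF//.
have pd0 : 0 < (2 * pi) ^+ d :> R by rewrite exprn_gt0// mulr_gt0// pi_gt0.
rewrite -ler_pdivrMr//; apply: le_trans.
rewrite le_eqVlt; apply/orP; left; apply/eqP; rewrite /density_lower_cst.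
have -> : (2 / (d%:R * hinv t^-1)) ^+ d = (2 / d%:R) ^+ d * hinv t^-1 ^- d.
  by rewrite invfM mulrA [LHS]exprMn exprVn.
have -> : - (2 * 2) = - 4 :> R by congr (- _); ring.
by rewrite [LHS]mulrAC [RHS]mulrC !mulrA.
Qed.

Lemma sup_density_inv_density t : 0 <= t -> (psi_integral t < +oo)%E ->
  [/\ is_density P (Y t) (inv_density P (Y t)),
      (sup_density (inv_density P (Y t)) <= psi_integral t)%E &
      forall x, (inv_density P (Y t) x)%:C = ((2 * pi) ^- d)%:C *
        cintegral lam (fun z =>
          cexp (- 'i * (dotv x z)%:C) * cexp (- t%:C * psi A N b z))].
Proof.
move=> t0 fin; pose g z := expR (- t * rpsi z).
have g0 z : 0 <= g z by exact: expR_ge0.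
have mg : measurable_fun setT g.
  by apply: measurableT_comp => //; apply: measurable_funM => //; exact: measurable_re_psi.
have ig : lam.-integrable setT (EFin \o g).
  apply/integrableP; split; first exact/measurable_EFinP.
  by under eq_integral do rewrite gee0_abs ?lee_fin//.
have nC z := cf_norm_psi z t0.
have leg u z : `|u| ^+ 2 <= g z ^+ 2 -> `|u| <= g z by rewrite ler_pXn2r ?nnegrE.
have Cg z : `|cf_cos P (Y t) z| <= g z.
  by apply: leg; rewrite real_normK ?num_real// -nC lerDl sqr_ge0.
have Sg z : `|cf_sin P (Y t) z| <= g z.
  by apply: leg; rewrite real_normK ?num_real// -nC lerDr sqr_ge0.
have mC := measurable_cf_cos P (mY t0); have mS := measurable_cf_sin P (mY t0).
have iC : lam.-integrable setT (EFin \o cf_cos P (Y t)).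
  apply: le_integrable ig => //; first exact/measurable_EFinP.
  by move=> z _; rewrite /= lee_fin (ger0_norm (g0 z)).
have iS : lam.-integrable setT (EFin \o cf_sin P (Y t)).
  apply: le_integrable ig => //; first exact/measurable_EFinP.
  by move=> z _; rewrite /= lee_fin (ger0_norm (g0 z)).
split.
- exact: inv_density_is_density (mY t0) iC iS.
- apply: ge_ereal_sup => _ [x _ <-].
  have := inv_density_le (mY t0) iC iS x ig g0 nC.
  (* The factor (2 pi)^-d of the inversion formula is simply bounded by 1. *)
  have p2 : 1 <= (2 * pi) ^+ d :> R.
    by rewrite exprn_ege1//; have := @pi_ge2 R; lra.
  have -> : psi_integral t = (\int[lam]_z g z)%:E.
    by rewrite /Rintegral fineK//; exact: (integrable_fin_num measurableT ig).
  rewrite lee_fin => /le_trans; apply.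
  rewrite ler_piMl ?Rintegral_ge0//.
  by rewrite invf_le1// (lt_le_trans _ p2).
- move=> x; have im0 := inv_density_im0 (mY t0) iC iS x.
  pose im z := cf_cos P (Y t) z * sin (dotv z x) - cf_sin P (Y t) z * cos (dotv z x).
  have iim : lam.-integrable setT (EFin \o im).
    apply: le_integrable (integrableZl measurableT 2 ig) => //.
      apply/measurable_EFinP; apply: measurable_funB; apply: measurable_funM => //.
        by apply: measurable_sinf; exact: measurable_dotv.
      by apply: measurable_cosf; exact: measurable_dotv.
    move=> z _; rewrite /= lee_fin (ger0_norm (_ : 0 <= 2 * g z)) ?mulr_ge0//.
    apply: le_trans (ler_normB _ _) _; rewrite !normrM.
    have h1 := ler_pM (normr_ge0 _) (normr_ge0 _) (Cg z) (sin_max (dotv z x)).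
    have h2 := ler_pM (normr_ge0 _) (normr_ge0 _) (Sg z) (cos_max (dotv z x)).
    by rewrite mulr1 in h1; rewrite mulr1 in h2; lra.
  have E z : cexp (- 'i * (dotv x z)%:C) * cexp (- t%:C * psi A N b z) =
      (cf_cos P (Y t) z * cos (dotv z x) + cf_sin P (Y t) z * sin (dotv z x)) +i*
      (- 1 * im z).
    rewrite cexp_psi// dotvC; apply/eqP; rewrite eq_complex /=.
    rewrite !(mul0r, mulr0, mul1r, mulN1r, oppr0, addr0, add0r, expR0).
    rewrite cosN sinN /im; apply/andP; split; apply/eqP; ring.
  rewrite /inv_density /cintegral.
  under [X in _ +i* X]eq_Rintegral do rewrite E.
  under [X in X +i* _]eq_Rintegral do rewrite E.
  rewrite /= (RintegralZl _ measurableT iim) im0 mulr0.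
  apply/eqP; rewrite eq_complex /=.
  by rewrite !(mul0r, mulr0, subr0, addr0) !eqxx.
Qed.

Lemma C7_of_psi_integral (T : \bar R) c c7 : (0 < T)%E ->
  (forall t, 0 < t -> (t%:E < T)%E ->
    (psi_integral t <= (c * hinv t^-1 ^- d)%:E)%E) ->
  density_lower_cst^-1 <= c7 -> c <= c7 -> C7_with A N b P Y T c7.
Proof.
move=> T0 bnd l7 cc7.
(* A transition density is required at every t > 0, while the bound is known for t < T only; the
   integral is nonincreasing in t, hence finite later too. *)
have fin t : 0 < t -> (psi_integral t < +oo)%E.
  move=> t0; have [t1 [t10 t1T t1t]] : exists t1, [/\ 0 < t1, (t1%:E < T)%E & t1 <= t].
    case: T T0 {bnd} => [T| |]// T0; last by exists t; rewrite ltry.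
    rewrite lte_fin in T0; exists (Num.min t (T / 2)); split.
    - by rewrite lt_min t0 divr_gt0.
    - by rewrite lte_fin gt_min; apply/orP; right; rewrite ltr_pdivrMr//; lra.
    - by rewrite ge_min lexx.
  apply: le_lt_trans (le_psi_integral b triplet t1t) _.
  by apply: le_lt_trans (bnd _ t10 t1T) _; rewrite ltry.
have c70 : 0 < c7 by apply: lt_le_trans l7; rewrite invr_gt0 density_lower_cst_gt0.
exists (fun t => inv_density P (Y t)); split => [t t0|t t0 tT].
  by have [df _ E] := sup_density_inv_density (ltW t0) (fin t t0).
have [df up _] := sup_density_inv_density (ltW t0) (fin t t0).
have r0 : 0 < hinv t^-1 by apply: levy_hinv_gt0; rewrite ?invr_gt0.
have rd0 : 0 < hinv t^-1 ^- d by rewrite invr_gt0 exprn_gt0.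
split.
  apply: le_trans (sup_density_ge t0 df); rewrite lee_fin ler_pM2r//.
  by rewrite -[leRHS]invrK lef_pV2 ?posrE ?invr_gt0 ?density_lower_cst_gt0.
apply: le_trans up _; apply: le_trans (bnd _ t0 tT) _.
by rewrite lee_fin ler_pM2r.
Qed.

(** A sum, so as to dominate at once 1 and the constants of both bounds. *)
Definition C7_cst c : R := 1 + density_lower_cst^-1 + c.

Let lower_ge0 : 0 <= density_lower_cst^-1.
Proof. by rewrite invr_ge0 ltW// density_lower_cst_gt0. Qed.

Lemma C1_C7 : C1 A N b P Y -> C7 A N b P Y.
Proof.
move=> [p [tp [T [c [T0 c0 bnd]]]]].
exists T, (C7_cst c); split => //; first by rewrite /C7_cst -addrA lerDl addr_ge0// ltW.
have C0 : 0 < C7_cst c by rewrite /C7_cst -addrA ltr_pwDl// addr_ge0// ltW.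
exists p; split => // t t0 tT.
have r0 : 0 < hinv t^-1 by apply: levy_hinv_gt0; rewrite ?invr_gt0.
have rd0 : 0 < hinv t^-1 ^- d by rewrite invr_gt0 exprn_gt0.
split.
  apply: le_trans (sup_density_ge t0 (tp t t0).1); rewrite lee_fin ler_pM2r//.
  rewrite -[leRHS]invrK lef_pV2 ?posrE ?invr_gt0 ?density_lower_cst_gt0//.
  by rewrite /C7_cst; lra.
apply: le_trans (bnd _ t0 tT) _; rewrite lee_fin ler_pM2r// /C7_cst.
by have := lower_ge0; lra.
Qed.

Lemma C7_C1 : C7 A N b P Y -> C1 A N b P Y.
Proof.
move=> [T [c [T0 c1 [p [tp bnd]]]]]; exists p; split => //; exists T, c; split => //.
  exact: lt_le_trans c1.
by move=> t t0 tT; have [] := bnd t t0 tT.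
Qed.

Lemma C1_C2 : C1 A N b P Y -> C2 A N b.
Proof.
move=> [p [tp [T [c [T0 c0 bnd]]]]].
have pd0 : 0 < (2 * pi) ^+ d :> R by rewrite exprn_gt0// mulr_gt0// pi_gt0.
apply: (@C2_of_half _ _ A N b d_gt0 triplet levy_h0 T (c * (2 * pi) ^+ d)) => //.
  by rewrite mulr_gt0.
move=> t t0 tT; rewrite mulrAC.
apply: psi_integral_le_density (ltW t0) (tp t t0).1 _ => x.
by rewrite -lee_fin; apply: le_trans (bnd _ t0 tT); apply: ereal_sup_ubound; exists x.
Qed.

Lemma C2_C7 : C2 A N b -> C7 A N b P Y.
Proof.
move=> [T [c [T0 c0 bnd]]]; exists T, (C7_cst c); split => //.
  by rewrite /C7_cst -addrA lerDl addr_ge0// ltW.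
have l0 := lower_ge0.
by apply: C7_of_psi_integral bnd _ _ => //; rewrite /C7_cst; lra.
Qed.

End density_bounds.

(** * The equivalences and the uniform constants *)

Lemma C3_withS (R : realType) d (A : 'M[R]_d) (N : {measure set 'rV[R]_d -> \bar R})
    (b : 'rV[R]_d) (S T : \bar R) c a : (0 < S)%E -> (S <= T)%E ->
  C3_with A N b T c a -> C3_with A N b S c a.
Proof.
move=> S0 ST [h1 h2]; have ST' : (T^-1 <= S^-1)%E.
  case: T S S0 ST {h1 h2} => [T| |] [S| |]// S0 ST; last first.
  - by rewrite invey inve_ge0 ltW.
  - rewrite lte_fin in S0; rewrite lee_fin in ST.
    have T0 := lt_le_trans S0 ST.
    by rewrite !inver !gt_eqF// lee_fin lef_pV2.
by split => [x xS|l r l1 rS]; [apply: h1|apply: h2] => //; exact: le_lt_trans ST' _.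
Qed.

Theorem corollary3p7 (R : realType) (d : nat) (d_gt0 : (0 < d)%N) :
  (forall (disp : measure_display) (Omega : measurableType disp)
     (P : probability Omega R) (Y : R -> Omega -> 'rV[R]_d)
     (A : 'M[R]_d) (N : {measure set 'rV[R]_d -> \bar R}) (b : 'rV[R]_d),
     levy_setting A N b P Y ->
     [/\ C1 A N b P Y <-> C7 A N b P Y,
         C2 A N b <-> C7 A N b P Y,
         C3 A N b <-> C7 A N b P Y &
         C4 A N b <-> C7 A N b P Y]) /\
  (forall c3 alpha3 : R, 0 < c3 <= 1 -> 0 < alpha3 <= 2 ->
     exists c7 : R, 1 <= c7 /\
     forall (disp : measure_display) (Omega : measurableType disp)
       (P : probability Omega R) (Y : R -> Omega -> 'rV[R]_d)
       (A : 'M[R]_d) (N : {measure set 'rV[R]_d -> \bar R}) (b : 'rV[R]_d),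
       levy_setting A N b P Y ->
     forall T3 : \bar R, (0 < T3)%E -> C3_with A N b T3 c3 alpha3 ->
       C7_with A N b P Y ((levy_hE A N (T3 / c7%:E))^-1)%E c7) /\
  (forall c3 alpha3 T3 T7 : R, 0 < c3 <= 1 -> 0 < alpha3 <= 2 ->
     0 < T3 -> 0 < T7 -> forall h : R -> R,
     exists c7 : R, 1 <= c7 /\
     forall (disp : measure_display) (Omega : measurableType disp)
       (P : probability Omega R) (Y : R -> Omega -> 'rV[R]_d)
       (A : 'M[R]_d) (N : {measure set 'rV[R]_d -> \bar R}) (b : 'rV[R]_d),
       levy_setting A N b P Y ->
       (forall r : R, 0 < r -> levy_h A N r = h r) ->
       C3_with A N b T3%:E c3 alpha3 ->
       C7_with A N b P Y T7%:E c7).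
Proof.
split=> [disp Omega P Y A N b setting|].
  have [_ triplet _ h0] := setting.
  have C27 := C2_C7 d_gt0 setting; have C17 := C1_C7 d_gt0 setting.
  have C71 := @C7_C1 _ _ _ _ P Y A N b; have C12 := C1_C2 d_gt0 setting.
  have C23 : C2 A N b -> C3 A N b by exact: C2_C3.
  have C32 : C3 A N b -> C2 A N b by exact: C3_C2.
  have C34 : C3 A N b -> C4 A N b by exact: C3_C4.
  have C43 : C4 A N b -> C3 A N b by exact: C4_C3.
  by split; split; auto.
have l0 := @density_lower_cst_gt0 R d d_gt0.
have li0 : 0 <= (@density_lower_cst R d)^-1 by rewrite invr_ge0 ltW.
split=> [c3 a3 /andP[c30 _] /andP[a30 _]|c3 a3 T3 T7 /andP[c30 _] /andP[a30 _] T30 T70 h].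
  have K0 := C3_cst_gt0 d a3 c30.
  pose c7 := @C7_cst R d (C3_cst d c3 a3).
  have c71 : 1 <= c7 by rewrite /c7 /C7_cst -addrA lerDl addr_ge0// ltW.
  have c70 : 0 < c7 by apply: lt_le_trans c71.
  exists c7; split => // disp Omega P Y A N b setting T3 T30 C3T.
  have [_ triplet _ h0] := setting.
  (* As c7 >= 1, C3 is inherited by the smaller radius T3 / c7, and the bound then holds up to the
     time 1 / h(T3 / c7). *)
  have [S0 ST] : (0 < T3 / c7%:E)%E /\ (T3 / c7%:E <= T3)%E.
    case: T3 T30 {C3T} => [T3| |]// T30; rewrite inver gt_eqF//.
      rewrite lte_fin in T30; rewrite -EFinM lte_fin lee_fin divr_gt0//.
      by rewrite ler_pdivrMr// ler_pMr.
    by rewrite gt0_mulye ?lte_fin ?invr_gt0.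
  apply: (@C7_of_psi_integral _ _ _ _ P Y A N b d_gt0 setting _ (C3_cst d c3 a3)).
  - exact: (levy_hE_inv_gt0 triplet h0 S0).
  - move=> t t0 tT.
    exact: (C3_psi_integral_levy_hinv triplet h0 S0 c30 a30 (C3_withS S0 ST C3T)).
  - by rewrite /c7 /C7_cst; lra.
  - by rewrite /c7 /C7_cst; lra.
have K0 := C3_cst_gt0 d a3 c30.
(* As h is only known to be levy_h on ]0, +oo[ under the setting below, its
   inverse is taken by choice at the two points that matter. *)
pose hinv y : R := xget 1 [set r | 0 < r /\ h r = y].
(* The factor 2 puts [r0] strictly below T3, where C3 bounds the integral. *)
pose r0 := hinv (2 * h T3); pose r7 := hinv T7^-1.
(* The absolute value gives q >= 0 before anything is known of [h]; under the setting both radii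
   turn out positive. *)
pose q := `|r7 / r0| ^+ d; pose c := C3_cst d c3 a3 * (1 + q).
have q0 : 0 <= q by rewrite exprn_ge0.
have c0 : 0 < c by rewrite mulr_gt0// ltr_pwDl.
exists (@C7_cst R d c); split; first by rewrite /C7_cst -addrA lerDl addr_ge0// ltW.
move=> disp Omega P Y A N b setting hE C3T; have [_ triplet _ h0] := setting.
have hinvP y : 0 < y -> 0 < hinv y /\ levy_h A N (hinv y) = y.
  move=> y0; rewrite /hinv; case: xgetP => [r -> [r_gt0 hr]|/(_ (levy_hinv A N y))].
    by rewrite hE.
  have hy := levy_hinv_gt0 triplet h0 y0.
  by case; split => //; rewrite -hE// levy_hinvK.
have T30e : (0 < T3%:E)%E by rewrite lte_fin.
have hT3 := levy_h_gt0 triplet h0 T30.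
have [r00 hr0] : 0 < r0 /\ levy_h A N r0 = 2 * levy_h A N T3.
  by rewrite (hE _ T30); apply: hinvP; rewrite -hE// mulr_gt0.
have T7i : 0 < T7^-1 by rewrite invr_gt0.
have [r70 hr7] := hinvP _ T7i; rewrite -/r7 in r70 hr7.
have r0T3 : r0 < T3.
  rewrite ltNge; apply/negP => /(levy_h_le triplet h0 T30); rewrite hr0; lra.
apply: (@C7_of_psi_integral _ _ _ _ P Y A N b d_gt0 setting T7%:E c) => //;
  [|by rewrite /C7_cst; lra|by rewrite /C7_cst; lra].
move=> t t0; rewrite lte_fin => tT7.
have ti0 : 0 < t^-1 by rewrite invr_gt0.
have r0' := levy_hinv_gt0 triplet h0 ti0.
have rd0 : 0 < levy_hinv A N t^-1 ^- d by rewrite invr_gt0 exprn_gt0.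
have [tT3|tT3] := ltP t (levy_h A N T3)^-1.
  have tT3' : (t%:E < (levy_hE A N T3%:E)^-1)%E.
    by rewrite /= inver gt_eqF.
  apply: le_trans (C3_psi_integral_levy_hinv triplet h0 T30e c30 a30 C3T t0 tT3') _.
  by rewrite lee_fin ler_pM2r// /c ler_peMr ?(ltW K0)// lerDl.
(* Here t is beyond the reach of C3. By monotonicity the integral is at most its value at 1 / h(r0),
   hence a multiple of r0^-d; since h^-1(1/t) <= r7 for t < T7, the factor q = (r7 / r0)^d converts
   r0^-d into h^-1(1/t)^-d. *)
have tr0 : (levy_h A N r0)^-1 <= t.
  apply: le_trans tT3; rewrite lef_pV2 ?posrE ?hr0 ?mulr_gt0//; lra.
apply: le_trans (le_psi_integral b triplet tr0) _.
apply: le_trans (C3_psi_integral_le triplet h0 T30e c30 a30 C3T r00 r0T3) _.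
rewrite lee_fin /c -mulrA ler_pM2l//.
have rr7 : levy_hinv A N t^-1 <= r7.
  apply: levy_hinv_le => //; rewrite hr7 lef_pV2 ?posrE// ltW//.
apply: (@le_trans _ _ (q * levy_hinv A N t^-1 ^- d)); last first.
  by rewrite ler_wpM2r ?(ltW rd0)// lerDr.
rewrite /q ger0_norm ?divr_ge0 ?(ltW r70) ?(ltW r00)//.
rewrite expr_div_n mulrAC ler_pMl ?invr_gt0 ?exprn_gt0//.
rewrite ler_pdivlMr ?exprn_gt0// mul1r lerXn2r ?nnegrE ?(ltW r0') ?(ltW r70)//.
Qed.
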